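(* Let $(M^m,g,J)$ be a (connected) Kähler manifold of complex dimension $m\geq 2$. (1) If $M$ has $\alpha$-nonnegative (respectively, $\alpha$-nonpositive) curvature operator of the second kind for some $\alpha<\frac{3}{2}(m^2-1)$, then $M$ is flat. (2) If $M$ has $\frac{3}{2}(m^2-1)$-nonnegative (respectively, $\frac{3}{2}(m^2-1)$-nonpositive) curvature operator of the second kind, then $M$ has constant nonnegative (respectively, nonpositive) holomorphic sectional curvature.
   Context: Sign convention: the Riemann curvature tensor $R$ is normalized so that $R(X,Y,X,Y)$ is the sectional curvature of the plane spanned by orthonormal $X,Y$ (positive on round spheres). For a Riemannian manifold $(M^n,g)$ and $p\in M$, let $S^2_0(T_pM)$ be the space of traceless symmetric two-tensors on $T_pM$ with inner product $\langle A,B\rangle=\operatorname{tr}(A^TB)$, and let $N=\dim S^2_0(T_pM)=\frac{(n-1)(n+2)}{2}$. The curvature operator of the second kind is the symmetric bilinear form on $S^2_0(T_pM)$ given in an orthonormal basis by $\mathring{R}(\varphi,\psi)=\sum_{i,j,k,l=1}^n R_{ijkl}\varphi_{il}\psi_{jk}$. For a real number $\alpha\in[1,N]$, $(M,g)$ has $\alpha$-nonnegative (respectively, $\alpha$-positive) curvature operator of the second kind if for every $p\in M$ and every orthonormal basis $\{\varphi_i\}_{i=1}^N$ of $S^2_0(T_pM)$, $$\sum_{i=1}^{\lfloor\alpha\rfloor}\mathring{R}(\varphi_i,\varphi_i)+(\alpha-\lfloor\alpha\rfloor)\mathring{R}(\varphi_{\lfloor\alpha\rfloor+1},\varphi_{\lfloor\alpha\rfloor+1})\geq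 0\quad(\text{respectively, }>0),$$ where the last term is absent when $\alpha$ is an integer. It has $\alpha$-nonpositive (respectively, $\alpha$-negative) curvature operator of the second kind if the reversed inequality $\le 0$ (respectively, $<0$) always holds. A Kähler manifold of complex dimension $m$ has real dimension $n=2m$. The holomorphic sectional curvature of a unit tangent vector $X$ is $R(X,JX,X,JX)$; it is constant if it takes the same value for all unit tangent vectors at all points. Completeness is not assumed. *)

(* Defs.v *)
From HB Require Import structures.
From mathcomp Require Import all_boot all_order all_algebra.
From mathcomp Require Import boolp classical_sets functions reals.
From mathcomp Require Import topology normedtype derive.

Set Implicit Arguments.
Unset Strict Implicit.
Unset Printing Implicit Defensive.

Import Order.TTheory GRing.Theory Num.Theory.
Import numFieldNormedType.Exports.

Local Open Scope classical_set_scope.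
Local Open Scope ring_scope.

(* Tangent vectors are written in coordinates as row vectors, and linear maps *)
(* act on them from the right.                                                *)

Section Smooth.
Context {R : realType} {n : nat}.

Definition partial (i : 'I_n) (f : 'rV[R]_n -> R) : 'rV[R]_n -> R :=
  fun x => 'D_(delta_mx ord0 i) f x.

(* C^oo on an open set U; continuity of the iterated partial derivatives      *)
(* follows from their differentiability.                                      *)
Definition smooth_on (U : set 'rV[R]_n) (f : 'rV[R]_n -> R) : Prop :=
  forall (s : seq 'I_n) (x : 'rV[R]_n), U x ->
    differentiable (foldr partial f s) x.

End Smooth.

(* [chart_inv] is only meaningful on the image of [chart_dom].                *)
Record chart (R : realType) (n : nat) (M : topologicalType) := Chart {
  chart_dom : set M;
  chart_map : M -> 'rV[R]_n;
  chart_inv : 'rV[R]_n -> M;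
  chart_dom_open : open chart_dom;
  chart_img_open : open (chart_map @` chart_dom);
  chart_mapK : forall p, chart_dom p -> chart_inv (chart_map p) = p;
  chart_map_cont : forall p, chart_dom p -> {for p, continuous chart_map};
  chart_inv_cont : forall x, (chart_map @` chart_dom) x ->
    {for x, continuous chart_inv} }.

Definition transition (R : realType) (n : nat) (M : topologicalType)
    (a b : chart R n M) : 'rV[R]_n -> 'rV[R]_n :=
  fun x => chart_map b (chart_inv a x).

Record manifold (R : realType) (n : nat) := Manifold {
  man_space :> topologicalType;
  man_hausdorff : hausdorff_space man_space;
  man_second_countable : @second_countable man_space;
  man_index : Type;
  man_chart : man_index -> chart R n man_space;
  man_cover : forall p : man_space, exists a, chart_dom (man_chart a) p;
  man_smooth : forall (a b : man_index) (k : 'I_n),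
    smooth_on
      (chart_map (man_chart a) @`
        (chart_dom (man_chart a) `&` chart_dom (man_chart b)))
      (fun x => transition (man_chart a) (man_chart b) x ord0 k) }.

(* A tensor field of rank 2 is given by its matrix of components in every     *)
(* chart, smooth and obeying the tensor transformation law.                   *)
Record riemannian_metric (R : realType) (n : nat) (M : manifold R n) :=
  RiemannianMetric {
  metric_mx : man_index M -> 'rV[R]_n -> 'M[R]_n;
  metric_smooth : forall a i j,
    smooth_on (chart_map (man_chart a) @` chart_dom (man_chart a))
      (fun x => metric_mx a x i j);
  metric_sym : forall a p, chart_dom (man_chart a) p ->
    (metric_mx a (chart_map (man_chart a) p))^T =
    metric_mx a (chart_map (man_chart a) p);
  metric_pos : forall a p (v : 'rV[R]_n), chart_dom (man_chart a) p ->
    v != 0 ->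
    0 < (v *m metric_mx a (chart_map (man_chart a) p) *m v^T) ord0 ord0;
  metric_change : forall a b p,
    chart_dom (man_chart a) p -> chart_dom (man_chart b) p ->
    let x := chart_map (man_chart a) p in
    let y := chart_map (man_chart b) p in
    let D := 'J (transition (man_chart a) (man_chart b)) x in
    metric_mx a x = D *m metric_mx b y *m D^T }.

Record almost_complex_structure (R : realType) (n : nat) (M : manifold R n) :=
  AlmostComplexStructure {
  acs_mx : man_index M -> 'rV[R]_n -> 'M[R]_n;
  acs_smooth : forall a i j,
    smooth_on (chart_map (man_chart a) @` chart_dom (man_chart a))
      (fun x => acs_mx a x i j);
  acs_sqr : forall a p, chart_dom (man_chart a) p ->
    acs_mx a (chart_map (man_chart a) p) *m
    acs_mx a (chart_map (man_chart a) p) = - 1%:M;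
  acs_change : forall a b p,
    chart_dom (man_chart a) p -> chart_dom (man_chart b) p ->
    let x := chart_map (man_chart a) p in
    let y := chart_map (man_chart b) p in
    let D := 'J (transition (man_chart a) (man_chart b)) x in
    acs_mx a x *m D = D *m acs_mx b y }.

Section LocalGeometry.
Context {R : realType} {n : nat}.
Variable g : 'rV[R]_n -> 'M[R]_n.

(* Gamma^k_{ij} of the Levi-Civita connection                                 *)
Definition christoffel (k i j : 'I_n) (x : 'rV[R]_n) : R :=
  2^-1 * \sum_l invmx (g x) k l *
    (partial i (fun y => g y j l) x + partial j (fun y => g y i l) x
     - partial l (fun y => g y i j) x).

(* (nabla_l J)_i^k, where J(d_i) = sum_k J_i^k d_k                            *)
Definition cov_deriv_endo (J : 'rV[R]_n -> 'M[R]_n) (l i k : 'I_n)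
    (x : 'rV[R]_n) : R :=
  partial l (fun y => J y i k) x
  + \sum_p (christoffel k l p x * J x i p - christoffel p l i x * J x p k).

(* R_{ijkl} = <nabla_i nabla_j d_l - nabla_j nabla_i d_l, d_k>, so that       *)
(* R(X,Y,X,Y) is the sectional curvature of an orthonormal pair X, Y.         *)
Definition riemann_coef (i j k l : 'I_n) (x : 'rV[R]_n) : R :=
  \sum_p g x k p *
    (partial i (christoffel p j l) x - partial j (christoffel p i l) x
     + \sum_q (christoffel p i q x * christoffel q j l x
               - christoffel p j q x * christoffel q i l x)).

Definition riemann (x X Y Z W : 'rV[R]_n) : R :=
  \sum_i \sum_j \sum_k \sum_l
    riemann_coef i j k l x *
    X ord0 i * Y ord0 j * Z ord0 k * W ord0 l.

(* the rows of E are the vectors of the frame                                 *)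
Definition orthonormal_frame (x : 'rV[R]_n) (E : 'M[R]_n) : Prop :=
  E *m g x *m E^T = 1%:M.

Definition second_kind (x : 'rV[R]_n) (E phi psi : 'M[R]_n) : R :=
  \sum_i \sum_j \sum_k \sum_l
    riemann x (row i E) (row j E) (row k E) (row l E) * phi i l * psi j k.

End LocalGeometry.

Section TracelessSymmetric.
Context {R : realType} {n : nat}.

Definition S20 (A : 'M[R]_n) : Prop := A^T = A /\ \tr A = 0.

Definition dimS20 : nat := ((n - 1) * (n + 2) %/ 2)%N.

Definition orthonormal_basisS20 (phi : 'I_dimS20 -> 'M[R]_n) : Prop :=
  [/\ forall i, S20 (phi i),
      forall i j, \tr ((phi i)^T *m phi j) = (i == j)%:R &
      forall A, S20 A -> exists c : 'I_dimS20 -> R,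
        A = \sum_i c i *: phi i].

End TracelessSymmetric.
Arguments dimS20 n : clear implicits.

(* The last sum has at most one term, and none when alpha = N.                *)
Definition alpha_sum (R : realType) (N : nat) (alpha : R) (u : 'I_N -> R) : R :=
  let k := Num.truncn alpha in
  \sum_(i < N | (i < k)%N) u i
  + (alpha - k%:R) * \sum_(i < N | i == k :> nat) u i.

Section CurvatureOperatorSecondKind.
Context {R : realType} {n : nat} (M : manifold R n) (g : riemannian_metric M).

Definition alpha_nonnegative (alpha : R) : Prop :=
  1 <= alpha <= (dimS20 n)%:R /\
  forall a p, chart_dom (man_chart a) p ->
  let x := chart_map (man_chart a) p in
  forall E, orthonormal_frame (metric_mx g a) x E ->
  forall phi : 'I_(dimS20 n) -> 'M[R]_n, orthonormal_basisS20 phi ->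
  0 <= alpha_sum alpha
         (fun i => second_kind (metric_mx g a) x E (phi i) (phi i)).

Definition alpha_nonpositive (alpha : R) : Prop :=
  1 <= alpha <= (dimS20 n)%:R /\
  forall a p, chart_dom (man_chart a) p ->
  let x := chart_map (man_chart a) p in
  forall E, orthonormal_frame (metric_mx g a) x E ->
  forall phi : 'I_(dimS20 n) -> 'M[R]_n, orthonormal_basisS20 phi ->
  alpha_sum alpha
    (fun i => second_kind (metric_mx g a) x E (phi i) (phi i)) <= 0.

Definition flat : Prop :=
  forall a p, chart_dom (man_chart a) p ->
  forall X Y Z W,
    riemann (metric_mx g a) (chart_map (man_chart a) p) X Y Z W = 0.

End CurvatureOperatorSecondKind.

Record kahler_manifold (R : realType) (m : nat) := KahlerManifold {
  kahler_man :> manifold R (2 * m);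
  kahler_metric : riemannian_metric kahler_man;
  kahler_J : almost_complex_structure kahler_man;
  kahler_hermitian : forall a p, chart_dom (man_chart a) p ->
    let x := chart_map (man_chart a) p in
    acs_mx kahler_J a x *m metric_mx kahler_metric a x
      *m (acs_mx kahler_J a x)^T = metric_mx kahler_metric a x;
  kahler_parallel : forall a p l i k, chart_dom (man_chart a) p ->
    cov_deriv_endo (metric_mx kahler_metric a) (acs_mx kahler_J a) l i k
      (chart_map (man_chart a) p) = 0 }.

Definition has_constant_hsc (R : realType) (m : nat) (M : kahler_manifold R m)
    (c : R) : Prop :=
  forall a p, chart_dom (man_chart a) p ->
  let x := chart_map (man_chart a) p in
  let g := metric_mx (kahler_metric M) a in
  let J := acs_mx (kahler_J M) a x in
  forall X : 'rV[R]_(2 * m), (X *m g x *m X^T) ord0 ord0 = 1 ->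
    riemann g x X (X *m J) X (X *m J) = c.

(* Main.v *)
From HB Require Import structures.
Require Import Defs.
From mathcomp Require Import all_boot all_order all_algebra.
From mathcomp Require Import boolp classical_sets functions reals.
From mathcomp Require Import topology normedtype landau derive.
From mathcomp Require Import ring lra.
Import Order.TTheory GRing.Theory Num.Theory.
Import numFieldNormedType.Exports.
Local Open Scope classical_set_scope.
Local Open Scope ring_scope.
Set Implicit Arguments.
Unset Strict Implicit.
Unset Printing Implicit Defensive.

(** At a point p of a Kähler manifold of real dimension n = 2m, the traceless
    symmetric tensors split orthogonally into the J-invariant ones, of dimension
    m^2 - 1, and the J-anti-invariant ones, of dimension m(m + 1). The traces of
    the curvature operator of the second kind on these two spaces are
    -(m - 1)/(2m) S and S, where S is the scalar curvature. Nonnegativity of the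
    alpha-sums for all orthonormal bases gives [0 <= \sum_i w_i u_i] for all
    weights w in [0, 1] of total mass at least alpha, where the u_i are the
    values of the form on an orthonormal basis. Full weights give S >= 0. Weight
    1 on the invariant part and constant weight on the anti-invariant part, with
    total mass 3/2 (m^2 - 1), give exactly 0; so for alpha < 3/2 (m^2 - 1) a
    slightly smaller mass gives S <= 0, and for alpha <= 3/2 (m^2 - 1)
    perturbing the weight of a single anti-invariant vector in both directions
    forces the form to be constant on the unit anti-invariant tensors. Its value
    at (X X - JX JX) / sqrt 2 is the holomorphic sectional curvature of X, which
    is therefore S / (m(m + 1)) for every unit X at p. When S = 0, polarization
    gives flatness. In general the curvature tensor at p is that of a complex
    space form, so the Ricci form is a constant multiple of c omega, where c is
    the holomorphic sectional curvature and omega the Kähler form; both forms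
    are closed, hence dc /\ omega = 0 and dc = 0 as n > 2. Tensoriality of the
    curvature under changes of chart and connectedness make c constant. *)

(** The anti-invariant weight that balances the invariant trace is t = (m - 1)/(2m), and t m(m + 1)
    = (m^2 - 1)/2: this is the origin of 3/2 (m^2 - 1). For m >= 2 it lies in [1/4, 1/2], strictly
    inside (0, 1), which leaves room to perturb weights both ways. No basis of either space is
    written down: a basis enters only through its orthogonal projection, whose trace gives the
    dimension and whose pairing with the curvature gives the trace of the form. The nonpositive case
    is the nonnegative one for -R, because the pointwise argument only uses symmetries shared by -R.
    On the analytic side the curvature is computed from connection matrices, and its behaviour under
    a change of chart is derived from the uniqueness of the Levi-Civita connection instead of a
    computation with Christoffel symbols. *)

Section Weights.
Context {R : realType}.

(** Among weights in [0, 1] of mass [alpha], the weighted sum is smallest when the mass fills the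
    smallest values of [u] first. For an enumeration sorting [u], that minimum is the
    [alpha_sum]. *)
Lemma alpha_sum_weighted_ge0 (I : finType) (N : nat) (u : I -> R) (alpha : R)
    (w : I -> R) :
  #|I| = N -> 1 <= alpha <= N%:R ->
  (forall e : 'I_N -> I, bijective e -> 0 <= alpha_sum alpha (u \o e)) ->
  (forall i, 0 <= w i <= 1) -> alpha <= \sum_i w i ->
  0 <= \sum_i w i * u i.
Proof.
move=> cardI /andP[a1 aN] hu hw hsw.
have a0 : 0 <= alpha by lra.
have N0 : (0 < N)%N by rewrite -(ltr_nat R); lra.
have [i0] : exists i0 : I, true.
  by move: N0; rewrite -cardI => /card_gt0P[i _]; exists i.
move=> _.
pose leu := [rel x y | u x <= u y].
pose s := sort leu (enum I).
have ss : size s = N by rewrite size_sort -cardT cardI.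
have us : uniq s by rewrite sort_uniq enum_uniq.
have sorted_s : sorted leu s by apply: sort_sorted => x y /=; exact: le_total.
pose e (i : 'I_N) := nth i0 s i.
have inj_e : injective e.
  move=> i j /eqP; rewrite /e nth_uniq ?ss ?ltn_ord// => /eqP ij.
  exact: val_inj.
have bij_e : bijective e by apply: inj_card_bij => //; rewrite card_ord cardI.
have mono_e (i j : 'I_N) : (i <= j)%N -> u (e i) <= u (e j).
  move=> ij; apply: (@sorted_leq_nth _ leu) => //=.
  - by move=> y x z /=; exact: le_trans.
  - by move=> x /=; exact: lexx.
  - by rewrite unfold_in /= ss.
  - by rewrite unfold_in /= ss.
have := hu e bij_e; rewrite /alpha_sum.
have /andP[] := truncn_itv a0; set k := Num.truncn alpha => ka ak.
have sum_e (F : I -> R) : \sum_i F i = \sum_(i < N) F (e i).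
  by rewrite (reindex e) //; exact: onW_bij.
rewrite sum_e in hsw; rewrite sum_e.
have kN : (k <= N)%N by rewrite -(ler_nat R); lra.
(* If [k] reaches [N], then [alpha] is [N] itself: all weights are 1 and the fractional term of
   [alpha_sum] is empty. *)
have [kltN|Nk] := ltnP k N; last first.
  have {Nk}kN : k = N by apply/eqP; rewrite eqn_leq kN.
  have w1 i : w (e i) = 1.
    have := hw (e i); move: hsw.
    rewrite (bigD1 i) //= => hsw /andP[_ hi].
    have : \sum_(j < N | j != i) w (e j) <= \sum_(j < N | j != i) 1.
      by apply: ler_sum => j _; case/andP: (hw (e j)).
    rewrite big_const_seq iter_addr_0 -sum1_count.
    have -> : (\sum_(j <- index_enum 'I_N | j != i) 1 = N.-1)%N.
      by rewrite sum1_card cardC1 card_ord.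
    rewrite -subn1 natrB //; move: ka; rewrite kN => ka h; lra.
  rewrite (eq_bigl xpredT); last by move=> i; rewrite kN ltn_ord.
  rewrite (_ : \sum_(i < N | _ == k) _ = 0); last first.
    by rewrite big_pred0 // => i; rewrite kN ltn_eqF.
  rewrite mulr0 addr0 => h; apply: le_trans h _.
  by apply: ler_sum => i _; rewrite w1 mul1r.
pose o := Ordinal kltN.
rewrite [X in _ * X](big_pred1 o) // => hs.
(* The threshold at the fractional position: [w - w0] is at most 0 before it and at least 0 after
   it, and so is [u - t]; hence every product in [key] is nonnegative. *)
pose t := u (e o).
pose w0 (i : 'I_N) : R := if (i < k)%N then 1 else if i == o then alpha - k%:R
  else 0.
have hs0 : \sum_i w0 i * u (e i) = \sum_(i < N | (i < k)%N) u (e i)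
             + (alpha - k%:R) * u (e o).
  rewrite (bigID (fun i : 'I_N => (i < k)%N)) /=; congr (_ + _).
    by apply: eq_bigr => i ik; rewrite /w0 ik mul1r.
  rewrite (bigD1 o) ?ltnn //= /w0 ltnn eqxx big1 ?addr0 // => i /andP[ik io].
  by rewrite (negbTE ik) (negbTE io) mul0r.
have sw0 : \sum_i w0 i = alpha.
  rewrite (bigID (fun i : 'I_N => (i < k)%N)) /=.
  rewrite (eq_bigr (fun=> 1)); last by move=> i ik; rewrite /w0 ik.
  rewrite big_const_seq iter_addr_0 -sum1_count.
  have -> : (\sum_(j <- index_enum 'I_N | (j < k)%N) 1 = k)%N.
    rewrite -(big_ord_widen N (fun=> 1%N)) ?sum1_card ?card_ord //; exact: ltnW.
  rewrite (bigD1 o) ?ltnn //= /w0 ltnn eqxx big1 ?addr0; first by ring.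
  by move=> i /andP[ik io]; rewrite (negbTE ik) (negbTE io).
have key : 0 <= \sum_i (w (e i) - w0 i) * (u (e i) - t).
  apply: sumr_ge0 => i _; rewrite /w0; case/andP: (hw (e i)) => h0 h1.
  have [ik|ki] := ltnP i k.
    apply: mulr_le0; first by lra.
    by rewrite subr_le0; apply: mono_e; exact: ltnW.
  case: eqVneq => [->|_]; first by rewrite /t subrr mulr0.
  apply: mulr_ge0; first by lra.
  by rewrite subr_ge0; apply: mono_e.
have expand : \sum_i (w (e i) - w0 i) * (u (e i) - t) =
    \sum_i w (e i) * u (e i) - \sum_i w0 i * u (e i)
    - t * (\sum_i w (e i) - \sum_i w0 i).
  rewrite mulrBr !mulr_sumr -!sumrB; apply: eq_bigr => i _; ring.
rewrite sw0 hs0 in expand; rewrite expand in key.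
(* The mass of [w] may exceed [alpha]; the excess is harmless when [t] is nonnegative. A negative
   [t] is impossible, since all values weighted by [w0] would then be negative. *)
have [t0|t0] := leP 0 t.
  have h : 0 <= t * (\sum_i w (e i) - alpha).
    by apply: mulr_ge0 => //; rewrite subr_ge0.
  rewrite /= in hs; lra.
suff : \sum_i w0 i * u (e i) < 0 by rewrite hs0; rewrite /= in hs; lra.
have le_t : \sum_i w0 i * u (e i) <= \sum_i w0 i * t.
  apply: ler_sum => i _; rewrite /w0; have [ik|ki] := ltnP i k.
    by rewrite !mul1r; apply: mono_e; exact: ltnW.
  by case: eqVneq => [->|_]; rewrite ?mul0r.
apply: le_lt_trans le_t _; rewrite -mulr_suml sw0 pmulr_rlt0 //; lra.
Qed.

End Weights.

(** * Orthonormal bases of the image of an orthogonal projection *)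

Section OrthonormalFamilies.
Context {R : realType} {V : vectType R} (B : V -> V -> R).
Hypothesis Blin : forall a x y z, B (a *: x + y) z = a * B x z + B y z.
Hypothesis Bsym : forall x y, B x y = B y x.
Hypothesis Bpos : forall x, x != 0 -> 0 < B x x.

Let B0l x : B 0 x = 0.
Proof. by have := Blin (-1) x x x; rewrite scaleN1r addNr mulN1r addNr. Qed.
Let BDl x y z : B (x + y) z = B x z + B y z.
Proof. by rewrite -[x]scale1r Blin mul1r scale1r. Qed.
Let BZl a x z : B (a *: x) z = a * B x z.
Proof. by rewrite -[a *: x]addr0 Blin B0l addr0. Qed.
Let Bsum (I : Type) (r : seq I) (F : I -> V) z :
  B (\sum_(i <- r) F i) z = \sum_(i <- r) B (F i) z.
Proof. exact: (big_morph (B^~ z) (fun x y => BDl x y z) (B0l z)). Qed.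

(** A sequence truncated at [r], rather than a family on ['I_r], so that it can be lengthened
    without changing its type. *)
Definition orthonormal_upto (q : nat -> V) (r : nat) : Prop :=
  forall i j, (i < r)%N -> (j < r)%N -> B (q i) (q j) = (i == j)%:R.

Lemma orthonormal_upto_dim (q : nat -> V) (r : nat) :
  orthonormal_upto q r -> (r <= \dim {:V})%N.
Proof.
move=> oq; pose X := [tuple q i | i < r].
have fX : free X.
  apply/freeP => k hk i.
  have := congr1 (B^~ (q i)) hk; rewrite /= B0l Bsum (bigD1 i) //= BZl.
  rewrite (nth_map i) ?size_enum_ord // nth_ord_enum oq // eqxx mulr1.
  rewrite big1 ?addr0 // => j ji.
  rewrite BZl (nth_map i) ?size_enum_ord // nth_ord_enum oq //.
  by rewrite val_eqE (negbTE ji) mulr0.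
rewrite -[r](size_tuple X); move: fX; rewrite /free => /eqP <-.
by apply: dimvS; exact: subvf.
Qed.

Lemma orthonormal_upto_rcons (q : nat -> V) (r : nat) (u : V) :
  orthonormal_upto q r -> B u u = 1 -> (forall i, (i < r)%N -> B u (q i) = 0) ->
  orthonormal_upto (fun i => if (i < r)%N then q i else u) r.+1.
Proof.
move=> oq uu qu i j; rewrite !ltnS => ir jr.
have [ir'|ri] := ltnP i r; have [jr'|rj] := ltnP j r.
- exact: oq.
- by rewrite Bsym qu // ltn_eqF // (leq_trans ir').
- by rewrite qu // gtn_eqF // (leq_trans jr').
- by rewrite uu (_ : i = j) ?eqxx //; apply/eqP;
  rewrite eqn_leq (leq_trans ir rj) (leq_trans jr ri).
Qed.

Section Projection.
Variable P : V -> V.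
Hypothesis Plin : forall a x y, P (a *: x + y) = a *: P x + P y.
Hypothesis PP : forall x, P (P x) = P x.
Hypothesis Psa : forall x y, B (P x) y = B x (P y).

Let P0 : P 0 = 0.
Proof. by have := Plin (-1) 0 0; rewrite !scaleN1r !addNr. Qed.
Let PD x y : P (x + y) = P x + P y.
Proof. by rewrite -[x]scale1r Plin !scale1r. Qed.
Let PZ a x : P (a *: x) = a *: P x.
Proof. by rewrite -[a *: x]addr0 Plin P0 addr0. Qed.

(** The failing expansion provides the vector: [P x] minus its expansion lies in the image of [P]
    and is orthogonal to the family, because [P] is self-adjoint and fixes each [q i]. It only has
    to be normalized. *)
Lemma orthonormal_upto_complement (q : nat -> V) (r : nat) (x : V) :
  orthonormal_upto q r -> (forall i, (i < r)%N -> P (q i) = q i) ->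
  P x != \sum_(i < r) B (q i) x *: q i ->
  exists u, [/\ B u u = 1, P u = u & forall i, (i < r)%N -> B u (q i) = 0].
Proof.
move=> oq Pq; rewrite -subr_eq0; set v := _ - _ => v0.
have Bvv := Bpos v0.
have Pv : P v = v.
  rewrite /v addrC -scaleN1r Plin PP; congr (_ *: _ + _).
  rewrite (big_morph P PD P0); apply: eq_bigr => i _; by rewrite PZ Pq.
have qv (i : nat) : (i < r)%N -> B v (q i) = 0.
  move=> ir; rewrite /v addrC -scaleN1r Blin Psa Pq // Bsum.
  rewrite (bigD1 (Ordinal ir)) //= BZl oq // eqxx mulr1 big1 ?addr0.
    by rewrite Bsym mulN1r addNr.
  move=> j ji; rewrite BZl oq //.
  by move: ji; rewrite -(inj_eq val_inj) /= => /negbTE ->; rewrite mulr0.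
exists ((Num.sqrt (B v v))^-1 *: v); split.
- rewrite BZl Bsym BZl mulrA -expr2 exprVn sqr_sqrtr ?mulVf ?gt_eqF //.
  exact: ltW.
- by rewrite PZ Pv.
- by move=> i ir; rewrite BZl qv // mulr0.
Qed.

(** Induction on the number of dimensions left. The new family is an orthonormal basis of the image
    of [P]; its length remains to be computed from a trace. *)
Lemma orthonormal_upto_extend (q : nat -> V) (r : nat) :
  orthonormal_upto q r -> (forall i, (i < r)%N -> P (q i) = q i) ->
  exists q' r', [/\ (r <= r')%N, forall i, (i < r)%N -> q' i = q i,
    orthonormal_upto q' r', forall i, (i < r')%N -> P (q' i) = q' i &
    forall x, P x = \sum_(i < r') B (q' i) x *: q' i].
Proof.
move: {2}(\dim {:V} - r)%N (leqnn (\dim {:V} - r)%N) => d.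
elim: d q r => [|d IH] q r hd oq Pq;
    case: (pselect (forall x, P x = \sum_(i < r) B (q i) x *: q i)) => [h|];
    try by exists q, r; split.
all: move=> /existsNP[x /eqP] hx;
  have [u [uu Pu qu]] := orthonormal_upto_complement oq Pq hx;
  have oq1 := orthonormal_upto_rcons oq uu qu; have := orthonormal_upto_dim oq1.
  (* With no dimension left, one more orthonormal vector would exceed the dimension. *)
  move: hd; rewrite leqn0 subn_eq0 => h1 h2.
  by have := leq_trans h2 h1; rewrite ltnn.
move=> hr.
have [||q' [r' [h1 h2 h3 h4 h5]]] := IH _ r.+1 _ oq1.
- by rewrite subnS -subn1 leq_subLR add1n.
- by move=> i _; case: ltnP => [/Pq //|_].
exists q', r'; split => //; first exact: ltnW.
by move=> i ir; rewrite h2 ?ir // ltnS ltnW.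
Qed.

End Projection.
End OrthonormalFamilies.

(** * Algebraic Kähler curvature tensors *)

Section KahlerTensors.
Context {R : realType} {V : lmodType R}.

(** Linearity is required in the first slot only; in the others it follows from the antisymmetries
    and the pair symmetry [kt_pair]. *)
Record kahler_tensor (J : V -> V) (D : V -> V -> V -> V -> R) : Prop := {
  kt_lin : forall a X X' Y Z W,
    D (a *: X + X') Y Z W = a * D X Y Z W + D X' Y Z W;
  kt_anti12 : forall X Y Z W, D Y X Z W = - D X Y Z W;
  kt_anti34 : forall X Y Z W, D X Y W Z = - D X Y Z W;
  kt_bianchi : forall X Y Z W, D X Y Z W + D Y Z X W + D Z X Y W = 0;
  kt_J : forall X Y Z W, D X Y (J Z) (J W) = D X Y Z W }.

Lemma kahler_tensorN J D : kahler_tensor J D ->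
  kahler_tensor J (fun X Y Z W => - D X Y Z W).
Proof.
case=> h1 h2 h3 h4 h5; split=> X Y Z W.
- by move=> T U; rewrite h1; ring.
- by rewrite h2.
- by rewrite h3.
- by have := h4 X Y Z W => h; lra.
- by rewrite h5.
Qed.

Variables (J : V -> V) (D : V -> V -> V -> V -> R).
Hypothesis Jlin : forall a X Y, J (a *: X + Y) = a *: J X + J Y.
Hypothesis JJ : forall X, J (J X) = - X.
Hypothesis HD : kahler_tensor J D.

(** A linear combination of four Bianchi identities, whose terms the antisymmetries identify. *)
Lemma kt_pair X Y Z W : D X Y Z W = D Z W X Y.
Proof.
have [_ a b c _] := HD.
have := c X Y Z W; have := c Y Z W X; have := c Z W X Y; have := c W X Y Z.
rewrite (b Z W X Y) (b W X Y Z) (a Z X W Y) (b X Y Z W) (a W Y X Z) (b W Y Z X).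
rewrite (b Y Z W X) (b Z X W Y) => *; lra.
Qed.

Let Dlin1 a X X' Y Z W : D (a *: X + X') Y Z W = a * D X Y Z W + D X' Y Z W.
Proof. exact: (kt_lin HD). Qed.
Let Dlin2 a X X' Y Z W : D Y (a *: X + X') Z W = a * D Y X Z W + D Y X' Z W.
Proof. by rewrite ![D Y _ _ _](kt_anti12 HD) Dlin1; ring. Qed.
Let Dlin3 a X X' Y Z W : D Y Z (a *: X + X') W = a * D Y Z X W + D Y Z X' W.
Proof. by rewrite ![D Y Z _ _]kt_pair Dlin1. Qed.
Let Dlin4 a X X' Y Z W : D Y Z W (a *: X + X') = a * D Y Z W X + D Y Z W X'.
Proof. by rewrite ![D Y Z _ _]kt_pair Dlin2. Qed.

Let addE (X Y : V) : X + Y = 1 *: X + Y. Proof. by rewrite scale1r. Qed.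
Lemma kt_D1 X X' Y Z W : D (X + X') Y Z W = D X Y Z W + D X' Y Z W.
Proof. by rewrite [X + _]addE Dlin1 mul1r. Qed.
Lemma kt_D2 X X' Y Z W : D Y (X + X') Z W = D Y X Z W + D Y X' Z W.
Proof. by rewrite [X + _]addE Dlin2 mul1r. Qed.
Lemma kt_D3 X X' Y Z W : D Y Z (X + X') W = D Y Z X W + D Y Z X' W.
Proof. by rewrite [X + _]addE Dlin3 mul1r. Qed.
Lemma kt_D4 X X' Y Z W : D Y Z W (X + X') = D Y Z W X + D Y Z W X'.
Proof. by rewrite [X + _]addE Dlin4 mul1r. Qed.
Lemma kt_01 Y Z W : D 0 Y Z W = 0.
Proof. by have := kt_D1 0 0 Y Z W; rewrite addr0 => h; lra. Qed.
Lemma kt_02 Y Z W : D Y 0 Z W = 0.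
Proof. by rewrite (kt_anti12 HD) kt_01 oppr0. Qed.
Lemma kt_03 Y Z W : D Y Z 0 W = 0.
Proof. by rewrite kt_pair kt_01. Qed.
Lemma kt_04 Y Z W : D Y Z W 0 = 0.
Proof. by rewrite kt_pair kt_02. Qed.
Lemma kt_Z1 a X Y Z W : D (a *: X) Y Z W = a * D X Y Z W.
Proof. by rewrite -[a *: X]addr0 Dlin1 kt_01 addr0. Qed.
Lemma kt_Z2 a X Y Z W : D Y (a *: X) Z W = a * D Y X Z W.
Proof. by rewrite -[a *: X]addr0 Dlin2 kt_02 addr0. Qed.
Lemma kt_Z3 a X Y Z W : D Y Z (a *: X) W = a * D Y Z X W.
Proof. by rewrite -[a *: X]addr0 Dlin3 kt_03 addr0. Qed.
Lemma kt_Z4 a X Y Z W : D Y Z W (a *: X) = a * D Y Z W X.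
Proof. by rewrite -[a *: X]addr0 Dlin4 kt_04 addr0. Qed.
Lemma kt_N1 X Y Z W : D (- X) Y Z W = - D X Y Z W.
Proof. by rewrite -scaleN1r kt_Z1 mulN1r. Qed.
Lemma kt_N2 X Y Z W : D Y (- X) Z W = - D Y X Z W.
Proof. by rewrite -scaleN1r kt_Z2 mulN1r. Qed.
Lemma kt_N3 X Y Z W : D Y Z (- X) W = - D Y Z X W.
Proof. by rewrite -scaleN1r kt_Z3 mulN1r. Qed.
Lemma kt_N4 X Y Z W : D Y Z W (- X) = - D Y Z W X.
Proof. by rewrite -scaleN1r kt_Z4 mulN1r. Qed.

Let JD X Y : J (X + Y) = J X + J Y.
Proof. by rewrite [X + _]addE Jlin scale1r. Qed.
Let JN X : J (- X) = - J X.
Proof.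
have J0 : J 0 = 0 by have := Jlin (-1) 0 0; rewrite !scaleN1r !addNr.
by rewrite -[- X]addr0 -scaleN1r Jlin J0 scaleN1r addr0.
Qed.

Lemma kt_J34_swap X Y Z W : D X Y Z (J W) = D X Y W (J Z).
Proof.
by rewrite -[LHS](kt_J HD) JJ kt_N4 (kt_anti34 HD _ _ W (J Z)) opprK.
Qed.

Lemma kt_J12_swap X Y Z W : D X (J Y) Z W = D Y (J X) Z W.
Proof. by rewrite kt_pair kt_J34_swap kt_pair. Qed.

(** The Bianchi identity with [J] moved across pairs of slots. Both the polarization below and the
    trace computation use it to replace bisectional terms by sectional ones. *)
Lemma kt_bisectional X Y :
  D X (J X) Y (J Y) = D X Y X Y + D X (J Y) X (J Y).
Proof.
have := kt_bianchi HD X (J X) Y (J Y).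
rewrite (kt_anti12 HD Y (J X)) -(kt_J12_swap X Y) (kt_J34_swap X (J Y)).
rewrite (kt_anti12 HD X Y (J X)) (kt_J HD) => h; lra.
Qed.

Lemma kt_hsc0_sec0 : (forall X, D X (J X) X (J X) = 0) ->
  forall X Y, D X Y X Y = 0.
Proof.
move=> h.
(* Adding the expansions at [X + Y] and [X - Y] kills the odd terms and leaves this relation.
   Replacing [Y] by [J Y] exchanges the coefficients 3 and 1, so both terms vanish. *)
have E X Y : 3 * D X (J Y) X (J Y) + D X Y X Y = 0.
  have := h (X + Y); have := h (X - Y).
  rewrite !JD JN !(kt_D1, kt_D2, kt_D3, kt_D4, kt_N1, kt_N2, kt_N3, kt_N4) !h.
  rewrite (kt_pair Y (J Y) X (J X)) !(kt_J12_swap Y X) !(kt_J34_swap _ _ Y X).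
  have := kt_bisectional X Y => e1 e2 e3; lra.
move=> X Y; have := E X Y; have := E X (J Y).
rewrite JJ kt_N2 kt_N4 => *; lra.
Qed.

(** Polarizing in the second and then in the first slot makes [D] invariant under cyclic
    permutations of its first three arguments, so the Bianchi sum is three times [D]. *)
Lemma kt_sec0 : (forall X Y, D X Y X Y = 0) -> forall X Y Z W, D X Y Z W = 0.
Proof.
move=> h.
have E X Y W : D X Y X W = 0.
  have := h X (Y + W); rewrite !(kt_D2, kt_D4) !h (kt_pair X W) => *; lra.
have C X Y Z W : D Y Z X W = D X Y Z W.
  have := E (X + Z) Y W; rewrite !(kt_D1, kt_D3) !E (kt_anti12 HD Y Z) => *;
    lra.
move=> X Y Z W; have := kt_bianchi HD X Y Z W.
rewrite (C Y Z X) (C X Y Z) => *; lra.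
Qed.

End KahlerTensors.

Section ConstantHolomorphicSectionalCurvature.
Context {R : realType} {V : lmodType R} (J : V -> V) (B : V -> V -> R).
Hypothesis Jlin : forall a X Y, J (a *: X + Y) = a *: J X + J Y.
Hypothesis JJ : forall X, J (J X) = - X.
Hypothesis Blin : forall a x y z, B (a *: x + y) z = a * B x z + B y z.
Hypothesis Bsym : forall x y, B x y = B y x.
Hypothesis BJ : forall x y, B (J x) (J y) = B x y.

(* Four times the curvature tensor of a space of constant holomorphic         *)
(* sectional curvature 1.                                                     *)
Definition hsc_model (X Y Z W : V) : R :=
  B X Z * B Y W - B X W * B Y Z + B X (J Z) * B Y (J W)
  - B X (J W) * B Y (J Z) + 2 * (B X (J Y) * B Z (J W)).

Let BNl x y : B (- x) y = - B x y.
Proof.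
have B0 : B 0 y = 0 by have := Blin (-1) 0 0 y; rewrite scaler0 addr0 => h; lra.
by rewrite -[- x]addr0 -scaleN1r Blin B0 mulN1r addr0.
Qed.

Let BJr x y : B x (J y) = - B y (J x).
Proof. by rewrite -[LHS]BJ JJ Bsym BNl. Qed.

Lemma hsc_model_kahler c : kahler_tensor J (fun X Y Z W =>
  c * hsc_model X Y Z W).
Proof.
rewrite /hsc_model; split=> [a X X' Y Z W|X Y Z W|X Y Z W|X Y Z W|X Y Z W].
- by rewrite !Blin; ring.
- by rewrite (BJr Y X); ring.
- by rewrite (BJr W Z); ring.
- rewrite (BJr X Z) (BJr Y X) (BJr Y Z) (Bsym Y X) (Bsym Z X) (Bsym Z Y).
  by rewrite (BJr Z X); ring.
- rewrite !JJ !(Bsym _ (- _)) !BNl (BJr W Z) !(Bsym Z X) !(Bsym Z Y)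
  !(Bsym W X) !(Bsym W Y).
  by ring.
Qed.

(** The model at (X, JX, X, JX) is 4 times the square of [B X X], hence the factor [c / 4]. The
    difference from the model is a Kähler tensor without holomorphic sectional curvature, so
    polarization kills it. *)
Lemma kt_const_hsc (D : V -> V -> V -> V -> R) c : kahler_tensor J D ->
  (forall X, D X (J X) X (J X) = c * B X X ^+ 2) ->
  forall X Y Z W, D X Y Z W = c / 4 * hsc_model X Y Z W.
Proof.
move=> HD hD X Y Z W; apply/eqP; rewrite -subr_eq0; apply/eqP.
pose E X Y Z W := D X Y Z W - c / 4 * hsc_model X Y Z W.
rewrite -[LHS]/(E X Y Z W).
have HE : kahler_tensor J E.
  have [h1 h2 h3 h4 h5] := HD; have [k1 k2 k3 k4 k5] := hsc_model_kahler
    (c / 4).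
  rewrite /E; split=> [a X' X'' Y' Z' W'|X' Y' Z' W'|X' Y' Z' W'|X' Y' Z' W'|X'
    Y' Z' W'].
  - by rewrite h1 k1; ring.
  - by rewrite h2 k2; ring.
  - by rewrite h3 k3; ring.
  - move: (h4 X' Y' Z' W') (k4 X' Y' Z' W') => /= e1 e2; lra.
  - by rewrite h5 k5.
apply: (kt_sec0 HE); apply: (kt_hsc0_sec0 Jlin JJ HE) => {X Y Z W} X.
have XJX : B X (J X) = 0 by have := BJr X X => h; lra.
rewrite /E hD /hsc_model !JJ !(Bsym _ (- _)) !BNl BJ (Bsym (J X)) !XJX.
by field.
Qed.

End ConstantHolomorphicSectionalCurvature.

(** * Traces of the curvature operator of the second kind *)

Section MatrixInnerProduct.
Context {R : realType} {n : nat}.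
Implicit Types A B : 'M[R]_n.

Definition mxdot A B : R := \tr (A^T *m B).

Lemma mxdotE A B : mxdot A B = \sum_a \sum_b A a b * B a b.
Proof.
rewrite /mxdot /mxtrace exchange_big /=; apply: eq_bigr => b _.
by rewrite mxE; apply: eq_bigr => a _; rewrite mxE.
Qed.

Lemma mxdot_lin a A A' B : mxdot (a *: A + A') B = a * mxdot A B + mxdot A' B.
Proof. by rewrite /mxdot linearP /= mulmxDl -scalemxAl linearP. Qed.

Lemma mxdotC A B : mxdot A B = mxdot B A.
Proof. by rewrite /mxdot -mxtrace_tr trmx_mul trmxK. Qed.

Lemma mxdot_gt0 A : A != 0 -> 0 < mxdot A A.
Proof.
move=> A0; rewrite lt_neqAle mxdotE.
have ge0 a : 0 <= \sum_b A a b * A a b.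
  by apply: sumr_ge0 => b _; rewrite -expr2 sqr_ge0.
rewrite sumr_ge0 ?andbT //; apply: contra A0 => /eqP/esym h.
apply/eqP/matrixP => a b; rewrite mxE.
have ha := psumr_eq0P (fun a _ => ge0 a) h (i := a) isT.
have sq_ge0 c (_ : true) : 0 <= A a c * A a c by rewrite -expr2 sqr_ge0.
by apply/eqP; rewrite -sqrf_eq0 expr2 (psumr_eq0P sq_ge0 ha).
Qed.

Lemma mxdot_tr A B : mxdot A^T B = mxdot A B^T.
Proof. by rewrite /mxdot trmxK -mxtrace_tr trmx_mul mxtrace_mulC. Qed.

Lemma mxdot1r A : mxdot A 1%:M = \tr A.
Proof. by rewrite /mxdot mulmx1 mxtrace_tr. Qed.

Lemma mxdot_delta A a b : mxdot A (delta_mx a b) = A a b.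
Proof.
rewrite mxdotE (bigD1 a) //= (bigD1 b) //= mxE !eqxx mulr1.
rewrite !big1 ?addr0 // => [c ca|c ca]; last by rewrite mxE (negbTE ca) andbF
  mulr0.
by rewrite big1 // => d _; rewrite mxE (negbTE ca) mulr0.
Qed.

(** The sum depends on the family only through its projection, so traces over a basis can be
    computed without choosing one. *)
Lemma orthonormal_kernel (P : 'M[R]_n -> 'M[R]_n) (q : nat ->
  'M[R]_n) r a b c d :
  (forall x, P x = \sum_(i < r) mxdot (q i) x *: q i) ->
  \sum_(s < r) q s a b * q s c d = P (delta_mx a b) c d.
Proof.
move=> ->; rewrite summxE; apply: eq_bigr => s _.
by rewrite mxE mxdot_delta.
Qed.

(** The rank of a projection is its trace; the dimensions of the two spaces are obtained this
    way. *)
Lemma orthonormal_count (P : 'M[R]_n -> 'M[R]_n) (q : nat -> 'M[R]_n) r :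
  orthonormal_upto mxdot q r ->
  (forall x, P x = \sum_(i < r) mxdot (q i) x *: q i) ->
  r%:R = \sum_a \sum_b P (delta_mx a b) a b.
Proof.
move=> oq hP.
transitivity (\sum_(s < r) mxdot (q s) (q s)).
  rewrite (eq_bigr (fun=> 1)) ?sumr_const ?card_ord // => s _.
  by rewrite oq // eqxx.
under eq_bigr do rewrite mxdotE.
rewrite exchange_big; apply: eq_bigr => a _.
rewrite exchange_big; apply: eq_bigr => b _.
exact: orthonormal_kernel.
Qed.

Section Projections.
Variable Jm : 'M[R]_n.
Hypothesis JmJm : Jm *m Jm = - 1%:M.
Hypothesis JmT : Jm^T = - Jm.
Hypothesis n0 : (0 < n)%N.

(** The pullback of a bilinear form by the complex structure, an involution whose eigenvalues 1 and
    -1 give the invariant and anti-invariant parts. *)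
Definition conjJ A : 'M[R]_n := Jm^T *m A *m Jm.

Lemma conjJ_lin a A B : conjJ (a *: A + B) = a *: conjJ A + conjJ B.
Proof. by rewrite /conjJ mulmxDr mulmxDl -scalemxAr -scalemxAl. Qed.

Lemma conjJK A : conjJ (conjJ A) = A.
Proof.
have JTJT : Jm^T *m Jm^T = - 1%:M by rewrite -trmx_mul JmJm linearN /= trmx1.
rewrite /conjJ !mulmxA -(mulmxA _ Jm Jm) JmJm JTJT.
by rewrite mulmxN mulmx1 mulNmx mul1mx opprK.
Qed.

Lemma conjJ_tr A : conjJ A^T = (conjJ A)^T.
Proof. by rewrite /conjJ !trmx_mul trmxK mulmxA. Qed.

Lemma conjJ1 : conjJ 1%:M = 1%:M.
Proof. by rewrite /conjJ mulmx1 JmT mulNmx JmJm opprK. Qed.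

Lemma conjJ_dot A B : mxdot (conjJ A) B = mxdot A (conjJ B).
Proof.
rewrite /mxdot /conjJ !trmx_mul trmxK -!mulmxA mxtrace_mulC !mulmxA JmT.
by rewrite !(mulmxN, mulNmx).
Qed.

Lemma conjJ_delta a b c d : conjJ (delta_mx a b) c d = Jm a c * Jm b d.
Proof.
rewrite /conjJ mxE (bigD1 b) //= big1 ?addr0 => [|k kb]; last first.
  rewrite mxE big1 ?mul0r // => j _; by rewrite !mxE (negbTE kb) andbF mulr0.
rewrite mxE (bigD1 a) //= big1 ?addr0 => [|j ja]; last first.
  by rewrite !mxE (negbTE ja) mulr0.
by rewrite !mxE !eqxx mulr1.
Qed.

Local Notation Q := conjJ.

(* Orthogonal projections onto the J-anti-invariant symmetric matrices and    *)
(* the traceless J-invariant symmetric ones.                                  *)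
Definition proj_anti A : 'M[R]_n := 4^-1 *: (A + A^T - Q A - (Q A)^T).
Definition proj_inv A : 'M[R]_n :=
  4^-1 *: (A + A^T + Q A + (Q A)^T) - (\tr A / n%:R) *: 1%:M.

Let nR : n%:R != 0 :> R. Proof. by rewrite pnatr_eq0 -lt0n. Qed.

Let QD A B : Q (A + B) = Q A + Q B.
Proof. by rewrite -[A]scale1r conjJ_lin !scale1r. Qed.
Let QN A : Q (- A) = - Q A.
Proof. by rewrite /Q mulmxN mulNmx. Qed.
Let QZ a A : Q (a *: A) = a *: Q A.
Proof. by rewrite /Q -scalemxAr -scalemxAl. Qed.
Let trD A B : (A + B)^T = A^T + B^T. Proof. by rewrite linearD. Qed.
Let trN A : (- A)^T = - A^T. Proof. by rewrite linearN. Qed.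
Let trZ a A : (a *: A)^T = a *: A^T. Proof. by rewrite linearZ. Qed.
Let mxtrD A B : \tr (A + B) = \tr A + \tr B. Proof. by rewrite linearD. Qed.
Let mxtrN A : \tr (- A) = - \tr A. Proof. by rewrite linearN. Qed.
Let mxtrZ a A : \tr (a *: A) = a * \tr A. Proof. by rewrite linearZ. Qed.
Let trQ A : \tr (Q A) = \tr A.
Proof. by rewrite -mxdot1r conjJ_dot conjJ1 mxdot1r. Qed.

Lemma proj_anti_lin a A B : proj_anti (a *: A + B) = a *: proj_anti A +
  proj_anti B.
Proof.
rewrite /proj_anti !QD !QZ !trD !trZ; apply/matrixP => i j; rewrite !mxE; ring.
Qed.

Lemma proj_inv_lin a A B : proj_inv (a *: A + B) = a *: proj_inv A + proj_inv B.
Proof.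
rewrite /proj_inv !QD !QZ !trD !trZ mxtrD mxtrZ; apply/matrixP => i j.
rewrite !mxE; ring.
Qed.

Lemma proj_antiK A : proj_anti (proj_anti A) = proj_anti A.
Proof.
rewrite /proj_anti !(QD, QN, QZ, trD, trN, trZ) -!conjJ_tr !conjJK !trmxK.
rewrite ?conjJ_tr ?trmxK.
by move: (Q A) (A^T) (Q A)^T => X Y Z; apply/matrixP => i j; rewrite !mxE;
  field.
Qed.

Lemma proj_invK A : proj_inv (proj_inv A) = proj_inv A.
Proof.
rewrite /proj_inv !(QD, QN, QZ, trD, trN, trZ, mxtrD, mxtrZ, mxtrN).
rewrite -!conjJ_tr !conjJK !trmxK ?conjJ1 ?trmx1 ?conjJ1 ?conjJ_tr ?trmxK
  !mxtrace_tr trQ.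
rewrite mxtrace1.
move: (\tr A) (Q A) (A^T) (Q A)^T => t X Y Z.
by apply/matrixP => i j; rewrite !mxE; field.
Qed.

Let BD A A' B : mxdot (A + A') B = mxdot A B + mxdot A' B.
Proof. by rewrite -[A]scale1r mxdot_lin mul1r scale1r. Qed.
Let BN A B : mxdot (- A) B = - mxdot A B.
Proof. by rewrite /mxdot linearN mulNmx linearN. Qed.
Let BZ a A B : mxdot (a *: A) B = a * mxdot A B.
Proof. by rewrite /mxdot linearZ -scalemxAl linearZ. Qed.
Let BDr A A' B : mxdot B (A + A') = mxdot B A + mxdot B A'.
Proof. by rewrite !(mxdotC B) BD. Qed.
Let BNr A B : mxdot B (- A) = - mxdot B A.
Proof. by rewrite !(mxdotC B) BN. Qed.
Let BZr a A B : mxdot B (a *: A) = a * mxdot B A.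
Proof. by rewrite !(mxdotC B) BZ. Qed.

Lemma proj_anti_sa A B : mxdot (proj_anti A) B = mxdot A (proj_anti B).
Proof.
rewrite /proj_anti !(BD, BN, BZ, BDr, BNr, BZr) -!conjJ_tr !conjJ_dot !mxdot_tr.
by rewrite conjJ_tr.
Qed.

Lemma proj_inv_sa A B : mxdot (proj_inv A) B = mxdot A (proj_inv B).
Proof.
rewrite /proj_inv !(BD, BN, BZ, BDr, BNr, BZr) -!conjJ_tr !conjJ_dot !mxdot_tr.
rewrite ?conjJ_tr (mxdotC 1%:M) !mxdot1r; ring.
Qed.

Lemma proj_anti_invE A : S20 A -> proj_anti A + proj_inv A = A.
Proof.
move=> [sA tA]; rewrite /proj_anti /proj_inv sA tA mul0r scale0r subr0.
by apply/matrixP => i j; rewrite !mxE; field.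
Qed.

Lemma proj_antiT A : (proj_anti A)^T = proj_anti A.
Proof.
rewrite /proj_anti !(trD, trN, trZ) !trmxK; apply/matrixP => i j.
by rewrite !mxE; ring.
Qed.

Lemma proj_invT A : (proj_inv A)^T = proj_inv A.
Proof.
rewrite /proj_inv !(trD, trN, trZ) !trmxK trmx1; apply/matrixP => i j.
by rewrite !mxE; ring.
Qed.

Lemma proj_anti_S20 A : S20 (proj_anti A).
Proof.
split; first exact: proj_antiT.
by rewrite /proj_anti !(mxtrD, mxtrZ, mxtrN) !mxtrace_tr trQ; ring.
Qed.

Lemma proj_inv_S20 A : S20 (proj_inv A).
Proof.
split; first exact: proj_invT.
rewrite /proj_inv !(mxtrD, mxtrZ, mxtrN) !mxtrace_tr trQ mxtrace1; field.
exact: nR.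
Qed.

Lemma proj_anti_inv0 A : proj_anti (proj_inv A) = 0.
Proof.
rewrite /proj_inv /proj_anti !(QD, QN, QZ, trD, trN, trZ, mxtrD, mxtrZ, mxtrN).
rewrite -!conjJ_tr !conjJK !trmxK ?conjJ1 ?trmx1 ?conjJ1 ?conjJ_tr ?trmxK.
move: (\tr A) (Q A) (A^T) (Q A)^T => t X Y Z.
by apply/matrixP => i j; rewrite !mxE; ring.
Qed.

Lemma proj_anti_fix A : A^T = A -> conjJ A = - A -> proj_anti A = A.
Proof.
move=> h1 h2; rewrite /proj_anti h2 trN h1.
by apply/matrixP => i j; rewrite !mxE; field.
Qed.

Lemma proj_anti_delta a b c d : proj_anti (delta_mx a b) c d =
  4^-1 * ((a == c)%:R * (b == d)%:R + (a == d)%:R * (b == c)%:R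
          - Jm a c * Jm b d - Jm a d * Jm b c).
Proof.
rewrite /proj_anti; have := conjJ_delta a b; move: (Q _) => X hX.
rewrite !mxE !hX (eq_sym c a) (eq_sym d b) (eq_sym d a) (eq_sym c b) -!mulnb
  !natrM.
ring.
Qed.

Lemma proj_inv_delta a b c d : proj_inv (delta_mx a b) c d =
  4^-1 * ((a == c)%:R * (b == d)%:R + (a == d)%:R * (b == c)%:R
          + Jm a c * Jm b d + Jm a d * Jm b c) - n%:R^-1 *
            ((a == b)%:R * (c == d)%:R).
Proof.
rewrite /proj_inv; have := conjJ_delta a b; move: (Q _) => X hX.
have -> : \tr (delta_mx a b : 'M[R]_n) = (a == b)%:R.
  by rewrite -mxdot1r mxdotC mxdot_delta mxE.
rewrite !mxE !hX (eq_sym c a) (eq_sym d b) (eq_sym d a) (eq_sym c b) -!mulnb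
  !natrM.
ring.
Qed.

Let sum_delta (F : 'I_n -> R) a : \sum_b (a == b)%:R * F b = F a.
Proof.
rewrite (bigD1 a) //= eqxx mul1r big1 ?addr0 // => b ba.
by rewrite eq_sym (negbTE ba) mul0r.
Qed.

Let trace_terms : 
  [/\ \sum_(a < n) \sum_(b < n) (a == a)%:R * (b == b)%:R = n%:R ^+ 2 :> R,
      \sum_(a < n) \sum_(b < n) (a == b)%:R * (b == a)%:R = n%:R :> R,
      \sum_a \sum_b Jm a a * Jm b b = 0 &
      \sum_a \sum_b Jm a b * Jm b a = - n%:R].
Proof.
split.
- under eq_bigr do under eq_bigr do rewrite !eqxx mulr1.
  by rewrite !sumr_const !card_ord -mulrnA mulnn natrX.
- under eq_bigr do rewrite (sum_delta (fun b => (b == _)%:R)) eqxx.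
  by rewrite sumr_const card_ord.
- rewrite big1 // => a _; rewrite big1 // => b _.
  have : Jm^T a a = - Jm a a by rewrite JmT mxE.
  by rewrite mxE => h; have -> : Jm a a = 0 by [lra]; rewrite mul0r.
- have <- : \tr (Jm *m Jm) = - n%:R by rewrite JmJm mxtrN mxtrace1.
  by apply: eq_bigr => a _; rewrite mxE.
Qed.

Lemma proj_anti_trace :
  \sum_a \sum_b proj_anti (delta_mx a b) a b = n%:R * (n%:R + 2) / 4.
Proof.
under eq_bigr do under eq_bigr do rewrite proj_anti_delta.
under eq_bigr do rewrite -mulr_sumr !sumrB big_split /=.
rewrite -mulr_sumr !sumrB big_split /=.
by have [-> -> -> ->] := trace_terms; field.
Qed.

Lemma proj_inv_trace :
  \sum_a \sum_b proj_inv (delta_mx a b) a b = n%:R ^+ 2 / 4 - 1.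
Proof.
under eq_bigr do under eq_bigr do rewrite proj_inv_delta.
under eq_bigr do rewrite sumrB -!mulr_sumr !big_split /=.
rewrite sumrB -!mulr_sumr !big_split /=.
have [-> -> -> ->] := trace_terms.
have [_ h _ _] := trace_terms.
rewrite (_ : \sum_a _ = n%:R); first by field.
rewrite -[RHS]h; apply: eq_bigr => a _; apply: eq_bigr => b _.
by rewrite (eq_sym b a).
Qed.

End Projections.
End MatrixInnerProduct.

Section Traces.
Context {R : realType} {V : lmodType R} {n : nat}.
Variables (J : V -> V) (D : V -> V -> V -> V -> R) (e : 'I_n ->
  V) (Jm : 'M[R]_n).

Definition curv_form (A : 'M[R]_n) : R :=
  \sum_i \sum_j \sum_k \sum_l D (e i) (e j) (e k) (e l) * A i l * A j k.

Definition curv_scal : R := \sum_i \sum_j D (e i) (e j) (e i) (e j).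

(** With [K] the kernel of an operator on matrices, this is the trace of [curv_form] against that
    operator; the order [i l j k] follows the index pairs at which [curv_form] evaluates its
    argument. *)
Definition curv_pair (K : 'I_n -> 'I_n -> 'I_n -> 'I_n -> R) : R :=
  \sum_i \sum_j \sum_k \sum_l D (e i) (e j) (e k) (e l) * K i l j k.

Lemma curv_form_trace (P : 'M[R]_n -> 'M[R]_n) (q : nat -> 'M[R]_n) r :
  (forall x, P x = \sum_(i < r) mxdot (q i) x *: q i) ->
  \sum_(s < r) curv_form (q s) = curv_pair (fun a b => P (delta_mx a b)).
Proof.
move=> hP; rewrite /curv_form /curv_pair.
rewrite exchange_big; apply: eq_bigr => i _.
rewrite exchange_big; apply: eq_bigr => j _.
rewrite exchange_big; apply: eq_bigr => k _.
rewrite exchange_big; apply: eq_bigr => l _.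
rewrite -(orthonormal_kernel i l j k hP) mulr_sumr; apply: eq_bigr => s _.
by rewrite mulrA.
Qed.

Lemma curv_pairD K L : curv_pair (fun a b c d => K a b c d + L a b c d) =
  curv_pair K + curv_pair L.
Proof.
rewrite /curv_pair -big_split; apply: eq_bigr => i _ /=.
rewrite -big_split; apply: eq_bigr => j _ /=.
rewrite -big_split; apply: eq_bigr => k _ /=.
by rewrite -big_split; apply: eq_bigr => l _ /=; rewrite mulrDr.
Qed.

Lemma curv_pairZ a K : curv_pair (fun i j k l =>
  a * K i j k l) = a * curv_pair K.
Proof.
rewrite /curv_pair mulr_sumr; apply: eq_bigr => i _.
rewrite mulr_sumr; apply: eq_bigr => j _.
rewrite mulr_sumr; apply: eq_bigr => k _.
by rewrite mulr_sumr; apply: eq_bigr => l _; rewrite mulrCA.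
Qed.

Lemma eq_curv_pair K L : (forall i j k l, K i j k l = L i j k l) ->
  curv_pair K = curv_pair L.
Proof.
move=> h; rewrite /curv_pair; apply: eq_bigr => i _; apply: eq_bigr => j _.
by apply: eq_bigr => k _; apply: eq_bigr => l _; rewrite h.
Qed.

Hypothesis JJ : forall X, J (J X) = - X.
Hypothesis HD : kahler_tensor J D.
Hypothesis Je : forall i, J (e i) = \sum_j Jm i j *: e j.
Hypothesis JmJm : Jm *m Jm = - 1%:M.
Hypothesis JmT : Jm^T = - Jm.

Let S := curv_scal.

Let sum_delta (F : 'I_n -> R) a : \sum_b F b * (a == b)%:R = F a.
Proof.
rewrite (bigD1 a) //= eqxx mulr1 big1 ?addr0 // => b ba.
by rewrite eq_sym (negbTE ba) mulr0.
Qed.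

Let Dsum2 X Z W (c : 'I_n -> R) :
  \sum_j D X (e j) Z W * c j = D X (\sum_j c j *: e j) Z W.
Proof.
rewrite (big_morph (fun Y => D X Y Z W) (fun Y Y' =>
  kt_D2 HD Y Y' X Z W) (kt_02 HD X Z W)).
by apply: eq_bigr => j _; rewrite (kt_Z2 HD) mulrC.
Qed.

Let Dsum3 X Y W (c : 'I_n -> R) :
  \sum_j D X Y (e j) W * c j = D X Y (\sum_j c j *: e j) W.
Proof.
rewrite (big_morph (fun Z => D X Y Z W) (fun Y' Z =>
  kt_D3 HD Y' Z X Y W) (kt_03 HD X Y W)).
by apply: eq_bigr => j _; rewrite (kt_Z3 HD) mulrC.
Qed.

Let D0 X Z W : D X X Z W = 0.
Proof. by have := kt_anti12 HD X X Z W => h; lra. Qed.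

Lemma curv_pair_id : curv_pair (fun a b c d => (a == c)%:R * (b == d)%:R) = 0.
Proof.
rewrite /curv_pair big1 // => i _.
under eq_bigr do under eq_bigr do under eq_bigr do rewrite mulrCA mulrC.
under eq_bigr do under eq_bigr do rewrite -mulr_suml.
under eq_bigr do rewrite -mulr_suml.
rewrite sum_delta big1 // => k _; rewrite big1 // => l _.
by rewrite D0 mul0r.
Qed.

Lemma curv_pair_swap : curv_pair (fun a b c d => (a == d)%:R * (b == c)%:R) = S.
Proof.
rewrite /curv_pair; apply: eq_bigr => i _; apply: eq_bigr => j _.
under eq_bigr do under eq_bigr do rewrite mulrCA mulrC.
under eq_bigr do rewrite -mulr_suml.
rewrite sum_delta; under eq_bigr do rewrite eq_sym.
exact: sum_delta.
Qed.

Lemma curv_pair_trace : curv_pair (fun a b c d =>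
  (a == b)%:R * (c == d)%:R) = - S.
Proof.
rewrite /curv_pair -sumrN; apply: eq_bigr => i _; rewrite -sumrN.
apply: eq_bigr => j _; rewrite exchange_big /=.
under eq_bigr do under eq_bigr do rewrite mulrCA mulrC.
under eq_bigr do rewrite -mulr_suml.
rewrite sum_delta sum_delta; exact: (kt_anti34 HD).
Qed.

(** [Jm] is an orthogonal matrix, so replacing the frame by its image under [J] leaves the
    contraction unchanged. *)
Let scal_J : \sum_i \sum_l D (e i) (J (e l)) (e i) (J (e l)) = S.
Proof.
apply: eq_bigr => i _.
transitivity (\sum_l \sum_j \sum_k D (e i) (e j) (e i) (e k) *
  (Jm l j * Jm l k)).
  apply: eq_bigr => l _; rewrite {1}Je -Dsum2; apply: eq_bigr => j _.
  rewrite (kt_anti34 HD) Je -Dsum3 mulNr mulr_suml -sumrN;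
    apply: eq_bigr => k _.
  by rewrite (kt_anti34 HD (e i) (e j) (e i) (e k)) !mulNr opprK mulrAC mulrA.
rewrite exchange_big; apply: eq_bigr => j _; rewrite exchange_big /=.
rewrite -[RHS](sum_delta (fun k => D (e i) (e j) (e i) (e k))).
apply: eq_bigr => k _; rewrite -mulr_sumr; congr (_ * _).
have : (Jm^T *m Jm) j k = (j == k)%:R by rewrite JmT mulNmx JmJm opprK mxE.
by rewrite mxE => <-; apply: eq_bigr => l _; rewrite mxE.
Qed.

(** Contracting with [Jm] produces minus the sum of the bisectional curvatures; each splits into two
    sectional terms, and both resulting sums are [S]. *)
Lemma curv_pair_J : curv_pair (fun a b c d => Jm a c * Jm b d) = - (2 * S).
Proof.
transitivity (\sum_i \sum_l D (e i) (J (e i)) (J (e l)) (e l)).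
  rewrite /curv_pair; apply: eq_bigr => i _.
  rewrite [LHS](_ : _ = \sum_l \sum_j \sum_k D (e i) (e j) (e k) (e l) *
    (Jm i j * Jm l k)).
    apply: eq_bigr => l _; rewrite Je -Dsum2; apply: eq_bigr => j _.
    rewrite Je -Dsum3 mulr_suml; apply: eq_bigr => k _; ring.
  rewrite [RHS]exchange_big; apply: eq_bigr => j _; exact: exchange_big.
rewrite mulr_natl mulr2n opprD -{1}scal_J -sumrN -sumrN -big_split.
apply: eq_bigr => i _ /=; rewrite -!sumrN -big_split; apply: eq_bigr => l _ /=.
by rewrite (kt_anti34 HD) (kt_bisectional JJ HD) opprD addrC.
Qed.

Lemma curv_pair_J' : curv_pair (fun a b c d => Jm a d * Jm b c) = - S.
Proof.
transitivity (\sum_i \sum_l D (e i) (J (e l)) (J (e i)) (e l)).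
  rewrite /curv_pair; apply: eq_bigr => i _.
  rewrite [LHS](_ : _ = \sum_l \sum_j \sum_k D (e i) (e j) (e k) (e l) *
    (Jm i k * Jm l j)).
    apply: eq_bigr => l _; rewrite (Je l) -Dsum2; apply: eq_bigr => j _.
    rewrite Je -Dsum3 mulr_suml; apply: eq_bigr => k _; ring.
  rewrite [RHS]exchange_big; apply: eq_bigr => j _; exact: exchange_big.
rewrite -scal_J -sumrN; apply: eq_bigr => i _; rewrite -sumrN.
apply: eq_bigr => l _.
by rewrite (kt_anti34 HD) (kt_J34_swap JJ HD).
Qed.

Lemma curv_trace_anti :
  curv_pair (fun a b => proj_anti Jm (delta_mx a b)) = S.
Proof.
rewrite (eq_curv_pair (L := fun a b c d =>
  4^-1 * (((a == c)%:R * (b == d)%:R + (a == d)%:R * (b == c)%:R)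
          + ((-1) * (Jm a c * Jm b d) + (-1) * (Jm a d * Jm b c)))));
            last first.
  by move=> i j k l; rewrite proj_anti_delta; ring.
rewrite curv_pairZ !curv_pairD !curv_pairZ curv_pair_id curv_pair_swap.
by rewrite curv_pair_J curv_pair_J'; field.
Qed.

Lemma curv_trace_inv : (0 < n)%N ->
  curv_pair (fun a b => proj_inv Jm (delta_mx a b)) = - (S / 2) + S / n%:R.
Proof.
move=> n0; have nR : n%:R != 0 :> R by rewrite pnatr_eq0 -lt0n.
rewrite (eq_curv_pair (L := fun a b c d =>
  4^-1 * (((a == c)%:R * (b == d)%:R + (a == d)%:R * (b == c)%:R)
          + (Jm a c * Jm b d + Jm a d * Jm b c))
  + (- n%:R^-1) * ((a == b)%:R * (c == d)%:R))); last first.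
  by move=> i j k l; rewrite proj_inv_delta; ring.
rewrite curv_pairD !curv_pairZ !curv_pairD curv_pair_id curv_pair_swap.
by rewrite curv_pair_J curv_pair_J' curv_pair_trace; field.
Qed.

End Traces.

(** * The weight argument at a point *)

Section Pointwise.
Context {R : realType} {V : lmodType R} {m : nat}.
Local Notation n := (2 * m)%N.
Variables (J : V -> V) (D : V -> V -> V -> V -> R) (e : 'I_n ->
  V) (Jm : 'M[R]_n).
Hypothesis m2 : (2 <= m)%N.
Hypothesis JJ : forall X, J (J X) = - X.
Hypothesis HD : kahler_tensor J D.
Hypothesis Je : forall i, J (e i) = \sum_j Jm i j *: e j.
Hypothesis JmJm : Jm *m Jm = - 1%:M.
Hypothesis JmT : Jm^T = - Jm.
Variable alpha : R.
Hypothesis alphaN : 1 <= alpha <= (dimS20 n)%:R.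
Hypothesis alpha_ge0 : forall phi : 'I_(dimS20 n) -> 'M[R]_n,
  orthonormal_basisS20 phi -> 0 <= alpha_sum alpha (fun i =>
    curv_form D e (phi i)).

Let n0 : (0 < n)%N. Proof. by rewrite muln_gt0 /= (leq_trans _ m2). Qed.
Let m2R : 2 <= m%:R :> R. Proof. by rewrite (ler_nat R 2). Qed.

(** The weights are [a] on the invariant part, [b] on [theta] and [c] on the rest of an
    anti-invariant orthonormal basis through [theta]; the last hypothesis compares [alpha] with
    their total mass. *)
Lemma weighted_curv_ge0 (theta : 'M[R]_n) (a b c : R) :
  mxdot theta theta = 1 -> theta^T = theta -> conjJ Jm theta = - theta ->
  0 <= a <= 1 -> 0 <= b <= 1 -> 0 <= c <= 1 ->
  alpha <= a * (m%:R ^+ 2 - 1) + b + c * (m%:R * (m%:R + 1) - 1) ->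
  0 <= a * (- (curv_scal D e / 2) + curv_scal D e / n%:R)
       + b * curv_form D e theta + c * (curv_scal D e - curv_form D e theta).
Proof.
move=> tt tT tJ ha hb hc hsum.
have dotC := @mxdotC R n; have dotl := @mxdot_lin R n;
  have dotp := @mxdot_gt0 R n.
have [q [r [r1 q0 oq Pq hP]]] : exists q r, [/\ (1 <= r)%N,
    forall i, (i < 1)%N -> q i = theta, orthonormal_upto mxdot q r,
    forall i, (i < r)%N -> proj_anti Jm (q i) = q i &
    forall x, proj_anti Jm x = \sum_(i < r) mxdot (q i) x *: q i].
  apply: (orthonormal_upto_extend dotl dotC dotp (proj_anti_lin Jm)
           (proj_antiK JmJm) (proj_anti_sa JmT) (q := fun=> theta) (r := 1)).
  - by case=> // -[].
  - by move=> i _; apply: proj_anti_fix.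
have [p [s [_ _ op Pp hPp]]] : exists q r, [/\ (0 <= r)%N,
    forall i, (i < 0)%N -> q i = theta, orthonormal_upto mxdot q r,
    forall i, (i < r)%N -> proj_inv Jm (q i) = q i &
    forall x, proj_inv Jm x = \sum_(i < r) mxdot (q i) x *: q i].
  by apply: (orthonormal_upto_extend dotl dotC dotp (proj_inv_lin Jm)
    (proj_invK JmJm JmT n0) (proj_inv_sa JmT) (q := fun=> theta) (r := 0)).
have nR : n%:R = 2 * m%:R :> R by rewrite natrM.
have rE : r%:R = m%:R * (m%:R + 1) :> R.
  by rewrite (orthonormal_count oq hP) (proj_anti_trace JmJm JmT) nR; field.
have sE : s%:R = m%:R ^+ 2 - 1 :> R.
  by rewrite (orthonormal_count op hPp) (proj_inv_trace JmJm JmT n0) nR; field.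
have pq i j : (i < s)%N -> (j < r)%N -> mxdot (p i) (q j) = 0.
  move=> si rj; rewrite -(Pq j) // -(proj_anti_sa JmT) -(Pp i) //.
  rewrite (proj_anti_inv0 JmJm JmT).
  by have := dotl (-1) 0 0 (q j); rewrite scaler0 addr0 mulN1r addNr.
pose I := ('I_s + 'I_r)%type.
pose phi (i : I) : 'M[R]_n := match i with inl i => p i | inr j => q j end.
(* Both dimensions are known as traces. The division by 2 in [dimS20] is exact because [n + 2] is
   twice [m + 1]. *)
have cardI : #|{: I}| = dimS20 n.
  apply/eqP; rewrite card_sum !card_ord -(eqr_nat R) natrD sE rE /dimS20.
  have -> : ((n - 1) * (n + 2) = ((n - 1) * (m + 1)) * 2)%N.
    by rewrite -mulnA mulnDl mul1n [(m * 2)%N]mulnC.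
  rewrite mulnK // natrM natrB // natrD nR; apply/eqP; ring.
have phiS20 i : S20 (phi i).
  case: i => i /=; first by rewrite -Pp //; exact: proj_inv_S20.
  by rewrite -Pq //; exact: proj_anti_S20.
have phi_on i j : mxdot (phi i) (phi j) = (i == j)%:R.
  case: i j => i [] j /=.
  - by rewrite op.
  - by rewrite pq.
  - by rewrite dotC pq.
  - by rewrite oq.
have phi_span A : S20 A -> A = \sum_i mxdot (phi i) A *: phi i.
  move=> SA; rewrite -{1}(proj_anti_invE Jm SA) hP hPp addrC.
  by rewrite big_sumType.
pose o : 'I_r := Ordinal r1.
pose w (i : I) := match i with inl _ => a | inr j =>
  if j == o then b else c end.
have := @alpha_sum_weighted_ge0 R I (dimS20 n) (fun i =>
  curv_form D e (phi i)) alpha w cardI alphaN.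
have h1 (f : 'I_(dimS20 n) -> I) : bijective f ->
  0 <= alpha_sum alpha ((fun i => curv_form D e (phi i)) \o f).
  move=> bf; apply: (@alpha_ge0 (phi \o f)); split => [i|i j|A SA].
  - exact: phiS20.
  - by rewrite -[LHS]/(mxdot _ _) phi_on (inj_eq (bij_inj bf)).
  - exists (fun i => mxdot (phi (f i)) A).
    by rewrite {1}(phi_span A SA) (reindex f) //; exact: onW_bij.
have h2 i : 0 <= w i <= 1 by case: i => //= j; case: ifP.
have sum_r (F : 'I_r -> R) : \sum_(j < r) (if j == o then b else c) * F j =
    b * F o + c * (\sum_j F j - F o).
  rewrite (bigD1 o) //= ?eqxx; congr (_ + _).
  rewrite [\sum_j F j](bigD1 o) //= addrAC subrr add0r mulr_sumr.
  by apply: eq_bigr => j /negbTE ->.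
move=> /(_ h1 h2).
rewrite !big_sumType /= sum_r -mulr_sumr.
rewrite (curv_form_trace D e hP) (curv_form_trace D e hPp).
rewrite (curv_trace_anti JJ HD Je JmJm JmT)
  (curv_trace_inv JJ HD Je JmJm JmT n0).
rewrite q0 // addrA; apply.
have -> : \sum_(j < r) (if j == o then b else c) = b + c * (r%:R - 1).
  have sum1 : \sum_(j < r) 1 = r%:R :> R by rewrite sumr_const card_ord.
  rewrite -[in RHS]sum1 -[X in X + _]mulr1 -(sum_r (fun=> 1)).
  by apply: eq_bigr => j _; rewrite mulr1.
rewrite sumr_const card_ord -[_ *+ s]mulr_natr sE rE; apply: le_trans hsum _.
by rewrite addrA.
Qed.

Lemma curv_form_anti_const (theta : 'M[R]_n) :
  alpha <= 3 / 2 * (m%:R ^+ 2 - 1) ->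
  mxdot theta theta = 1 -> theta^T = theta -> conjJ Jm theta = - theta ->
  [/\ 0 <= curv_scal D e,
      alpha < 3 / 2 * (m%:R ^+ 2 - 1) -> curv_scal D e <= 0 &
      m%:R * (m%:R + 1) * curv_form D e theta = curv_scal D e].
Proof.
move=> ha tt tT tJ.
have W := weighted_curv_ge0 tt tT tJ.
have nR : n%:R = 2 * m%:R :> R by rewrite natrM.
have m0 : m%:R != 0 :> R by rewrite pnatr_eq0 -lt0n (leq_trans _ m2).
have m1 : m%:R + 1 != 0 :> R by rewrite natr1 pnatr_eq0.
rewrite nR in W.
move: (curv_scal D e) (curv_form D e theta) W => S u W.
move: (m%:R : R) m2R ha W m0 m1 {nR} => M M2 ha W m0 m1.
pose N := M * (M + 1).
have N0 : N != 0 by rewrite mulf_neq0.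
have Ngt : 6 <= N by rewrite /N; nra.
have M1 : 0 <= M ^+ 2 - 1 by nra.
(* The anti-invariant weight that cancels the invariant contribution [- (t * S)]; its total mass
   [t * N] is half of [M ^+ 2 - 1]. *)
pose t := (M - 1) / (2 * M).
have tE : t * N = (M ^+ 2 - 1) / 2.
  by rewrite /t /N; field.
have t4 : 1 / 4 <= t <= 1 / 2.
  have tM : t * (2 * M) = M - 1 by rewrite /t divfK // mulf_neq0 // pnatr_eq0.
  by apply/andP; split; nra.
have SE : - (S / 2) + S / (2 * M) = - (t * S).
  by rewrite /t; field; rewrite m0.
rewrite SE -/N in W.
have S0 : 0 <= S.
  have : 0 <= 1 * - (t * S) + 1 * u + 1 * (S - u).
    by apply: W; rewrite ?ler01 ?lexx // /N; nra.
  by case/andP: t4 => h1 h2 h3; nra.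
(* The weight of [theta] changes by [eps * N - eps] and those of the other [N - 1] vectors by
   [- eps]: the mass stays the same and the sum becomes [eps * (N * u - S)]. As [eps * N] is 1/4 or
   -1/4, the weights stay in [0, 1]. The squared hypothesis treats both signs at once. *)
have key eps : eps ^+ 2 = (1 / (4 * N)) ^+ 2 -> 0 <= eps * (N * u - S).
  move=> heps.
  have hN : eps * N = 1 / 4 \/ eps * N = - (1 / 4).
    have /eqP : (eps * N) ^+ 2 = (1 / 4) ^+ 2 by rewrite exprMn heps; field.
    by rewrite eqf_sqr => /orP[] /eqP; [left|right].
  have heps4 : - (1 / 4) <= eps <= 1 / 4 by apply/andP; split; case: hN; nra.
  have := W 1 (t + (eps * N - eps)) (t - eps).
  case/andP: t4 heps4 => h1 h2 /andP[h3 h4].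
  have h5 : - (1 / 4) <= eps * N - eps <= 1 / 4.
    apply/andP; split; case: hN; nra.
  case/andP: h5 => h5 h6 h.
  suff : 0 <= 1 * - (t * S) + (t + (eps * N - eps)) * u + (t - eps) * (S - u).
    by move=> h7; lra.
  apply: h; first by rewrite ler01 lexx.
  - by apply/andP; split; lra.
  - by apply/andP; split; lra.
  - apply: le_trans ha _; rewrite le_eqVlt; apply/orP; left; apply/eqP.
    have -> : 1 * (M ^+ 2 - 1) + (t + (eps * N - eps)) + (t - eps) * (N - 1) =
      (M ^+ 2 - 1) + t * N by ring.
    by rewrite tE; field.
split=> //.
- move=> ha'.
  (* Lowering each anti-invariant weight by [d / N] lowers the mass by [d], within the slack left by
     [alpha], and turns the balanced sum into [- (d / N) * S]. The second bound on [d] keeps the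
     weights nonnegative. *)
  have [d [d0 d1 d2]] : exists d,
    [/\ 0 < d, d <= 3 / 2 * (M ^+ 2 - 1) - alpha & d <= (M ^+ 2 - 1) / 2].
    have [h|h] := leP (3 / 2 * (M ^+ 2 - 1) - alpha) ((M ^+ 2 - 1) / 2).
      by exists (3 / 2 * (M ^+ 2 - 1) - alpha); split => //; lra.
    by exists ((M ^+ 2 - 1) / 2); split => //; nra.
  have := W 1 (t - d / N) (t - d / N).
  have dN : d / N * N = d by rewrite divfK.
  have dN0 : 0 < d / N by rewrite divr_gt0 //; lra.
  have dNt : d / N <= t by rewrite ler_pdivrMr; [rewrite tE|lra].
  case/andP: t4 => h1 h2.
  move=> h; suff : 0 <= 1 * - (t * S) + (t - d / N) * u + (t - d / N) * (S - u).
    by move=> h3; nra.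
  apply: h; first by rewrite ler01 lexx.
  - by apply/andP; split; lra.
  - by apply/andP; split; lra.
  - have -> : 1 * (M ^+ 2 - 1) + (t - d / N) + (t - d / N) * (N - 1) =
    (M ^+ 2 - 1) + t * N - d / N * N by ring.
    rewrite tE dN; lra.
- have := key (1 / (4 * N)) erefl; have := key (- (1 / (4 * N))).
  rewrite sqrrN => /(_ erefl).
  have : 0 < 1 / (4 * N) by rewrite divr_gt0 //; lra.
  move=> h1; rewrite mulNr oppr_ge0 pmulr_rge0 // pmulr_rle0 // => h2 h3.
  by rewrite -/N; lra.
Qed.

End Pointwise.

(** * The pointwise theorem *)

Section MultilinearSums.
Context {R : realType} {V : lmodType R} {n : nat}.
Variables (J : V -> V) (D : V -> V -> V -> V -> R) (e : 'I_n -> V).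
Hypothesis HD : kahler_tensor J D.

Lemma kt_sum (a b c d : 'I_n -> R) :
  \sum_i \sum_j \sum_k \sum_l
    D (e i) (e j) (e k) (e l) * (a i * b j * c k * d l) =
  D (\sum_i a i *: e i) (\sum_i b i *: e i) (\sum_i c i *: e i)
    (\sum_i d i *: e i).
Proof.
set Y := \sum_i b i *: _; set Z := \sum_i c i *: _; set W := \sum_i d i *: _.
rewrite (big_morph (fun X => D X Y Z W) (fun X X' =>
  kt_D1 HD X X' Y Z W) (kt_01 HD Y Z W)).
apply: eq_bigr => i _; rewrite (kt_Z1 HD).
rewrite (big_morph (fun Y => D (e i) Y Z W) (fun X X' =>
  kt_D2 HD X X' _ Z W) (kt_02 HD _ Z W)).
rewrite mulr_sumr; apply: eq_bigr => j _; rewrite (kt_Z2 HD).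
rewrite (big_morph (fun Z => D (e i) (e j) Z W) (fun X X' =>
  kt_D3 HD X X' _ _ W) (kt_03 HD _ _ W)).
rewrite !mulr_sumr; apply: eq_bigr => k _; rewrite (kt_Z3 HD).
rewrite (big_morph (fun W => D (e i) (e j) (e k) W) (fun X X' =>
  kt_D4 HD X X' _ _ _) (kt_04 HD _ _ _)).
rewrite !mulr_sumr; apply: eq_bigr => l _; rewrite (kt_Z4 HD); ring.
Qed.

(** The pure terms of the expansion vanish by antisymmetry; the two mixed ones agree, and their sum
    is halved by the normalization. *)
Lemma curv_form_diff_sqr (xi eta : 'rV[R]_n) (X Y : V) :
  X = \sum_i xi ord0 i *: e i -> Y = \sum_i eta ord0 i *: e i ->
  curv_form D e ((Num.sqrt 2)^-1 *: (xi^T *m xi - eta^T *m eta)) = D X Y X Y.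
Proof.
move=> hX hY.
have s2 : (Num.sqrt 2)^-1 * (Num.sqrt 2)^-1 = 2^-1 :> R.
  by rewrite -invfM -expr2 sqr_sqrtr.
have E i j : ((Num.sqrt 2)^-1 *: (xi^T *m xi - eta^T *m eta)) i j =
    (Num.sqrt 2)^-1 * (xi ord0 i * xi ord0 j - eta ord0 i * eta ord0 j).
  by rewrite !mxE !big_ord1 !mxE.
transitivity (2^-1 * (D X X X X - D X Y Y X - D Y X X Y + D Y Y Y Y)).
  rewrite hX hY -!kt_sum -!sumrB -!big_split /= mulr_sumr.
  apply: eq_bigr => i _ /=.
  rewrite -!sumrB -!big_split /= mulr_sumr; apply: eq_bigr => j _ /=.
  rewrite -!sumrB -!big_split /= mulr_sumr; apply: eq_bigr => k _ /=.
  rewrite -!sumrB -!big_split /= mulr_sumr; apply: eq_bigr => l _ /=.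
  rewrite !E -s2; ring.
have h0 A B C : D A A B C = 0 by have := kt_anti12 HD A A B C => h; lra.
rewrite !h0 (kt_anti34 HD) (kt_anti12 HD X Y X Y).
by field.
Qed.

End MultilinearSums.

Section HermitianPoint.
Context {R : realType} {n : nat}.
Variables (g0 J0 : 'M[R]_n).
Hypothesis gT : g0^T = g0.
Hypothesis gpos : forall v : 'rV[R]_n, v != 0 -> 0 < (v *m g0 *m v^T) ord0 ord0.
Hypothesis JJ : J0 *m J0 = - 1%:M.
Hypothesis JgJ : J0 *m g0 *m J0^T = g0.
Let J (X : 'rV[R]_n) := X *m J0.

Definition gdot (X Y : 'rV[R]_n) : R := (X *m g0 *m Y^T) ord0 ord0.

Lemma gdot_lin a x y z : gdot (a *: x + y) z = a * gdot x z + gdot y z.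
Proof. by rewrite /gdot !mulmxDl -!scalemxAl !mxE. Qed.

Lemma gdotC x y : gdot x y = gdot y x.
Proof.
rewrite /gdot -[in RHS](trmxK (_ *m _ *m _)) [RHS]mxE !trmx_mul !trmxK gT.
by rewrite mulmxA.
Qed.

Lemma gdotZ a x : gdot (a *: x) (a *: x) = a ^+ 2 * gdot x x.
Proof.
by rewrite /gdot linearZ /= -!scalemxAl -scalemxAr !mxE expr2 mulrA.
Qed.

Lemma gdotJ x y : gdot (J x) (J y) = gdot x y.
Proof. by rewrite /gdot /J trmx_mul !mulmxA -(mulmxA x) -(mulmxA x) JgJ. Qed.

Lemma J0g : g0 *m J0^T = - (J0 *m g0).
Proof.
by rewrite -{2}JgJ !mulmxA JJ !mulNmx mul1mx opprK.
Qed.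

Lemma actJ_lin a X Y : J (a *: X + Y) = a *: J X + J Y.
Proof. by rewrite /J mulmxDl -scalemxAl. Qed.

Lemma actJK X : J (J X) = - X.
Proof. by rewrite /J -mulmxA JJ mulmxN mulmx1. Qed.

(** The empty family is completed with [P] the identity. Its length [r] is [n] because the matrix
    [Q] of its vectors has a left and a right inverse. *)
Lemma exists_frame : exists E : 'M[R]_n, E *m g0 *m E^T = 1%:M.
Proof.
have [q [r [_ _ oq _ hq]]] := orthonormal_upto_extend gdot_lin gdotC gpos
  (P := id) (q := fun=> 0) (r := 0) (fun a x y => erefl) (fun x => erefl)
  (fun x y => erefl) (fun i j hi => False_ind _ (notF hi)) (fun i hi =>
    False_ind _ (notF hi)).
pose Q := \matrix_(i < r) q i.
have Q1 : Q *m g0 *m Q^T = 1%:M.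
  apply/matrixP => i j; rewrite [RHS]mxE -(oq i j) // /gdot.
  have -> : (Q *m g0 *m Q^T) i j = (row i (Q *m g0 *m Q^T)) ord0 j by rewrite
    [RHS]mxE.
  rewrite !row_mul rowK [LHS]mxE [RHS]mxE; apply: eq_bigr => k _; congr (_ * _).
  by rewrite !mxE.
have Q2 : g0 *m Q^T *m Q = 1%:M.
  apply/row_matrixP => i; rewrite row1 [RHS]hq rowE mulmxA mulmx_sum_row.
  apply: eq_bigr => k _; rewrite rowK; congr (_ *: _).
  rewrite gdotC /gdot mulmxA !mxE; apply: eq_bigr => l _; by rewrite !mxE.
have r1 := mulmx1_min Q1.
have r2 := mulmx1_min Q2.
have rn : r = n by apply/eqP; rewrite eqn_leq r1 r2.
by subst r; exists Q.
Qed.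

End HermitianPoint.

Section KahlerPoint.
Context {R : realType} {m : nat}.
Local Notation n := (2 * m)%N.
Variables (g0 J0 : 'M[R]_n) (D : 'rV[R]_n -> 'rV[R]_n -> 'rV[R]_n ->
  'rV[R]_n -> R).
Hypothesis m2 : (2 <= m)%N.
Hypothesis gT : g0^T = g0.
Hypothesis gpos : forall v : 'rV[R]_n, v != 0 -> 0 < (v *m g0 *m v^T) ord0 ord0.
Hypothesis JJ : J0 *m J0 = - 1%:M.
Hypothesis JgJ : J0 *m g0 *m J0^T = g0.
Let J (X : 'rV[R]_n) := X *m J0.
Hypothesis HD : kahler_tensor J D.
Local Notation gdot := (gdot g0).
Variable alpha : R.
Hypothesis alphaN : 1 <= alpha <= (dimS20 n)%:R.
Hypothesis alpha_ge0 : forall E : 'M[R]_n, E *m g0 *m E^T = 1%:M ->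
  forall phi : 'I_(dimS20 n) -> 'M[R]_n, orthonormal_basisS20 phi ->
  0 <= alpha_sum alpha (fun i => curv_form D (fun j => row j E) (phi i)).
Hypothesis alpha_le : alpha <= 3 / 2 * (m%:R ^+ 2 - 1).

Lemma kahler_point_unit : exists c, [/\ 0 <= c,
  alpha < 3 / 2 * (m%:R ^+ 2 - 1) -> c = 0 &
  forall X, gdot X X = 1 -> D X (J X) X (J X) = c].
Proof.
have [E hE] := exists_frame gT gpos.
have hE2 : g0 *m E^T *m E = 1%:M by apply: mulmx1C; rewrite mulmxA.
(* The matrix of [J] in the frame, [g0 *m E^T] being the inverse of [E]. *)
pose Jm := E *m J0 *m g0 *m E^T.
have JmE : Jm *m E = E *m J0.
  by rewrite /Jm -(mulmxA (E *m J0)) -mulmxA hE2 mulmx1.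
have JmJm : Jm *m Jm = - 1%:M.
  by rewrite {2}/Jm !mulmxA JmE -(mulmxA E) JJ mulmxN mulmx1 !mulNmx hE.
have JmT : Jm^T = - Jm.
  by rewrite /Jm !trmx_mul trmxK gT -!mulmxA (mulmxA g0) (J0g JJ JgJ) !mulNmx
    mulmxN !mulmxA.
clearbody Jm.
pose e := fun j => row j E.
have Je i : J (e i) = \sum_j Jm i j *: e j.
  rewrite /J /e -row_mul -JmE row_mul mulmx_sum_row.
  by apply: eq_bigr => j _; rewrite mxE.
pose N1 : R := m%:R * (m%:R + 1).
have N10 : 0 < N1.
  by rewrite mulr_gt0 ?ltr_wpDl ?ler0n // ltr0n (leq_trans _ m2).
have key X : gdot X X = 1 -> [/\ 0 <= curv_scal D e,
    alpha < 3 / 2 * (m%:R ^+ 2 - 1) -> curv_scal D e <= 0 &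
    N1 * D X (J X) X (J X) = curv_scal D e].
  move=> XX.
  (* Frame coordinates of [X] and [J X], which are orthonormal row vectors. *)
  pose xi := X *m g0 *m E^T; pose eta := xi *m Jm.
  have hX : X = xi *m E by rewrite /xi -!mulmxA (mulmxA g0) hE2 mulmx1.
  have hY : J X = eta *m E by rewrite /eta -mulmxA JmE mulmxA -hX.
  have xixi : xi *m xi^T = 1%:M.
    have <- : X *m g0 *m X^T = 1%:M.
      by rewrite [LHS]mx11_scalar -/(gdot X X) XX.
    by rewrite {2}/xi !trmx_mul trmxK gT !mulmxA -[xi *m E]hX.
  have etaE : eta = xi *m Jm by [].
  clearbody eta; clearbody xi.
  have etaJ : eta *m Jm = - xi by rewrite etaE -mulmxA JmJm mulmxN mulmx1.
  have etaeta : eta *m eta^T = 1%:M.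
    by rewrite {2}etaE trmx_mul JmT mulNmx mulmxN mulmxA etaJ mulNmx opprK.
  have xieta : xi *m eta^T = 0.
    have : (xi *m eta^T)^T = - (xi *m eta^T).
      by rewrite trmx_mul trmxK etaE trmx_mul JmT mulNmx mulmxN opprK mulmxA.
    move=> /(congr1 (fun M : 'M_1 => M ord0 ord0)).
    move: (xi *m eta^T) => M; rewrite !mxE => h.
    by apply/matrixP => i j; rewrite !ord1 mxE; lra.
  have etaxi : eta *m xi^T = 0.
    by rewrite -[LHS]trmxK trmx_mul trmxK xieta trmx0.
  pose theta := (Num.sqrt 2)^-1 *: (xi^T *m xi - eta^T *m eta).
  have <- : curv_form D e theta = D X (J X) X (J X).
    apply: (curv_form_diff_sqr HD); first by rewrite {1}hX mulmx_sum_row.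
    by rewrite {1}hY mulmx_sum_row.
  have thetaT : theta^T = theta.
    by rewrite /theta linearZ /= linearB /= !trmx_mul !trmxK.
  apply: (curv_form_anti_const m2 (actJK JJ) HD Je JmJm JmT alphaN
    (alpha_ge0 hE)) => //.
  - rewrite /mxdot thetaT /theta -scalemxAl -scalemxAr scalerA -invfM -expr2.
    rewrite sqr_sqrtr // mulmxBl !mulmxBr !mulmxA.
    rewrite -!(mulmxA _ _ xi^T) -!(mulmxA _ _ eta^T) xixi etaeta xieta etaxi.
    rewrite !mulmx0 !mul0mx !mulmx1 subr0 sub0r opprK linearZ linearD /=.
    by rewrite !(mxtrace_mulC _^T) xixi etaeta mxtrace1; field.
  - rewrite /conjJ /theta -scalemxAr -scalemxAl -scalerN; congr (_ *: _).
    rewrite mulmxBr mulmxBl !mulmxA -!trmx_mul -!(mulmxA _ _ Jm) -etaE etaJ.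
    have -> : (- xi)^T = - xi^T by rewrite linearN.
    by rewrite mulNmx mulmxN opprK opprB.
have N1n : N1 != 0 by rewrite gt_eqF.
(* [key] yields the bounds on the scalar curvature only in the presence of a unit vector; the first
   frame vector is one. *)
have [X XX] : exists X, gdot X X = 1.
  have m0 : (0 < n)%N by rewrite muln_gt0 /= (leq_trans _ m2).
  exists (e (Ordinal m0)).
  have -> : gdot (e (Ordinal m0)) (e (Ordinal m0)) =
      (E *m g0 *m E^T) (Ordinal m0) (Ordinal m0).
    rewrite /gdot /e -row_mul [LHS]mxE [RHS]mxE; apply: eq_bigr => k _.
    by rewrite [row _ _ _ _]mxE; congr (_ * _); rewrite !mxE.
  by rewrite hE mxE eqxx.
have [S0 S1 _] := key X XX.
exists (curv_scal D e / N1); split.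
- by rewrite divr_ge0 // ltW.
- move=> /S1 S2; have -> : curv_scal D e = 0 by apply/eqP; rewrite eq_le S2 S0.
  by rewrite mul0r.
- by move=> Z /key[_ _ <-]; rewrite mulrC mulKf.
Qed.

Lemma kahler_point_hsc : exists c, [/\ 0 <= c,
  alpha < 3 / 2 * (m%:R ^+ 2 - 1) -> c = 0 &
  forall X, D X (J X) X (J X) = c * gdot X X ^+ 2].
Proof.
have [c [c0 ca hc]] := kahler_point_unit; exists c; split => // X.
have [->|X0] := eqVneq X 0.
  by rewrite (kt_01 HD) /gdot mul0mx mul0mx mxE expr0n mulr0.
have gX : 0 < gdot X X by exact: gpos.
pose t := Num.sqrt (gdot X X).
have t0 : t != 0 by rewrite gt_eqF // sqrtr_gt0.
have tt : t ^+ 2 = gdot X X by rewrite sqr_sqrtr // ltW.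
have [Y XE] : exists Y, X = t *: Y.
  by exists (t^-1 *: X); rewrite scalerA divff // scale1r.
have YY : gdot Y Y = 1.
  have t20 : t ^+ 2 != 0 by rewrite expf_neq0.
  by apply: (mulfI t20); rewrite -gdotZ -XE tt mulr1.
have JX : J X = t *: J Y by rewrite XE /J -scalemxAl.
rewrite JX -tt XE (kt_Z1 HD) (kt_Z2 HD) (kt_Z3 HD) (kt_Z4 HD) (hc _ YY); ring.
Qed.

End KahlerPoint.

(** * Calculus of smooth functions *)

Section NearDifferentiable.
Context {R : realType} {V W : normedModType R}.
Implicit Types f g : V -> W.

(** The difference [g - f] vanishes near [x], so it is differentiable there with zero
    differential. *)
Lemma near_eq_differentiable f g x :
  (\near x, f x = g x) -> differentiable f x -> differentiable g x.
Proof.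
move=> fg df.
pose h : V -> W := g - f.
have h0 : \near x, h x = 0.
  near=> y; rewrite -[LHS]/(g y - f y).
  by have -> : f y = g y by [near: y]; rewrite subrr.
have hx : h x = 0 by exact: (nbhs_singleton h0).
have ho : h \o shift x = cst (h x) + (0 : V -> W) +o_ 0 id.
  apply/eqaddoP => e e0; near=> y.
  rewrite -[X in `|X|]/(h (y + x) - (h x + 0)) hx addr0 subr0.
  have -> : h (y + x) = 0.
    by near: y; move: h0; rewrite (near_shift 0) /= subr0.
  by rewrite normr0 mulr_ge0 // ltW.
have dh : differentiable h x.
  apply/diff_locallyP; rewrite (_ : ('d h x : V -> W) = 0).
    by split; [move=> y; exact: cst_continuous|].
  have -> : 0 = (GRing.Linear.sort (\0%R : {linear V -> W})) by [].
  by apply: diff_unique => //; move=> y; exact: cst_continuous.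
have -> : g = f + h by rewrite /h addrC subrK.
exact: differentiableD.
Unshelve. all: by end_near. Qed.

End NearDifferentiable.

Section Schwarz.
Context {R : realType} {V : normedModType R}.
Implicit Types (f : V -> R).

Lemma is_derive_line f (v y : V) (s : R) :
  differentiable f (s *: v + y) ->
  is_derive s 1 (fun t : R => f (t *: v + y)) ('D_v f (s *: v + y)).
Proof.
move=> df; have dv : derivable f (s *: v + y) v by exact: diff_derivable.
have E : (fun h : R => h^-1 *: ((fun t : R =>
  f (t *: v + y)) (h *: 1 + s) - f (s *: v + y))) =
    (fun h : R => h^-1 *: (f (h *: v + (s *: v + y)) - f (s *: v + y))).
  by apply/funext => h; rewrite [h *: 1]mulr1 scalerDl addrA.
apply: DeriveDef; first by rewrite /derivable /= E.
by rewrite /derive /= E.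
Qed.

Lemma diff_approx f x e : differentiable f x -> 0 < e ->
  exists2 d, 0 < d & forall h : V, `|h| < d ->
    `|f (h + x) - f x - 'd f x h| <= e * `|h|.
Proof.
move=> /diff_locally /eqaddoP /(_ e) + e0 => /(_ e0) /nbhs_ballP[d /= d0 hd].
exists d => // h hh; have := hd h; rewrite -ball_normE /= sub0r normrN =>
  /(_ hh).
by rewrite !fctE /= opprD addrA.
Qed.

(** The mean value theorem along [v] reduces the second difference to a first difference of
    ['D_v f], which is then expanded to first order at [x]. *)
Lemma second_difference f (U : set V) (x v w : V) e :
  open U -> U x -> (forall y, U y -> differentiable f y) ->
  differentiable ('D_v f) x -> 0 < e ->
  exists2 d, 0 < d & forall t, 0 < t < d ->
    `|f (t *: v + (t *: w + x)) - f (t *: v + x) - f (t *: w + x) + f x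
      - t ^+ 2 * 'D_w ('D_v f) x| <= e * t ^+ 2.
Proof.
move=> oU Ux df ddf e0.
(* Displacements [s *: v + u *: w] with coefficients in [0, t] have norm at most [t * K]; the
   summand 1 makes [K] positive. *)
pose K := `|v| + `|w| + 1.
have K0 : 0 < K by rewrite /K ltr_wpDl ?addr_ge0.
have [d1 d10 H1] : exists2 d, 0 < d & forall h : V, `|h| < d -> U (h + x).
  have : nbhs x U by exact: open_nbhs_nbhs.
  move=> /nbhs_ballP[d /= d0 hd]; exists d => // h hh; apply: hd.
  by rewrite -ball_normE /= opprD addrA addrAC subrr sub0r normrN.
have [d2 d20 H2] := diff_approx ddf
  (divr_gt0 e0 (mulr_gt0 (ltr0n _ 2) K0) : 0 < e / (2 * K)).
exists (Num.min d1 d2 / K); first by rewrite divr_gt0 // lt_min d10.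
move=> t /andP[t0]; rewrite ltr_pdivlMr // => tK.
have bound s (u : R) : 0 <= s <= t -> 0 <= u <= t ->
  `|s *: v + u *: w| <= t * K.
  move=> /andP[s0 st] /andP[u0 ut]; apply: (le_trans (ler_normD _ _)).
  rewrite !normrZ !ger0_norm // /K !mulrDr mulr1 -[leLHS]addr0.
  by rewrite !lerD // ?ler_wpM2r // ltW.
have inU s (u : R) : 0 <= s <= t -> 0 <= u <= t -> U (s *: v + (u *: w + x)).
  move=> hs hu; rewrite addrA; apply: H1; apply: le_lt_trans (bound _ _ hs hu)
    _.
  by apply: lt_le_trans tK _; rewrite ge_min lexx.
have tt : 0 <= t <= t by rewrite lexx ltW.
have t00 : 0 <= (0 : R) <= t by rewrite lexx ltW.
(* The term [0 *: w] gives both points the shape to which [inU] and [small] apply. *)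
pose phi (s : R) := f (s *: v + (t *: w + x)) - f (s *: v + (0 *: w + x)).
pose dphi (s : R) := 'D_v f (s *: v + (t *: w + x)) - 'D_v f
  (s *: v + (0 *: w + x)).
have dp s : 0 <= s <= t -> is_derive s 1 phi (dphi s).
  move=> hs; apply: is_deriveB.
  - by apply: is_derive_line; apply: df; exact: inU.
  - by apply: is_derive_line; apply: df; exact: inU.
have [c ct Hc] : exists2 c, c \in `]0, t[%R & phi t - phi 0 = dphi c * (t - 0).
  apply: MVT => //.
  - by move=> s; rewrite in_itv /= => /andP[s0 st]; apply: dp; rewrite !ltW.
  - apply: derivable_within_continuous => s; rewrite in_itv /= => hs.
    by have [] := dp s hs.
have hc : 0 <= c <= t by move: ct; rewrite in_itv /= => /andP[? ?];
  rewrite !ltW.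
have -> : f (t *: v + (t *: w + x)) - f (t *: v + x) - f (t *: w + x) + f x
    = phi t - phi 0.
  rewrite /phi !scale0r !add0r; ring.
rewrite Hc subr0.
have ddE : 'D_w ('D_v f) x = 'd ('D_v f) x w by rewrite deriveE.
have small s (u : R) : 0 <= s <= t -> 0 <= u <= t ->
    `|'D_v f (s *: v + (u *: w + x)) - 'D_v f x - 'd ('D_v f) x
      (s *: v + u *: w)| <= e / 2 * t.
  move=> hs hu; rewrite addrA; apply: le_trans (H2 _ _) _.
    apply: le_lt_trans (bound _ _ hs hu) _.
    by apply: lt_le_trans tK _; rewrite ge_min lexx orbT.
  have -> : e / 2 * t = e / (2 * K) * (t * K).
    by rewrite invfM; field; rewrite gt_eqF.
  rewrite ler_wpM2l ?bound // ltW // divr_gt0 // mulr_gt0 //.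
have s1 := small c t hc tt; have s2 := small c 0 hc t00.
have -> : dphi c * t - t ^+ 2 * 'D_w ('D_v f) x = t * (
   ('D_v f (c *: v + (t *: w + x)) - 'D_v f x - 'd ('D_v f) x (c *: v + t *: w))
  - ('D_v f (c *: v + (0 *: w + x)) - 'D_v f x - 'd ('D_v f) x
    (c *: v + 0 *: w))).
  have L s (u : R) : 'd ('D_v f) x (s *: v + u *: w) =
      s * 'd ('D_v f) x v + u * 'd ('D_v f) x w by rewrite linearD !linearZ.
  by rewrite ddE /dphi !L; ring.
rewrite normrM (ger0_norm (ltW t0)) expr2 mulrCA ler_pM2l //.
apply: le_trans (ler_normB _ _) _; lra.
Qed.

(** The second difference is symmetric in [v] and [w], and divided by [t ^+ 2] it approximates both
    mixed derivatives. *)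
Lemma derive_comm f (U : set V) (x v w : V) :
  open U -> U x -> (forall y, U y -> differentiable f y) ->
  differentiable ('D_v f) x -> differentiable ('D_w f) x ->
  'D_v ('D_w f) x = 'D_w ('D_v f) x.
Proof.
move=> oU Ux df dv dw; apply/eqP; rewrite -subr_eq0 -normr_le0.
apply/ler_addgt0Pr => e e0; rewrite add0r.
have e2 : 0 < e / 2 by rewrite divr_gt0.
have [d1 d10 H1] := second_difference w oU Ux df dv e2.
have [d2 d20 H2] := second_difference v oU Ux df dw e2.
pose t := Num.min d1 d2 / 2.
have m0 : 0 < Num.min d1 d2 by rewrite lt_min d10.
have t0 : 0 < t by rewrite divr_gt0.
have tm : t < Num.min d1 d2 by rewrite /t; lra.
have h1 := H1 t; have h2 := H2 t.
have t1 : 0 < t < d1 by rewrite t0 (lt_le_trans tm) // ge_min lexx.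
have t2 : 0 < t < d2 by rewrite t0 (lt_le_trans tm) // ge_min lexx orbT.
have {}h1 := h1 t1; have {}h2 := h2 t2.
rewrite (addrCA (t *: w)) in h2.
set p := 'D_w _ x in h1 *; set q := 'D_v _ x in h2 *.
have key : `|t ^+ 2 * (q - p)| <= t ^+ 2 * e.
  have E (y : R) A B C D : y * (q - p) =
    (A - B - C + D - y * p) - (A - C - B + D - y * q) by ring.
  rewrite (E _ (f (t *: v + (t *: w + x))) (f (t *: v + x)) (f (t *: w + x))
    (f x)).
  apply: le_trans (ler_normB _ _) _.
  rewrite [leRHS]mulrC [in leRHS](splitr e) mulrDl; exact: lerD h1 h2.
have t20 : 0 < t ^+ 2 by exact: exprn_gt0.
by move: key; rewrite normrM (gtr0_norm t20) ler_pM2l.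
Qed.

End Schwarz.

Section Partial.
Context {R : realType} {n : nat}.
Implicit Types (f g : 'rV[R]_n -> R) (U : set 'rV[R]_n).

Lemma open_near_eq U f g x : open U -> U x ->
  (forall y, U y -> f y = g y) -> \near x, f x = g x.
Proof.
move=> oU Ux fg; have : nbhs x U by exact: open_nbhs_nbhs.
by apply: filterS => y; exact: fg.
Qed.

Lemma eq_partial_on U f g i x : open U -> U x ->
  (forall y, U y -> f y = g y) -> partial i f x = partial i g x.
Proof. by move=> oU Ux fg; apply: near_eq_derive; exact: open_near_eq fg. Qed.

Lemma partialD f g i x : differentiable f x -> differentiable g x ->
  partial i (fun y => f y + g y) x = partial i f x + partial i g x.
Proof. by move=> df dg; apply: deriveD; exact: diff_derivable. Qed.

Lemma partialN f i x : differentiable f x ->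
  partial i (fun y => - f y) x = - partial i f x.
Proof. by move=> df; apply: deriveN; exact: diff_derivable. Qed.

Lemma partialM f g i x : differentiable f x -> differentiable g x ->
  partial i (fun y => f y * g y) x = partial i f x * g x + f x * partial i g x.
Proof.
move=> df dg; rewrite /partial; have := @deriveM _ _ f g x (delta_mx ord0 i)
  (diff_derivable df) (diff_derivable dg).
by rewrite /= => ->; rewrite addrC [g x *: _]mulrC.
Qed.

Lemma partial_cst (c : R) (i : 'I_n) x : partial i (fun=> c) x = 0.
Proof. exact: derive_cst. Qed.

Lemma partialV f i x : differentiable f x -> f x != 0 ->
  partial i (fun y => (f y)^-1) x = - ((f x)^-1 * (f x)^-1 * partial i f x).
Proof.
move=> df f0; rewrite /partial; have := @deriveV _ _ f x (delta_mx ord0 i) f0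
  (diff_derivable df).
by rewrite /= => ->; rewrite -exprVn expr2 scaleNr.
Qed.

Lemma differentiable_bigsum (I : Type) (r : seq I) (P : pred I)
    (F : I -> 'rV[R]_n -> R) x :
  (forall k, differentiable (F k) x) ->
  differentiable (fun y => \sum_(k <- r | P k) F k y) x.
Proof.
move=> dF; elim: r => [|k r IH].
  by under eq_fun do rewrite big_nil; exact: differentiable_cst.
under eq_fun do rewrite big_cons.
by case: (P k) => //; exact: differentiableD.
Qed.

Lemma partial_sum (I : Type) (r : seq I) (F : I -> 'rV[R]_n -> R) i x :
  (forall k, differentiable (F k) x) ->
  partial i (fun y => \sum_(k <- r) F k y) x = \sum_(k <- r) partial i (F k) x.
Proof.
move=> dF; elim: r => [|k r IH].
  by under eq_fun do rewrite big_nil; rewrite big_nil partial_cst.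
under eq_fun do rewrite big_cons.
by rewrite big_cons partialD ?IH //; exact: differentiable_bigsum.
Qed.

Lemma diff_partialE f x (v : 'rV[R]_n) : differentiable f x ->
  'd f x v = \sum_i v ord0 i * partial i f x.
Proof.
move=> df; rewrite [in LHS](row_sum_delta v) linear_sum; apply: eq_bigr => i _.
by rewrite linearZ /= /partial deriveE.
Qed.

Lemma partial_comm U f i j x : open U -> U x ->
  (forall y, U y -> differentiable f y) ->
  differentiable (partial i f) x -> differentiable (partial j f) x ->
  partial i (partial j f) x = partial j (partial i f) x.
Proof. exact: derive_comm. Qed.

End Partial.

Section SmoothClosure.
Context {R : realType} {n : nat} (U : set 'rV[R]_n).
Hypothesis oU : open U.
Implicit Types (f g : 'rV[R]_n -> R).

(** Smoothness to finite order, recursing on the first derivative taken, so that the product and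
    quotient rules go through by induction on the order. *)
Fixpoint diff_upto (k : nat) f : Prop :=
  (forall x, U x -> differentiable f x) /\
  (if k is k'.+1 then forall i, diff_upto k' (partial i f) else True).

Lemma diff_uptoW k f : diff_upto k f -> forall x, U x -> differentiable f x.
Proof. by case: k => [|k] []. Qed.

Lemma diff_upto_pred k f : diff_upto k.+1 f -> diff_upto k f.
Proof.
elim: k f => [|k IH] f [df pf]; split => // i.
by apply: IH; exact: pf.
Qed.

Lemma eq_diff_upto k f g : (forall x, U x -> f x = g x) ->
  diff_upto k f -> diff_upto k g.
Proof.
elim: k f g => [|k IH] f g fg [df pf]; split => //.
- by move=> x Ux; apply: near_eq_differentiable (df x Ux);
  exact: open_near_eq fg.
- by move=> x Ux; apply: near_eq_differentiable (df x Ux);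
  exact: open_near_eq fg.
- by move=> i; apply: IH (pf i) => x Ux; exact: (eq_partial_on i oU Ux).
Qed.

(** [foldr] differentiates along the last index of the list first, hence the induction from the
    right. *)
Lemma smooth_onP f : smooth_on U f <-> forall k, diff_upto k f.
Proof.
split=> [sf k|hf s].
  elim: k f sf => [|k IH] f sf; split=> //; try exact: (sf [::]).
  move=> i; apply: IH => s x Ux; have := sf (rcons s i) x Ux.
  by rewrite foldr_rcons.
elim/last_ind: s f hf => [|s i IH] f hf x Ux;
  first exact: diff_uptoW (hf 0) x Ux.
rewrite foldr_rcons; apply: IH => // k.
by have [_ /(_ i)] := hf k.+1.
Qed.

Lemma diff_upto_cst k (c : R) : diff_upto k (fun=> c).
Proof.
elim: k c => [|k IH] c; split => //; try by move=> x _;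
  exact: differentiable_cst.
by move=> i; apply: eq_diff_upto (IH 0) => x _; rewrite partial_cst.
Qed.

Lemma diff_uptoD k f g : diff_upto k f -> diff_upto k g ->
  diff_upto k (fun x => f x + g x).
Proof.
elim: k f g => [|k IH] f g [df pf] [dg pg]; split => //;
  try by move=> x Ux; apply: differentiableD; [exact: df|exact: dg].
move=> i; apply: eq_diff_upto (IH _ _ (pf i) (pg i)) => x Ux.
by rewrite partialD //; [exact: df|exact: dg].
Qed.

Lemma diff_uptoM k f g : diff_upto k f -> diff_upto k g ->
  diff_upto k (fun x => f x * g x).
Proof.
elim: k f g => [|k IH] f g hf hg; have [df pf] := hf; have [dg pg] := hg;
  split => //;
  try by move=> x Ux; apply: differentiableM; [exact: df|exact: dg].
move=> i; have [hf' hg'] := (diff_upto_pred hf, diff_upto_pred hg).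
apply: eq_diff_upto (diff_uptoD (IH _ _ (pf i) hg') (IH _ _ hf' (pg i))) =>
  x Ux.
by rewrite partialM //; [exact: df|exact: dg].
Qed.

(** The derivative of the inverse contains the inverse again, but is needed to one order less. *)
Lemma diff_uptoV k f : (forall x, U x -> f x != 0) -> diff_upto k f ->
  diff_upto k (fun x => (f x)^-1).
Proof.
move=> f0; elim: k => [|k IH] hf; have [df pf] := hf; split => //;
  try by move=> x Ux; apply: differentiableV; [exact: df|exact: f0].
move=> i; have Vf := IH (diff_upto_pred hf).
have := diff_uptoM (diff_upto_cst k (-1))
  (diff_uptoM (diff_uptoM Vf Vf) (pf i)).
apply: eq_diff_upto => x Ux.
by rewrite partialV ?mulN1r //; [exact: df|exact: f0].
Qed.

Lemma smoothD f g : smooth_on U f -> smooth_on U g ->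
  smooth_on U (fun x => f x + g x).
Proof. by move=> /smooth_onP hf /smooth_onP hg; apply/smooth_onP => k;
  exact: diff_uptoD. Qed.

Lemma smoothM f g : smooth_on U f -> smooth_on U g ->
  smooth_on U (fun x => f x * g x).
Proof. by move=> /smooth_onP hf /smooth_onP hg; apply/smooth_onP => k;
  exact: diff_uptoM. Qed.

Lemma smoothV f : (forall x, U x -> f x != 0) -> smooth_on U f ->
  smooth_on U (fun x => (f x)^-1).
Proof. by move=> f0 /smooth_onP hf; apply/smooth_onP => k;
  exact: diff_uptoV. Qed.

Lemma smooth_cst (c : R) : smooth_on U (fun=> c).
Proof. by apply/smooth_onP => k; exact: diff_upto_cst. Qed.

Lemma smoothN f : smooth_on U f -> smooth_on U (fun x => - f x).
Proof.
move=> hf; have := smoothM (smooth_cst (-1)) hf.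
by rewrite (_ : (fun x => _ * _) = (fun x => - f x)) //; apply/funext => x;
  rewrite mulN1r.
Qed.

Lemma eq_smooth_on f g : (forall x, U x -> f x = g x) ->
  smooth_on U f -> smooth_on U g.
Proof.
by move=> fg /smooth_onP hf; apply/smooth_onP => k; exact: eq_diff_upto (hf k).
Qed.

Lemma smooth_partial f i : smooth_on U f -> smooth_on U (partial i f).
Proof. by move=> hf s x Ux; have := hf (rcons s i) x Ux;
  rewrite foldr_rcons. Qed.

Lemma smooth_diff f x : smooth_on U f -> U x -> differentiable f x.
Proof. by move=> hf; exact: (hf [::]). Qed.

Lemma smooth_partial_comm f i j x : smooth_on U f -> U x ->
  partial i (partial j f) x = partial j (partial i f) x.
Proof.
move=> sf Ux; apply: (partial_comm oU Ux) => [y Uy| |].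
- exact: smooth_diff.
- by apply: smooth_diff => //; exact: smooth_partial.
- by apply: smooth_diff => //; exact: smooth_partial.
Qed.

Lemma smooth_sum (I : Type) (r : seq I) (F : I -> 'rV[R]_n -> R) :
  (forall k, smooth_on U (F k)) -> smooth_on U (fun x => \sum_(k <- r) F k x).
Proof.
move=> sF; elim: r => [|k r IH].
  by under eq_fun do rewrite big_nil; exact: smooth_cst.
by under eq_fun do rewrite big_cons; exact: smoothD.
Qed.

Lemma smooth_prod (I : Type) (r : seq I) (F : I -> 'rV[R]_n -> R) :
  (forall k, smooth_on U (F k)) -> smooth_on U (fun x => \prod_(k <- r) F k x).
Proof.
move=> sF; elim: r => [|k r IH].
  by under eq_fun do rewrite big_nil; exact: smooth_cst.
by under eq_fun do rewrite big_cons; exact: smoothM.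
Qed.

Lemma smooth_det k (M : 'rV[R]_n -> 'M[R]_k) :
  (forall i j, smooth_on U (fun x => M x i j)) -> smooth_on U (fun x =>
    \det (M x)).
Proof.
move=> sM; apply: smooth_sum => s; apply: smoothM; first exact: smooth_cst.
exact: smooth_prod.
Qed.

(** By Cramer's rule the entries are quotients of polynomials in the entries of [M]. *)
Lemma smooth_invmx k (M : 'rV[R]_n -> 'M[R]_k) :
  (forall x, U x -> M x \in unitmx) ->
  (forall i j, smooth_on U (fun x => M x i j)) ->
  forall i j, smooth_on U (fun x => invmx (M x) i j).
Proof.
move=> uM sM i j.
apply: (@eq_smooth_on (fun x => (\det (M x))^-1 * cofactor (M x) j i)).
  by move=> x Ux; rewrite /invmx uM // !mxE.
apply: smoothM.
  apply: smoothV; last exact: smooth_det.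
  by move=> x Ux; have := uM x Ux; rewrite unitmxE unitfE.
apply: smoothM; first exact: smooth_cst.
apply: smooth_det => a b.
by under eq_fun do rewrite !mxE; exact: sM.
Qed.

End SmoothClosure.

(* Locked: otherwise unification of distinct instances unfolds derivatives.   *)
HB.lock Definition pmx (R : realType) (n k l : nat) (i : 'I_n)
    (M : 'rV[R]_n -> 'M[R]_(k, l)) (x : 'rV[R]_n) : 'M[R]_(k, l) :=
  \matrix_(a, b) partial i (fun y => M y a b) x.
Canonical pmx_unlockable := Unlockable pmx.unlock.

Section MatrixPartial.
Context {R : realType} {n : nat}.

Definition diffmx k l (M : 'rV[R]_n -> 'M[R]_(k, l)) (x : 'rV[R]_n) : Prop :=
  forall a b, differentiable (fun y => M y a b) x.

Lemma pmxE k l (i : 'I_n) (M : 'rV[R]_n -> 'M[R]_(k, l)) x a b :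
  pmx i M x a b = partial i (fun y => M y a b) x.
Proof. by rewrite unlock mxE. Qed.

Definition smoothmx k l (U : set 'rV[R]_n) (M : 'rV[R]_n ->
  'M[R]_(k, l)) : Prop :=
  forall a b, smooth_on U (fun y => M y a b).

Lemma diffmxD k l (M N : 'rV[R]_n -> 'M[R]_(k, l)) x :
  diffmx M x -> diffmx N x -> diffmx (fun y => M y + N y) x.
Proof.
by move=> dM dN a b; under eq_fun do rewrite mxE; exact: differentiableD.
Qed.

Lemma diffmxN k l (M : 'rV[R]_n -> 'M[R]_(k, l)) x :
  diffmx M x -> diffmx (fun y => - M y) x.
Proof.
by move=> dM a b; under eq_fun do rewrite mxE; exact: differentiableN.
Qed.

Lemma diffmxM k l p (M : 'rV[R]_n -> 'M[R]_(k, l)) (N : 'rV[R]_n ->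
  'M[R]_(l, p)) x :
  diffmx M x -> diffmx N x -> diffmx (fun y => M y *m N y) x.
Proof.
move=> dM dN a b; under eq_fun do rewrite mxE.
by apply: differentiable_bigsum => c; exact: differentiableM.
Qed.

Lemma diffmxT k l (M : 'rV[R]_n -> 'M[R]_(k, l)) x :
  diffmx M x -> diffmx (fun y => (M y)^T) x.
Proof. by move=> dM a b; under eq_fun do rewrite mxE; exact: dM. Qed.

Lemma pmxD k l (M N : 'rV[R]_n -> 'M[R]_(k, l)) i x :
  diffmx M x -> diffmx N x -> pmx i (fun y =>
    M y + N y) x = pmx i M x + pmx i N x.
Proof.
move=> dM dN; apply/matrixP => a b; rewrite mxE !pmxE.
by under eq_fun do rewrite mxE; rewrite partialD.
Qed.

Lemma pmxN k l (M : 'rV[R]_n -> 'M[R]_(k, l)) i x :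
  diffmx M x -> pmx i (fun y => - M y) x = - pmx i M x.
Proof.
move=> dM; apply/matrixP => a b; rewrite mxE !pmxE.
by under eq_fun do rewrite mxE; rewrite partialN.
Qed.

Lemma pmxM k l p (M : 'rV[R]_n -> 'M[R]_(k, l)) (N : 'rV[R]_n ->
  'M[R]_(l, p)) i x :
  diffmx M x -> diffmx N x ->
  pmx i (fun y => M y *m N y) x = pmx i M x *m N x + M x *m pmx i N x.
Proof.
move=> dM dN; apply/matrixP => a b; rewrite pmxE !mxE.
under eq_fun do rewrite mxE.
rewrite partial_sum; last by move=> c; exact: differentiableM.
rewrite -big_split; apply: eq_bigr => c _.
by rewrite partialM // !pmxE.
Qed.

Lemma pmxT k l (M : 'rV[R]_n -> 'M[R]_(k, l)) i x :
  pmx i (fun y => (M y)^T) x = (pmx i M x)^T.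
Proof. by apply/matrixP => a b; rewrite mxE !pmxE;
  under eq_fun do rewrite mxE. Qed.

Lemma eq_pmx_on k l U (M N : 'rV[R]_n -> 'M[R]_(k, l)) i x : open U -> U x ->
  (forall y, U y -> M y = N y) -> pmx i M x = pmx i N x.
Proof.
move=> oU Ux MN; apply/matrixP => a b; rewrite !pmxE.
by apply: (eq_partial_on i oU Ux) => y Uy; rewrite MN.
Qed.

Lemma smoothmx_pmx k l U (M : 'rV[R]_n -> 'M[R]_(k, l)) i :
  smoothmx U M -> smoothmx U (pmx i M).
Proof.
by move=> sM a b; under eq_fun do rewrite pmxE; exact: smooth_partial.
Qed.

Lemma smoothmx_diff k l U (M : 'rV[R]_n -> 'M[R]_(k, l)) x :
  smoothmx U M -> U x -> diffmx M x.
Proof. by move=> sM Ux a b; exact: smooth_diff (sM a b) Ux. Qed.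

Lemma pmx_comm k l U (M : 'rV[R]_n -> 'M[R]_(k, l)) i j x : open U -> U x ->
  smoothmx U M -> pmx i (pmx j M) x = pmx j (pmx i M) x.
Proof.
move=> oU Ux sM; apply/matrixP => a b.
have E i' j' : pmx i' (pmx j' M) x a b = partial i' (partial j' (fun y =>
  M y a b)) x.
  by rewrite pmxE; congr (partial _ _ x); apply/funext => y; rewrite pmxE.
rewrite !E; exact: (smooth_partial_comm oU i j (sM a b) Ux).
Qed.

Lemma partial_mxtrace k (M : 'rV[R]_n -> 'M[R]_k) i x :
  diffmx M x -> partial i (fun y => \tr (M y)) x = \tr (pmx i M x).
Proof.
move=> dM; rewrite /mxtrace partial_sum //.
by apply: eq_bigr => a _; rewrite pmxE.
Qed.

End MatrixPartial.

(** * Connection matrices and their curvature *)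

(** For identities that become additive once products are expanded: [mx_abel] abstracts every
    product, transpose and derivative, and concludes entrywise. *)
Ltac mx_expand :=
  rewrite ?(mulmxDl, mulmxDr, mulNmx, mulmxN, opprD, opprK, mulmxA).
Ltac mx_abel :=
  repeat match goal with |- context [mulmx ?A ?B] => move: (mulmx A B) => ? end;
  repeat match goal with |- context [trmx ?A] => move: (trmx A) => ? end;
  repeat match goal with |- context [pmx ?i ?A ?x] => move: (pmx i A x) =>
    ? end;
  apply/matrixP => ? ?; rewrite !mxE; ring.

Section ConnectionForms.
Context {R : realType} {n : nat} (U : set 'rV[R]_n).
Hypothesis oU : open U.
Variable A : 'I_n -> 'rV[R]_n -> 'M[R]_n.
Hypothesis sA : forall i, smoothmx U (A i).

(** The covariant derivative of a field [v] of row vectors is [pmx i v + v *m A i]; connection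
    matrices act from the right, hence the reversed order of the products. *)
Definition curvF (i j : 'I_n) (x : 'rV[R]_n) : 'M[R]_n :=
  pmx i (A j) x - pmx j (A i) x + (A j x *m A i x - A i x *m A j x).

Let dA i x : U x -> diffmx (A i) x.
Proof. by move=> Ux; exact: smoothmx_diff (sA i) Ux. Qed.
Let dpA i j x : U x -> diffmx (pmx j (A i)) x.
Proof. by move=> Ux; exact: (smoothmx_diff (smoothmx_pmx j (sA i)) Ux). Qed.

Lemma curvF_diff i j x : U x -> diffmx (curvF i j) x.
Proof.
move=> Ux; apply: diffmxD; first by apply: diffmxD; [|apply: diffmxN];
  exact: dpA.
by apply: diffmxD; [|apply: diffmxN]; apply: diffmxM; exact: dA.
Qed.

Lemma curvF_pmx i j k x : U x -> pmx k (curvF i j) x =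
  pmx k (pmx i (A j)) x - pmx k (pmx j (A i)) x
  + (pmx k (A j) x *m A i x + A j x *m pmx k (A i) x
     - (pmx k (A i) x *m A j x + A i x *m pmx k (A j) x)).
Proof.
move=> Ux; have h1 a := dA a Ux; have h2 a b := dpA a b Ux.
have hN a b : diffmx (fun y => - pmx a (A b) y) x by exact: diffmxN (h2 b a).
have hM a b : diffmx (fun y => A a y *m A b y) x by exact: diffmxM (h1 a)
  (h1 b).
have hMN a b : diffmx (fun y => - (A a y *m A b y)) x by exact: diffmxN
  (hM a b).
rewrite /curvF (pmxD k (diffmxD (h2 j i) (hN j i))
  (diffmxD (hM j i) (hMN i j))).
rewrite (pmxD k (h2 j i) (hN j i)) (pmxD k (hM j i) (hMN i j)).
rewrite (pmxN k (h2 i j)) (pmxN k (hM i j)).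
by rewrite (pmxM k (h1 j) (h1 i)) (pmxM k (h1 i) (h1 j)).
Qed.

(** Each bracket is a covariant derivative of the curvature. Second derivatives of [A] cancel by
    their symmetry, the remaining products algebraically. *)
Lemma second_bianchi i j k x : U x ->
  (pmx k (curvF i j) x + curvF i j x *m A k x - A k x *m curvF i j x)
  + (pmx i (curvF j k) x + curvF j k x *m A i x - A i x *m curvF j k x)
  + (pmx j (curvF k i) x + curvF k i x *m A j x - A j x *m curvF k i x) = 0.
Proof.
move=> Ux; rewrite !curvF_pmx // /curvF.
rewrite (pmx_comm k i oU Ux (sA j)) (pmx_comm k j oU Ux (sA i)).
rewrite (pmx_comm j i oU Ux (sA k)).
mx_expand; mx_abel.
Qed.

(** The integrability condition for a parallel [J]: differentiate its equation once more and use the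
    symmetry of second derivatives. *)
Lemma curvF_parallel_endo (J : 'rV[R]_n -> 'M[R]_n) i j x :
  smoothmx U J ->
  (forall k y, U y -> pmx k J y = A k y *m J y - J y *m A k y) ->
  U x -> curvF i j x *m J x = J x *m curvF i j x.
Proof.
move=> sJ hJ Ux.
have dJ : diffmx J x by exact: smoothmx_diff Ux.
have E a b : pmx a (pmx b J) x =
    pmx a (A b) x *m J x + A b x *m (A a x *m J x - J x *m A a x)
    - ((A a x *m J x - J x *m A a x) *m A b x + J x *m pmx a (A b) x).
  rewrite (eq_pmx_on a oU Ux (hJ b)) pmxD; last by apply: diffmxN;
    apply: diffmxM => //; exact: dA.
    rewrite pmxN; last by apply: diffmxM => //; exact: dA.
    by rewrite !pmxM //; try exact: dA; rewrite !hJ.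
  by apply: diffmxM => //; exact: dA.
have := pmx_comm i j oU Ux sJ; rewrite !E => /eqP; rewrite -subr_eq0 => /eqP E0.
apply/eqP; rewrite -subr_eq0; apply/eqP; rewrite -[RHS]E0 /curvF.
mx_expand; mx_abel.
Qed.

(** The same integrability argument for a parallel bilinear form. *)
Lemma curvF_parallel_form (g : 'rV[R]_n -> 'M[R]_n) i j x :
  smoothmx U g ->
  (forall k y, U y -> pmx k g y = A k y *m g y + g y *m (A k y)^T) ->
  U x -> curvF i j x *m g x + g x *m (curvF i j x)^T = 0.
Proof.
move=> sg hg Ux.
have dg : diffmx g x by exact: smoothmx_diff Ux.
have dAT k : diffmx (fun y => (A k y)^T) x by apply: diffmxT; exact: dA.
have E a b : pmx a (pmx b g) x =
    pmx a (A b) x *m g x + A b x *m (A a x *m g x + g x *m (A a x)^T)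
    + ((A a x *m g x + g x *m (A a x)^T) *m (A b x)^T + g x *m
      (pmx a (A b) x)^T).
  rewrite (eq_pmx_on a oU Ux (hg b)) pmxD; last by apply: diffmxM.
    by rewrite !pmxM //; try exact: dA; rewrite !hg // pmxT.
  by apply: diffmxM => //; exact: dA.
have := pmx_comm i j oU Ux sg; rewrite !E => /eqP; rewrite -subr_eq0 => /eqP E0.
have tD (X Y : 'M[R]_n) : (X + Y)^T = X^T + Y^T by rewrite linearD.
have tN (X : 'M[R]_n) : (- X)^T = - X^T by rewrite linearN.
rewrite -[RHS]E0 /curvF !(tD, tN, trmx_mul).
mx_expand; mx_abel.
Qed.

Hypothesis symA : forall i j k x, U x -> A i x j k = A j x i k.

(** [symA] expresses that the connection is torsion-free; derivatives and products then cancel in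
    pairs. *)
Lemma first_bianchi i j l p x : U x ->
  curvF i j x l p + curvF j l x i p + curvF l i x j p = 0.
Proof.
move=> Ux; rewrite /curvF.
have E a b c : pmx a (A b) x c p = pmx a (A c) x b p.
  rewrite !pmxE; apply: (eq_partial_on a oU Ux) => y Uy; exact: symA.
have M a b c : (A a x *m A b x) c p = (A c x *m A b x) a p.
  by rewrite [LHS]mxE [RHS]mxE; apply: eq_bigr => q _; rewrite symA.
have D3 (X Y Z W : 'M[R]_n) a : (X - Y + (Z - W)) a p = X a p - Y a p +
  (Z a p - W a p).
  by rewrite !mxE.
rewrite !D3 (E i j l) (E j i l) (E l i j) (M j i l) (M i j l) (M i l j); ring.
Qed.

End ConnectionForms.

HB.lock Definition conn (R : realType) (n : nat) (g : 'rV[R]_n -> 'M[R]_n)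
    (i : 'I_n) (x : 'rV[R]_n) : 'M[R]_n :=
  \matrix_(j, k) christoffel g k i j x.
Canonical conn_unlockable := Unlockable conn.unlock.

Section LeviCivita.
Context {R : realType} {n : nat} (U : set 'rV[R]_n) (g : 'rV[R]_n -> 'M[R]_n).
Hypothesis oU : open U.
Hypothesis sg : smoothmx U g.
Hypothesis gT : forall x, U x -> (g x)^T = g x.
Hypothesis gu : forall x, U x -> g x \in unitmx.

Local Notation conn := (conn g).

Lemma connE i j k x : conn i x j k = christoffel g k i j x.
Proof. by rewrite unlock mxE. Qed.

Let dg i x j l := partial i (fun y => g y j l) x.

Let dgC i x j l : U x -> dg i x j l = dg i x l j.
Proof.
move=> Ux; apply: (eq_partial_on i oU Ux) => y Uy.
by rewrite -[in LHS](gT Uy) mxE.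
Qed.

Let koszul i x j l : U x ->
  (conn i x *m g x) j l = 2^-1 * (dg i x j l + dg j x i l - dg l x i j).
Proof.
move=> Ux.
pose T := \matrix_(j, l) (2^-1 * (dg i x j l + dg j x i l - dg l x i j)).
have -> : conn i x = T *m invmx (g x).
  apply/matrixP => a b; rewrite [RHS]mxE connE /christoffel mulr_sumr.
  apply: eq_bigr => c _; rewrite mxE.
  have -> : invmx (g x) b c = invmx (g x) c b.
    by rewrite -[in RHS](gT Ux) -trmx_inv mxE.
  by rewrite mulrCA mulrC.
by rewrite mulmxKV ?gu // mxE.
Qed.

Lemma conn_sym i j k x : U x -> conn i x j k = conn j x i k.
Proof.
move=> Ux; rewrite !connE /christoffel; congr (_ * _).
apply: eq_bigr => l _; congr (_ * _).
by rewrite -/(dg l x i j) (dgC _ _ _ Ux) /dg; ring.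
Qed.

Lemma conn_metric i x : U x ->
  pmx i g x = conn i x *m g x + g x *m (conn i x)^T.
Proof.
move=> Ux.
have -> : g x *m (conn i x)^T = (conn i x *m g x)^T by rewrite trmx_mul gT.
apply/matrixP => j l; rewrite pmxE.
have DE (X : 'M[R]_n) : (X + X^T) j l = X j l + X l j by rewrite !mxE.
rewrite DE !koszul // -/(dg i x j l) (dgC i l j Ux).
by field.
Qed.

(** The two conditions determine [A i *m g x] by the Koszul formula. This identifies the connection
    after a change of chart. *)
Lemma conn_unique (A : 'I_n -> 'M[R]_n) x : U x ->
  (forall i j k, A i j k = A j i k) ->
  (forall i, pmx i g x = A i *m g x + g x *m (A i)^T) ->
  forall i, A i = conn i x.
Proof.
move=> Ux symA metA i.
rewrite -[A i](mulmxK (gu Ux)) -[conn i x](mulmxK (gu Ux)); congr (_ *m _).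
pose S i j l := (A i *m g x) j l.
have symS a b c : S a b c = S b a c.
  by rewrite /S !mxE; apply: eq_bigr => k _; rewrite symA.
have dS a b c : dg a x b c = S a b c + S a c b.
  have := congr1 (fun X : 'M[R]_n => X b c) (metA a).
  have -> : g x *m (A a)^T = (A a *m g x)^T by rewrite trmx_mul gT.
  by rewrite /S; move: (A a *m g x) => X; rewrite pmxE !mxE.
apply/matrixP => j l; rewrite koszul // -/(S i j l) !dS.
by rewrite (symS j i l) (symS l i j) (symS l j i); field.
Qed.

Lemma christoffel_smooth k i j : smooth_on U (christoffel g k i j).
Proof.
apply: (smoothM oU); first exact: (smooth_cst oU).
apply: (smooth_sum oU) => l; apply: (smoothM oU);
  first exact: (smooth_invmx oU).
have D a b c : smooth_on U (partial a (fun y => g y b c)).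
  by apply: smooth_partial; exact: sg.
by apply: (smoothD oU); [apply: (smoothD oU)|apply: (smoothN oU)].
Qed.

Lemma conn_smooth i : smoothmx U (conn i).
Proof.
move=> a b; rewrite (_ : (fun y => _) = christoffel g b i a); last first.
  by apply/funext => y; rewrite connE.
exact: christoffel_smooth.
Qed.

Lemma riemann_coefE i j k l x :
  riemann_coef g i j k l x = \sum_p g x k p * curvF conn i j x l p.
Proof.
apply: eq_bigr => p _; congr (_ * _); rewrite /curvF.
have D3 (X Y Z W : 'M[R]_n) : (X - Y + (Z - W)) l p = X l p - Y l p +
  (Z l p - W l p).
  by rewrite !mxE.
have E a b : pmx a (conn b) x l p = partial a (christoffel g p b l) x.
  by rewrite pmxE; congr (partial _ _ x); apply/funext => y; rewrite connE.
rewrite D3 (E i j) (E j i); congr (_ + _).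
rewrite sumrB; congr (_ - _); rewrite mxE; apply: eq_bigr => q _.
  by rewrite !connE mulrC.
by rewrite !connE mulrC.
Qed.

Definition curvF_vec (x X Y : 'rV[R]_n) : 'M[R]_n :=
  \sum_i \sum_j (X ord0 i * Y ord0 j) *: curvF conn i j x.

(** The curvature endomorphism acts on the fourth argument, and the result is paired with the
    third. *)
Lemma riemannE x X Y Z W :
  riemann g x X Y Z W = (W *m curvF_vec x X Y *m (g x)^T *m Z^T) ord0 ord0.
Proof.
rewrite /riemann /curvF_vec mulmx_sumr !mulmx_suml summxE.
apply: eq_bigr => i _; rewrite mulmx_sumr !mulmx_suml summxE.
apply: eq_bigr => j _.
rewrite -scalemxAr -!scalemxAl [RHS]mxE; move: (curvF conn i j x) (fun k l =>
  riemann_coefE i j k l x) => F hF.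
rewrite [X in _ = _ * X]mxE mulr_sumr; apply: eq_bigr => k _.
rewrite [X in _ = _ * (X * _)]mxE mulr_suml mulr_sumr.
transitivity (\sum_l \sum_p (g x k p * F l p) * X ord0 i * Y ord0 j * Z ord0 k
  * W ord0 l).
  by apply: eq_bigr => l _; rewrite hF !mulr_suml.
rewrite exchange_big; apply: eq_bigr => p _.
rewrite [X in _ = _ * (X * _ * _)]mxE !mulr_suml mulr_sumr;
  apply: eq_bigr => l _.
by rewrite !mxE; ring.
Qed.

Lemma curvF_anti i j x : curvF conn j i x = - curvF conn i j x.
Proof. by rewrite /curvF !opprD !opprK [X in _ = X + _]addrC
  [X in _ = _ + X]addrC. Qed.

Lemma curvF_vec_anti x X Y : curvF_vec x Y X = - curvF_vec x X Y.
Proof.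
rewrite /curvF_vec exchange_big /= -sumrN; apply: eq_bigr => i _;
  rewrite -sumrN.
by apply: eq_bigr => j _; rewrite curvF_anti scalerN mulrC.
Qed.

Lemma curvF_vec_lin x a X X' Y :
  curvF_vec x (a *: X + X') Y = a *: curvF_vec x X Y + curvF_vec x X' Y.
Proof.
rewrite /curvF_vec scaler_sumr -big_split; apply: eq_bigr => i _ /=.
rewrite scaler_sumr -big_split; apply: eq_bigr => j _ /=.
by rewrite !mxE mulrDl scalerDl scalerA mulrA.
Qed.

Lemma curvF_vec_skew x X Y : U x ->
  curvF_vec x X Y *m g x + g x *m (curvF_vec x X Y)^T = 0.
Proof.
move=> Ux; rewrite /curvF_vec mulmx_suml linear_sum mulmx_sumr -big_split big1
  // => i _ /=.
rewrite mulmx_suml linear_sum mulmx_sumr -big_split big1 // => j _ /=.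
rewrite -scalemxAl linearZ /= -scalemxAr -scalerDr.
rewrite (curvF_parallel_form oU conn_smooth i j sg _ Ux) ?scaler0 //.
exact: conn_metric.
Qed.

Lemma curvF_vec_endo J x X Y : U x -> smoothmx U J ->
  (forall k y, U y -> pmx k J y = conn k y *m J y - J y *m conn k y) ->
  curvF_vec x X Y *m J x = J x *m curvF_vec x X Y.
Proof.
move=> Ux sJ pJ; rewrite /curvF_vec mulmx_suml mulmx_sumr;
  apply: eq_bigr => i _.
rewrite mulmx_suml mulmx_sumr; apply: eq_bigr => j _.
by rewrite -scalemxAl -scalemxAr
  (curvF_parallel_endo oU conn_smooth i j sJ pJ Ux).
Qed.

Lemma curvF_vec_bianchi x X Y W : U x ->
  W *m curvF_vec x X Y + X *m curvF_vec x Y W + Y *m curvF_vec x W X = 0.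
Proof.
move=> Ux.
have E (A B C : 'rV[R]_n) : C *m curvF_vec x A B =
    \row_p \sum_i \sum_j \sum_l A ord0 i * B ord0 j * C ord0 l * curvF conn i j
      x l p.
  apply/rowP => p; rewrite [RHS]mxE /curvF_vec mulmx_sumr summxE.
  apply: eq_bigr => i _; rewrite mulmx_sumr summxE; apply: eq_bigr => j _.
  rewrite -scalemxAr [LHS]mxE [X in _ * X]mxE mulr_sumr; apply: eq_bigr => l _;
    ring.
apply/rowP => p; rewrite !E [RHS]mxE 5!mxE.
have -> : \sum_i \sum_j \sum_l Y ord0 i * W ord0 j * X ord0 l * curvF conn i j
  x l p =
    \sum_i \sum_j \sum_l X ord0 i * Y ord0 j * W ord0 l * curvF conn j l x i p.
  rewrite [RHS]exchange_big; apply: eq_bigr => j _.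
  by rewrite exchange_big; apply: eq_bigr => l _; apply: eq_bigr => i _; ring.
have -> : \sum_i \sum_j \sum_l W ord0 i * X ord0 j * Y ord0 l * curvF conn i j
  x l p =
    \sum_i \sum_j \sum_l X ord0 i * Y ord0 j * W ord0 l * curvF conn l i x j p.
  rewrite exchange_big; apply: eq_bigr => i _.
  by rewrite exchange_big; apply: eq_bigr => j _; apply: eq_bigr => l _; ring.
rewrite -!big_split big1 // => i _ /=; rewrite -!big_split big1 // => j _ /=.
rewrite -!big_split big1 // => l _ /=; rewrite -!mulrDr.
by rewrite (first_bianchi oU (A := conn)) ?mulr0 // => *; exact: conn_sym.
Qed.

End LeviCivita.

(** * Schur's lemma for Kähler metrics *)

Section HscModelTrace.
Context {R : realType} {n : nat} (g0 J0 : 'M[R]_n).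
Hypothesis gT : g0^T = g0.
Hypothesis gu : g0 \in unitmx.
Hypothesis JJ : J0 *m J0 = - 1%:M.
Hypothesis JgJ : J0 *m g0 *m J0^T = g0.

Local Notation dot := (fun X Y : 'rV[R]_n => (X *m g0 *m Y^T) ord0 ord0).

(** As [g0] is invertible, the hypothesis determines [F], namely as [F']. In the trace, the four
    rank-one terms contribute 4 and the multiple of [J0] contributes 2n, whence the factor
    [n + 2]. *)
Lemma hsc_model_ricci_form (F : 'M[R]_n) (X Y : 'rV[R]_n) c :
  (forall Z W : 'rV[R]_n, (W *m F *m g0^T *m Z^T) ord0 ord0 =
     c / 4 * hsc_model (fun X => X *m J0) dot X Y Z W) ->
  \tr (F *m J0) = - (c * (n%:R + 2) / 2) * (X *m (g0 *m J0^T) *m Y^T) ord0 ord0.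
Proof.
move=> hF.
have gJ : g0 *m J0^T = - (J0 *m g0).
  by rewrite -{2}JgJ !mulmxA JJ !mulNmx mul1mx opprK.
pose om := (X *m (g0 *m J0^T) *m Y^T) ord0 ord0.
pose F' := (c / 4) *: (g0 *m Y^T *m X - g0 *m X^T *m Y - J0 *m g0 *m Y^T *m X
  *m J0
    + J0 *m g0 *m X^T *m Y *m J0 + (2 * om) *: J0).
have mx11M (A B : 'M[R]_1) : (A *m B) ord0 ord0 = A ord0 ord0 * B ord0 ord0.
  by rewrite mxE big_ord1.
have sc (A : 'M[R]_1) : A^T ord0 ord0 = A ord0 ord0 by rewrite mxE.
have FF' : F = F'.
  suff : F *m g0 = F' *m g0 by move=> /(congr1 (mulmx^~ (invmx g0)));
    rewrite !mulmxK.
  apply/matrixP => l k.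
  have E (M : 'M[R]_n) : M l k =
      (delta_mx (ord0 : 'I_1) l *m M *m (delta_mx (ord0 : 'I_1) k)^T) ord0 ord0.
    by rewrite -rowE trmx_delta -colE !mxE.
  rewrite (E (F *m g0)) (E (F' *m g0)).
  move: (delta_mx _ l) (delta_mx _ k) => W Z.
  rewrite !mulmxA; have := hF Z W; rewrite gT => ->.
  rewrite /F' -scalemxAr -!scalemxAl [RHS]mxE; congr (_ * _).
  rewrite /hsc_model !trmx_mul !mulmxDr !mulmxDl !mulmxN !mulNmx -!scalemxAr
    -!scalemxAl.
  rewrite !mulmxA.
  have S1 (A B C D : 'rV[R]_n) (M N : 'M[R]_n) :
      (A *m M *m B^T *m C *m N *m D^T) ord0 ord0 =
      (A *m M *m B^T) ord0 ord0 * (C *m N *m D^T) ord0 ord0.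
    by rewrite -mx11M !mulmxA.
  have T1 (A B : 'rV[R]_n) : (A *m J0 *m g0 *m B^T) ord0 ord0 =
      - (A *m g0 *m J0^T *m B^T) ord0 ord0.
    rewrite -(mulmxA A J0 g0) -(mulmxA A g0 J0^T) gJ mulmxN mulNmx.
    by rewrite [X in - X]mxE opprK.
  have T2 (A B : 'rV[R]_n) : (A *m J0 *m g0 *m B^T) ord0 ord0 =
      (B *m g0 *m J0^T *m A^T) ord0 ord0.
    by rewrite -sc !trmx_mul trmxK gT !mulmxA.
  have T3 (A B : 'rV[R]_n) : (A *m g0 *m B^T) ord0 ord0 = (B *m g0 *m A^T) ord0
    ord0.
    by rewrite -sc !trmx_mul trmxK gT !mulmxA.
  have D5 (A B C D E' : 'M[R]_1) : (A - B - C + D + E') ord0 ord0 =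
     A ord0 ord0 - B ord0 ord0 - C ord0 ord0 + D ord0 ord0 + E' ord0 ord0.
    by rewrite !mxE.
  rewrite D5 (S1 W Y X Z g0 g0) (S1 W X Y Z g0 g0) [X in _ = _ + X]mxE.
  have -> : (W *m J0 *m g0 *m Y^T *m X *m J0 *m g0 *m Z^T) ord0 ord0 =
      (W *m J0 *m g0 *m Y^T) ord0 ord0 * (X *m J0 *m g0 *m Z^T) ord0 ord0.
    by rewrite -mx11M !mulmxA.
  have -> : (W *m J0 *m g0 *m X^T *m Y *m J0 *m g0 *m Z^T) ord0 ord0 =
      (W *m J0 *m g0 *m X^T) ord0 ord0 * (Y *m J0 *m g0 *m Z^T) ord0 ord0.
    by rewrite -mx11M !mulmxA.
  rewrite (T2 W Y) (T2 W X) (T2 W Z) (T1 X Z) (T1 Y Z) /om !mulmxA.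
  rewrite (T3 W Y) (T3 W X); ring.
rewrite FF' /F' -scalemxAl linearZ /= !mulmxDl !mulNmx -!scalemxAl JJ.
rewrite -!(mulmxA _ J0 J0) JJ !mulmxN !mulmx1.
have tD (A B : 'M[R]_n) : \tr (A + B) = \tr A + \tr B by rewrite linearD.
have tN (A : 'M[R]_n) : \tr (- A) = - \tr A by rewrite linearN.
have tZ a (A : 'M[R]_n) : \tr (a *: A) = a * \tr A by rewrite linearZ.
rewrite !(tD, tN, tZ) mxtrace1.
have t11 (A : 'M[R]_1) : \tr A = A ord0 ord0 by rewrite /mxtrace big_ord1.
have XJY : (X *m J0 *m g0 *m Y^T) ord0 ord0 = - om.
  by rewrite /om gJ mulmxN mulNmx [X in - X]mxE opprK !mulmxA.
have YJX : (Y *m J0 *m g0 *m X^T) ord0 ord0 = om.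
  by rewrite /om -sc !trmx_mul trmxK gT !mulmxA.
have -> : \tr (g0 *m Y^T *m X *m J0) = - om.
  by rewrite -mulmxA mxtrace_mulC !mulmxA t11.
have -> : \tr (g0 *m X^T *m Y *m J0) = om.
  by rewrite -mulmxA mxtrace_mulC !mulmxA t11.
have -> : \tr (J0 *m g0 *m Y^T *m X) = - om.
  by rewrite mxtrace_mulC !mulmxA t11.
have -> : \tr (J0 *m g0 *m X^T *m Y) = om.
  by rewrite mxtrace_mulC !mulmxA t11.
by rewrite -/om; field.
Qed.

End HscModelTrace.

Section LocalKahler.
Context {R : realType} {n : nat} (U : set 'rV[R]_n) (g J : 'rV[R]_n -> 'M[R]_n).
Hypothesis oU : open U.
Hypothesis sg : smoothmx U g.
Hypothesis gT : forall x, U x -> (g x)^T = g x.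
Hypothesis gpos : forall x (v : 'rV[R]_n), U x -> v != 0 ->
  0 < (v *m g x *m v^T) ord0 ord0.
Hypothesis sJ : smoothmx U J.
Hypothesis JJ : forall x, U x -> J x *m J x = - 1%:M.
Hypothesis JgJ : forall x, U x -> J x *m g x *m (J x)^T = g x.
Hypothesis pJ : forall k y, U y -> pmx k J y = conn g k y *m J y - J y *m conn
  g k y.

Lemma posdef_unitmx (g0 : 'M[R]_n) :
  (forall v : 'rV[R]_n, v != 0 -> 0 < (v *m g0 *m v^T) ord0 ord0) ->
    g0 \in unitmx.
Proof.
move=> pos; rewrite -row_free_unit -kermx_eq0; apply/negPn/negP => /rowV0Pn[v].
move=> /sub_kermxP vg v0; have := pos v v0.
by rewrite vg mul0mx mxE ltxx.
Qed.

Let gu x : U x -> g x \in unitmx.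
Proof. by move=> Ux; apply: posdef_unitmx => v; exact: gpos. Qed.

Let F := curvF (conn g).
Let Fv := curvF_vec g.

Lemma riemann_kahler x : U x -> kahler_tensor (fun X => X *m J x) (riemann g x).
Proof.
move=> Ux; have gx := gT Ux.
have sc (A : 'M[R]_1) : A^T ord0 ord0 = A ord0 ord0 by rewrite mxE.
have skew X Y : Fv x X Y *m g x = - (g x *m (Fv x X Y)^T).
  by apply/eqP; rewrite -addr_eq0 (curvF_vec_skew oU sg gT gu).
have a34 X Y Z W : riemann g x X Y W Z = - riemann g x X Y Z W.
  rewrite !riemannE gx -/Fv -sc !trmx_mul trmxK gx.
  by rewrite -(mulmxA W (Fv x X Y)) skew mulmxN mulNmx [X in - X]mxE opprK
    !mulmxA.
split=> [a X X' Y Z W|X Y Z W|X Y Z W|X Y Z W|X Y Z W].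
- by rewrite !riemannE curvF_vec_lin mulmxDr !mulmxDl -scalemxAr -!scalemxAl
  !mxE.
- by rewrite !riemannE curvF_vec_anti mulmxN !mulNmx !mxE.
- exact: a34.
(* [curvF_vec_bianchi] cycles the vector acted on, which sits in the fourth slot; hence the exchange
   of the last two slots. *)
- rewrite (a34 X Y W Z) (a34 Y Z W X) (a34 Z X W Y) -!opprD !riemannE.
  have D3 (A B C : 'M[R]_1) : A ord0 ord0 + B ord0 ord0 + C ord0 ord0 =
    (A + B + C) ord0 ord0 by rewrite !mxE.
  by rewrite D3 -!mulmxDl (curvF_vec_bianchi oU gT) // !mul0mx mxE oppr0.
- rewrite !riemannE gx !trmx_mul -/Fv.
  rewrite -(mulmxA W (J x)) -(curvF_vec_endo oU sg gu X Y Ux sJ pJ) -/Fv.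
  by rewrite !mulmxA -!(mulmxA (W *m Fv x X Y)) JgJ // !mulmxA.
Qed.

Lemma riemann_const_hsc x c : U x ->
  (forall X, riemann g x X (X *m J x) X (X *m J x) = c * gdot (g x) X X ^+ 2) ->
  forall X Y Z W, riemann g x X Y Z W =
    c / 4 * hsc_model (fun X => X *m J x) (gdot (g x)) X Y Z W.
Proof.
move=> Ux hc X Y Z W.
apply: (kt_const_hsc (actJ_lin (J x)) (actJK (JJ Ux)) (gdot_lin (g x))
  (gdotC (gT Ux)) (gdotJ (JgJ Ux)) (riemann_kahler Ux) hc).
Qed.

(** The Ricci form up to a constant factor; [om] is the Kähler form g(X, JY). *)
Let rho i j x := \tr (F i j x *m J x).
Let om x := g x *m (J x)^T.

(** Since [J] is parallel and the trace is cyclic, the derivative of [rho] is the trace of the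
    covariant derivative of [F] against [J], to which the second Bianchi identity applies. *)
Lemma ricci_form_closed i j k x : U x ->
  partial k (rho i j) x + partial i (rho j k) x + partial j (rho k i) x = 0.
Proof.
move=> Ux.
have dJ : diffmx J x by exact: smoothmx_diff Ux.
have dF a b : diffmx (F a b) x by exact: (curvF_diff (conn_smooth oU sg gu)).
have tD (A B : 'M[R]_n) : \tr (A + B) = \tr A + \tr B by rewrite linearD.
have E a b c : partial c (rho a b) x =
    \tr ((pmx c (F a b) x + F a b x *m conn g c x - conn g c x *m F a b x) *m J
      x).
  rewrite partial_mxtrace; last exact: diffmxM.
  rewrite pmxM // pJ //; move: (pmx c (F a b) x) (F a b x) => P Q.
  rewrite mulmxBr !mulmxDl mulNmx !mulmxA.
  have tN (A : 'M[R]_n) : \tr (- A) = - \tr A by rewrite linearN.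
  rewrite !(tD, tN) -(mulmxA (conn g c x)) (mxtrace_mulC (conn g c x)).
  by rewrite addrA.
have B := second_bianchi oU (conn_smooth oU sg gu) i j k Ux.
by rewrite (E i j k) (E j k i) (E k i j) -!tD -!mulmxDl [X in X *m _]B mul0mx
  linear0.
Qed.

Lemma kahler_form_pmx k x : U x ->
  pmx k om x = conn g k x *m om x + om x *m (conn g k x)^T.
Proof.
move=> Ux.
have dJ : diffmx J x by exact: smoothmx_diff Ux.
have dg : diffmx g x by exact: smoothmx_diff Ux.
rewrite pmxM //; last exact: diffmxT.
rewrite pmxT pJ // (conn_metric oU gT gu) //.
have tB (A B : 'M[R]_n) : (A - B)^T = A^T - B^T by rewrite linearB.
rewrite tB !trmx_mul mulmxDl mulmxBr /om !mulmxA.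
by rewrite addrACA subrr addr0.
Qed.

Lemma kahler_form_anti x : U x -> (om x)^T = - om x.
Proof. by move=> Ux; rewrite /om trmx_mul trmxK gT //
  (J0g (JJ Ux) (JgJ Ux)) opprK. Qed.

(** [om] is parallel, so only connection terms remain; they cancel because the connection is
    symmetric and [om] antisymmetric. *)
Lemma kahler_form_closed i j k x : U x ->
  pmx k om x i j + pmx i om x j k + pmx j om x k i = 0.
Proof.
move=> Ux; rewrite !kahler_form_pmx //.
have oA a b : om x a b = - om x b a.
  by have := congr1 (fun M : 'M[R]_n => M b a) (kahler_form_anti Ux);
    rewrite mxE => ->; rewrite mxE.
move: (om x) oA => O oA.
have E a b c : (conn g c x *m O + O *m (conn g c x)^T) a b =
    \sum_q (conn g c x a q * O q b - conn g c x b q * O q a).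
  rewrite mxE [X in X + _]mxE [X in _ + X]mxE -big_split;
    apply: eq_bigr => q _ /=.
  by rewrite [_^T _ _]mxE (oA a q) mulNr (mulrC (O q a)).
rewrite !E -!big_split big1 // => q _ /=.
rewrite (conn_sym oU gT i k) // (conn_sym oU gT j k) // (conn_sym oU gT j i) //.
ring.
Qed.

Variable c : 'rV[R]_n -> R.
Hypothesis hc : forall x, U x -> forall X,
  riemann g x X (X *m J x) X (X *m J x) = c x * gdot (g x) X X ^+ 2.

Lemma hsc_ricci_form i j x : U x ->
  rho i j x = - (c x * (n%:R + 2) / 2) * om x i j.
Proof.
move=> Ux.
have := @hsc_model_ricci_form R n (g x) (J x) (gT Ux) (gu Ux) (JJ Ux) (JgJ Ux)
  (F i j x) (delta_mx ord0 i) (delta_mx ord0 j) (c x).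
have -> : (delta_mx (ord0 : 'I_1) i *m (g x *m (J x)^T)
    *m (delta_mx (ord0 : 'I_1) j)^T) ord0 ord0 = om x i j.
  by rewrite -rowE trmx_delta -colE !mxE.
apply => Z W; rewrite -(riemann_const_hsc Ux (hc Ux)) riemannE.
congr ((_ *m _ *m _ *m _) _ _); rewrite /curvF_vec (bigD1 i) //=
  [X in _ = _ + X]big1 ?addr0.
  rewrite (bigD1 j) //= [X in _ = _ + X]big1 ?addr0;
    first by rewrite !mxE !eqxx mulr1 scale1r.
  by move=> b bj; rewrite !mxE (negbTE bj) andbF mulr0 scale0r.
move=> a ai; rewrite big1 // => b _.
by rewrite !mxE (negbTE ai) andbF mul0r scale0r.
Qed.

(** [hc] gives [c] only pointwise; its regularity comes from solving [hc] for [c] at a fixed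
    coordinate vector. *)
Lemma hsc_differentiable x : (0 < n)%N -> U x -> differentiable c x.
Proof.
move=> n0 Ux; pose X : 'rV[R]_n := delta_mx ord0 (Ordinal n0).
have X0 : X != 0.
  apply/eqP => /matrixP/(_ ord0 (Ordinal n0)); rewrite !mxE !eqxx => /eqP.
  by rewrite oner_eq0.
have cE y : U y -> riemann g y X (X *m J y) X (X *m J y) *
  ((gdot (g y) X X)^-1 * (gdot (g y) X X)^-1) = c y.
  move=> Uy; have h : gdot (g y) X X != 0 by rewrite gt_eqF //; exact: gpos.
  by rewrite (hc Uy); field.
apply: (@near_eq_differentiable _ _ _ (fun y =>
  riemann g y X (X *m J y) X (X *m J y)
   * ((gdot (g y) X X)^-1 * (gdot (g y) X X)^-1))).
  exact: (open_near_eq oU Ux cE).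
have dg : diffmx g x by exact: smoothmx_diff Ux.
have dJ : diffmx J x by exact: smoothmx_diff Ux.
have dX (Z : 'rV[R]_n) : diffmx (fun=> Z) x by move=> a b;
  exact: differentiable_cst.
have dXJ : diffmx (fun y => X *m J y) x by exact: diffmxM.
have dGV : differentiable (fun y => (gdot (g y) X X)^-1) x.
  apply: differentiableV; last by rewrite gt_eqF //; exact: gpos.
  have XgX : diffmx (fun y => X *m g y *m X^T) x.
    apply: (diffmxM (M := fun y => X *m g y) (N := fun=> X^T));
      first exact: diffmxM.
    by move=> a b; exact: differentiable_cst.
  exact: XgX.
apply: differentiableM; last exact: differentiableM.
apply: differentiable_bigsum => i; apply: differentiable_bigsum => j.
apply: differentiable_bigsum => k; apply: differentiable_bigsum => l.
apply: differentiableM; last exact: dXJ.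
apply: differentiableM; last exact: differentiable_cst.
apply: differentiableM; last exact: dXJ.
apply: differentiableM; last exact: differentiable_cst.
rewrite (_ : riemann_coef g i j k l = fun y => \sum_p g y k p * F i j y l p);
  last first.
  by apply/funext => y; exact: riemann_coefE.
apply: differentiable_bigsum => p; apply: differentiableM; first exact: dg.
exact: (curvF_diff (conn_smooth oU sg gu)).
Qed.

(** The left side collects the components of dc /\ omega. When [c] times [om] is differentiated, the
    derivatives of [om] drop out because [om] is closed. *)
Lemma hsc_cyclic i j k x : (0 < n)%N -> U x ->
  partial k c x * om x i j + partial i c x * om x j k + partial j c x * om x k
    i = 0.
Proof.
move=> n0 Ux; have dc := hsc_differentiable n0 Ux.
have dom : diffmx om x.
  by apply: diffmxM; [|apply: diffmxT]; exact: smoothmx_diff Ux.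
pose K : R := - ((n%:R + 2) / 2).
have K0 : K != 0 by rewrite oppr_eq0 gt_eqF // divr_gt0 // ltr_wpDl.
have E a b d : partial d (rho a b) x =
    K * (partial d c x * om x a b + c x * pmx d om x a b).
  rewrite (@eq_partial_on _ _ U (rho a b) (fun y =>
    K * (c y * om y a b)) d x oU Ux).
    rewrite partialM; [|exact: differentiable_cst|exact: differentiableM].
    by rewrite partial_cst mul0r add0r partialM // pmxE.
  by move=> y Uy; rewrite hsc_ricci_form // /K; field.
have := ricci_form_closed i j k Ux; rewrite !E -!mulrDr => /eqP.
rewrite mulf_eq0 (negbTE K0) /= => /eqP; have := kahler_form_closed i j k Ux.
move: (pmx _ _ _ _ _) (pmx _ _ _ _ _) (pmx _ _ _ _ _) => a b d h0 h1.
have : c x * (d + b + a) = 0 by rewrite h0 mulr0.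
move: h1; move: (partial k c x * _) (partial i c x * _) (partial j c x * _) =>
  p q r h1 h2.
by lra.
Qed.

Lemma schur_partial k x : (2 < n)%N -> U x -> partial k c x = 0.
Proof.
move=> n2 Ux; have n0 : (0 < n)%N by rewrite (ltn_trans _ n2).
pose dv (Z : 'rV[R]_n) := \sum_i Z ord0 i * partial i c x.
pose ov (X Y : 'rV[R]_n) := (X *m om x *m Y^T) ord0 ord0.
have ovE X Y : ov X Y = \sum_i \sum_j X ord0 i * Y ord0 j * om x i j.
  rewrite /ov mxE exchange_big /=; apply: eq_bigr => j _; rewrite mxE mulr_suml.
  by apply: eq_bigr => i _; rewrite !mxE mulrAC.
have cyc X Y Z : dv Z * ov X Y + dv X * ov Y Z + dv Y * ov Z X = 0.
  have E A B C : dv C * ov A B =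
      \sum_i \sum_j \sum_k A ord0 i * B ord0 j * C ord0 k *
        (partial k c x * om x i j).
    rewrite ovE mulr_sumr; apply: eq_bigr => i _; rewrite mulr_sumr.
    apply: eq_bigr => j _; rewrite mulr_suml; apply: eq_bigr => l _; ring.
  have E2 : dv X * ov Y Z =
      \sum_i \sum_j \sum_k X ord0 i * Y ord0 j * Z ord0 k *
        (partial i c x * om x j k).
    rewrite E [RHS]exchange_big; apply: eq_bigr => j _.
    by rewrite exchange_big; apply: eq_bigr => l _; apply: eq_bigr => i _; ring.
  have E3 : dv Y * ov Z X =
      \sum_i \sum_j \sum_k X ord0 i * Y ord0 j * Z ord0 k *
        (partial j c x * om x k i).
    rewrite E exchange_big; apply: eq_bigr => i _.
    by rewrite exchange_big; apply: eq_bigr => j _; apply: eq_bigr => l _; ring.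
  rewrite E2 E3 E -!big_split big1 // => i _ /=;
    rewrite -!big_split big1 // => j _ /=.
  rewrite -!big_split big1 // => l _ /=; rewrite -!mulrDr hsc_cyclic ?mulr0 //.
pose Z : 'rV[R]_n := delta_mx ord0 k.
have dZ : dv Z = partial k c x.
  rewrite /dv (bigD1 k) //= big1 ?addr0; first by rewrite mxE !eqxx mul1r.
  by move=> i ik; rewrite mxE (negbTE ik) mul0r.
(* a nonzero X orthogonal to Z and JZ; this is where n > 2 is needed *)
have [X X0 [XZ XJZ]] : exists2 X : 'rV[R]_n, X != 0 &
    X *m (g x *m Z^T) = 0 /\ X *m (g x *m (Z *m J x)^T) = 0.
  pose N := row_mx (g x *m Z^T) (g x *m (Z *m J x)^T).
  have : kermx N != 0.
    rewrite kermx_eq0; apply/negP; rewrite /row_free => /eqP rN.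
    by have := rank_leq_col N; rewrite rN leqNgt n2.
  move=> /rowV0Pn[X /sub_kermxP XN X0]; exists X => //.
  by move: XN; rewrite mul_mx_row => /eqP; rewrite row_mx_eq0 =>
    /andP[/eqP ? /eqP ?].
have gX := gpos Ux X0.
(* Of dc /\ omega at (X, JX, Z) only dc(Z) omega(X, JX) survives, and omega(X, JX) is minus the
   squared norm of [X]. *)
have := cyc X (X *m J x) Z; rewrite -dZ.
have -> : ov X (X *m J x) = - (X *m g x *m X^T) ord0 ord0.
  rewrite /ov /om trmx_mul !mulmxA -(mulmxA (X *m g x)) -trmx_mul JJ //.
  have -> : (- 1%:M : 'M[R]_n)^T = - 1%:M by rewrite linearN /= trmx1.
  by rewrite mulmxN mulmx1 mulNmx mxE.
have -> : ov (X *m J x) Z = 0.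
  by rewrite /ov /om !mulmxA -(mulmxA X) -(mulmxA X) JgJ // -mulmxA XZ mxE.
have -> : ov Z X = 0.
  have sc (A : 'M[R]_1) : A^T ord0 ord0 = A ord0 ord0 by rewrite mxE.
  have h : X *m om x *m Z^T = 0.
    by rewrite /om -!mulmxA -trmx_mul.
  rewrite /ov; have -> : Z *m om x *m X^T = (X *m (om x)^T *m Z^T)^T.
    by rewrite trmx_mul (trmx_mul X) !trmxK mulmxA.
  by rewrite sc kahler_form_anti // mulmxN mulNmx h oppr0 mxE.
rewrite !mulr0 !addr0 mulrN => /eqP; rewrite oppr_eq0 mulf_eq0 (gt_eqF gX) orbF.
by move=> /eqP.
Qed.

End LocalKahler.

(** * Change of chart *)

Section ChainRule.
Context {R : realType} {n : nat} (U : set 'rV[R]_n) (f : 'rV[R]_n -> 'rV[R]_n).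
Hypothesis oU : open U.
Hypothesis sf : forall k, smooth_on U (fun x => f x ord0 k).

Lemma differentiable_rV x : U x -> differentiable f x.
Proof.
move=> Ux.
have -> : f = \sum_(k < n) (fun x => f x ord0 k *: delta_mx ord0 k).
  by apply/funext => y; rewrite fct_sumE [LHS]row_sum_delta.
apply: differentiable_sum => k; apply: differentiableZl;
  exact: smooth_diff (sf k) Ux.
Qed.

Lemma jacobianE x j p : U x -> 'J f x j p = partial j (fun y => f y ord0 p) x.
Proof.
move=> Ux; have df := differentiable_rV Ux.
rewrite mxE /partial.
have := derive_mx (diff_derivable (v := delta_mx ord0 j) df).
by rewrite (deriveE _ df) => /(congr1 (fun M : 'rV[R]_n => M ord0 p));
  rewrite [RHS]mxE.
Qed.

Lemma jacobian_smooth : smoothmx U (fun x => 'J f x).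
Proof.
move=> j p; apply: (eq_smooth_on oU (f := partial j (fun y => f y ord0 p))).
  by move=> x Ux; rewrite jacobianE.
exact: smooth_partial.
Qed.

Lemma jacobian_pmx_sym i j p x : U x ->
  pmx i (fun y => 'J f y) x j p = pmx j (fun y => 'J f y) x i p.
Proof.
move=> Ux; rewrite !pmxE.
rewrite (eq_partial_on i oU Ux (fun y Uy => jacobianE j p Uy)).
rewrite (eq_partial_on j oU Ux (fun y Uy => jacobianE i p Uy)).
exact: (smooth_partial_comm oU i j (sf p) Ux).
Qed.

Lemma partial_comp (h : 'rV[R]_n -> R) i x : U x -> differentiable h (f x) ->
  partial i (fun y => h (f y)) x = \sum_p 'J f x i p * partial p h (f x).
Proof.
move=> Ux dh; have df := differentiable_rV Ux.
have dhf : differentiable (h \o f) x by exact: differentiable_comp.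
rewrite /partial (deriveE (f := h \o f)) // diff_comp //= diff_partialE //.
by apply: eq_bigr => p _; rewrite mxE.
Qed.

Lemma pmx_comp k l (M : 'rV[R]_n -> 'M[R]_(k, l)) i x : U x -> diffmx M (f x) ->
  pmx i (fun y => M (f y)) x = \sum_p 'J f x i p *: pmx p M (f x).
Proof.
move=> Ux dM; apply/matrixP => a b; rewrite pmxE.
rewrite (partial_comp (h := fun y => M y a b)) // summxE.
by apply: eq_bigr => p _; rewrite [RHS]mxE pmxE.
Qed.

Lemma diffmx_comp k l (M : 'rV[R]_n -> 'M[R]_(k, l)) x : U x ->
  diffmx M (f x) ->
  diffmx (fun y => M (f y)) x.
Proof.
move=> Ux dM a b; apply: (differentiable_comp (g := fun y => M y a b)) => //.
exact: differentiable_rV.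
Qed.

End ChainRule.

Section GaugeChange.
Context {R : realType} {n : nat} (U : set 'rV[R]_n).
Hypothesis oU : open U.
Variables (A B : 'I_n -> 'rV[R]_n -> 'M[R]_n) (D : 'rV[R]_n -> 'M[R]_n).
Hypothesis dA : forall i x, U x -> diffmx (A i) x.
Hypothesis dB : forall i x, U x -> diffmx (B i) x.
Hypothesis sD : smoothmx U D.
Hypothesis gauge : forall i x, U x -> A i x *m D x = pmx i D x + D x *m B i x.

(** The inhomogeneous term of [gauge] leaves no trace in the curvature because second derivatives of
    [D] commute. *)
Lemma curvF_gauge i j x : U x -> curvF A i j x *m D x = D x *m curvF B i j x.
Proof.
move=> Ux.
have dD : diffmx D x by exact: smoothmx_diff Ux.
have E a b : pmx a (A b) x *m D x + A b x *m pmx a D x =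
    pmx a (pmx b D) x + (pmx a D x *m B b x + D x *m pmx a (B b) x).
  rewrite -pmxM //; last exact: dA.
  rewrite (eq_pmx_on a oU Ux (gauge b)) pmxD.
  - by rewrite pmxM //; exact: dB.
  - exact: (smoothmx_diff (smoothmx_pmx b sD) Ux).
  - by apply: diffmxM => //; exact: dB.
have AA a b : A a x *m A b x *m D x =
    A a x *m pmx b D x + pmx a D x *m B b x + D x *m B a x *m B b x.
  by rewrite -mulmxA gauge // mulmxDr mulmxA gauge // mulmxDl addrA.
have Ea a b : pmx a (A b) x *m D x = pmx a (pmx b D) x
    + (pmx a D x *m B b x + D x *m pmx a (B b) x) - A b x *m pmx a D x.
  by rewrite -E addrK.
rewrite /curvF !mulmxDl !mulNmx !AA !Ea (pmx_comm i j oU Ux sD).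
mx_expand; mx_abel.
Qed.

End GaugeChange.

Section ChartChange.
Context {R : realType} {n : nat} (U U' : set 'rV[R]_n).
Variables (f : 'rV[R]_n -> 'rV[R]_n) (g g' : 'rV[R]_n -> 'M[R]_n).
Hypothesis oU : open U.
Hypothesis oU' : open U'.
Hypothesis fU : forall x, U x -> U' (f x).
Hypothesis sf : forall k, smooth_on U (fun x => f x ord0 k).
Hypothesis sg : smoothmx U g.
Hypothesis gT : forall x, U x -> (g x)^T = g x.
Hypothesis gu : forall x, U x -> g x \in unitmx.
Hypothesis sg' : smoothmx U' g'.
Hypothesis gT' : forall x, U' x -> (g' x)^T = g' x.
Hypothesis gu' : forall x, U' x -> g' x \in unitmx.
Hypothesis change : forall x, U x -> g x = 'J f x *m g' (f x) *m ('J f x)^T.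

Let D x := 'J f x.
(** The connection of [g'] pulled back by [f], still in the frame of the target chart. *)
Let B i x := \sum_p D x i p *: conn g' p (f x).

Let sD : smoothmx U D. Proof. exact: jacobian_smooth. Qed.
Let dD x : U x -> diffmx D x.
Proof. by move=> Ux; exact: smoothmx_diff Ux. Qed.
Let dC p x : U x -> diffmx (conn g' p) (f x).
Proof. by move=> /fU Ux; exact: (smoothmx_diff (conn_smooth oU' sg' gu' p) Ux).
  Qed.
Let dCf p x : U x -> diffmx (fun y => conn g' p (f y)) x.
Proof. by move=> Ux; exact: (diffmx_comp sf Ux (dC p Ux)). Qed.

Let BE i x a b : B i x a b = \sum_p D x i p * conn g' p (f x) a b.
Proof. by rewrite /B summxE; apply: eq_bigr => p _; rewrite mxE. Qed.

Let dB i x : U x -> diffmx (B i) x.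
Proof.
move=> Ux a b; rewrite (_ : (fun y => B i y a b) =
   fun y => \sum_p D y i p * conn g' p (f y) a b); last by apply/funext => y;
     exact: BE.
apply: differentiable_bigsum => p; apply: differentiableM; first exact: dD.
exact: dCf.
Qed.

Lemma jacobian_unit x : U x -> D x \in unitmx.
Proof.
move=> Ux; have := gu Ux; rewrite (change Ux) unitmx_mul => /andP[+ _].
by rewrite unitmx_mul => /andP[].
Qed.

(** Solving for the connection matrix gives a candidate [A]. It is torsion-free, because derivatives
    of the Jacobian are symmetric, and compatible with [g], so it is the Levi-Civita connection. *)
Lemma conn_change i x : U x -> conn g i x *m D x = pmx i D x + D x *m B i x.
Proof.
move=> Ux; have Du := jacobian_unit Ux.
pose A i := (pmx i D x + D x *m B i x) *m invmx (D x).
have AD a : A a *m D x = pmx a D x + D x *m B a x by rewrite /A mulmxKV.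
have symN a b p : (pmx a D x + D x *m B a x) b p = (pmx b D x + D x *m B b x) a
  p.
  rewrite [LHS]mxE [RHS]mxE (jacobian_pmx_sym oU sf) //; congr (_ + _).
  rewrite [LHS]mxE [RHS]mxE.
  transitivity (\sum_q \sum_r D x b q * D x a r * conn g' r (f x) q p).
    by apply: eq_bigr => q _; rewrite BE mulr_sumr; apply: eq_bigr => r _;
      rewrite mulrA.
  rewrite exchange_big; apply: eq_bigr => r _; rewrite BE mulr_sumr.
  apply: eq_bigr => q _; rewrite (conn_sym oU' gT' q r p (fU Ux)); ring.
suff -> : conn g i x = A i by [].
apply/esym; apply: (conn_unique gT gu (A := A) Ux) => [a b k|a].
  rewrite /A [LHS]mxE [RHS]mxE; apply: eq_bigr => q _; by rewrite symN.
have gf : diffmx (fun y => g' (f y)) x.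
  exact: (diffmx_comp sf Ux (smoothmx_diff sg' (fU Ux))).
rewrite (eq_pmx_on a oU Ux change).
rewrite (pmxM a (diffmxM (dD Ux) gf) (diffmxT (dD Ux))) (pmxM a (dD Ux) gf)
  pmxT.
rewrite (pmx_comp sf a Ux (smoothmx_diff sg' (fU Ux))).
have -> : \sum_p 'J f x a p *: pmx p g' (f x) = B a x *m g' (f x) + g' (f x) *m
  (B a x)^T.
  rewrite /B mulmx_suml linear_sum mulmx_sumr -big_split;
    apply: eq_bigr => p _ /=.
  rewrite (conn_metric oU' gT' gu' p (fU Ux)) scalerDr.
  by rewrite -scalemxAl linearZ /= -scalemxAr.
have -> : g x *m (A a)^T = D x *m g' (f x) *m (A a *m D x)^T.
  by rewrite (change Ux) (trmx_mul (A a) (D x)) !mulmxA.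
rewrite [in A a *m g x](change Ux) !mulmxA AD.
have tD (X Y : 'M[R]_n) : (X + Y)^T = X^T + Y^T by rewrite linearD.
rewrite tD trmx_mul -/(D x).
by mx_expand; mx_abel.
Qed.

(** Curvature commutes with pullback: the derivatives of the Jacobian are symmetric and cancel. *)
Lemma curvF_B i j x : U x ->
  curvF B i j x = \sum_p \sum_q (D x i p * D x j q) *: curvF (conn g') p q
    (f x).
Proof.
move=> Ux.
pose P p q := pmx p (conn g' q) (f x); pose C p := conn g' p (f x).
have EB a b : pmx a (B b) x = \sum_p pmx a D x b p *: C p
    + \sum_p \sum_q (D x a p * D x b q) *: P p q.
  apply/matrixP => k l; rewrite pmxE.
  rewrite (_ : (fun y => B b y k l) = fun y =>
    \sum_p D y b p * conn g' p (f y) k l);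
    last by apply/funext => y; exact: BE.
  have dd p : differentiable (fun y => D y b p) x by exact: dD.
  have dc p : differentiable (fun y => conn g' p (f y) k l) x by exact: dCf.
  rewrite partial_sum; last by move=> p; exact: differentiableM.
  rewrite exchange_big /= -big_split summxE; apply: eq_bigr => p _ /=.
  rewrite partialM // [RHS]mxE [X in _ = X + _]mxE pmxE; congr (_ + _).
  rewrite (partial_comp sf a (h := fun y => conn g' p y k l) Ux (dC p Ux k l)).
  rewrite mulr_sumr summxE; apply: eq_bigr => q _.
  by rewrite [RHS]mxE pmxE mulrCA mulrA.
have MB a b : B b x *m B a x = \sum_p \sum_q (D x a p * D x b q) *:
  (C q *m C p).
  rewrite /B mulmx_sumr; apply: eq_bigr => p _; rewrite mulmx_suml.
  by apply: eq_bigr => q _; rewrite -scalemxAl -scalemxAr scalerA mulrC.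
have S a b (Q : 'I_n -> 'I_n -> 'M[R]_n) : \sum_p \sum_q (D x a p * D x b q) *:
  Q p q =
    \sum_p \sum_q (D x b p * D x a q) *: Q q p.
  by rewrite exchange_big; apply: eq_bigr => p _; apply: eq_bigr => q _;
    rewrite mulrC.
rewrite /curvF (EB i j) (EB j i) (MB i j) (MB j i).
have -> : \sum_p pmx j D x i p *: C p = \sum_p pmx i D x j p *: C p.
  by apply: eq_bigr => p _; rewrite (jacobian_pmx_sym oU sf).
rewrite (S j i P) (S j i (fun p q => C q *m C p)) [X in X - _]addrC addrKA.
rewrite -!sumrB -big_split; apply: eq_bigr => p _ /=.
rewrite -!sumrB -big_split; apply: eq_bigr => q _ /=.
by rewrite -!scalerBr -scalerDr.
Qed.

Lemma riemann_change x X Y Z W : U x ->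
  riemann g x X Y Z W =
  riemann g' (f x) (X *m D x) (Y *m D x) (Z *m D x) (W *m D x).
Proof.
move=> Ux.
have FD : curvF_vec g x X Y *m D x = D x *m curvF_vec g' (f x) (X *m D x)
  (Y *m D x).
  transitivity (\sum_i \sum_j \sum_p \sum_q
     (X ord0 i * D x i p * (Y ord0 j * D x j q)) *:
       (D x *m curvF (conn g') p q (f x))).
    rewrite /curvF_vec mulmx_suml; apply: eq_bigr => i _.
    rewrite mulmx_suml; apply: eq_bigr => j _.
    rewrite -scalemxAl (curvF_gauge oU _ dB sD conn_change) //; last first.
      by move=> a y Uy; exact: (smoothmx_diff (conn_smooth oU sg gu a) Uy).
    rewrite curvF_B // mulmx_sumr scaler_sumr; apply: eq_bigr => p _.
    rewrite mulmx_sumr scaler_sumr; apply: eq_bigr => q _.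
    by rewrite -scalemxAr scalerA; congr (_ *: _); ring.
  rewrite /curvF_vec mulmx_sumr.
  under eq_bigr do rewrite exchange_big /=.
  rewrite exchange_big; apply: eq_bigr => p _.
  under eq_bigr do rewrite exchange_big /=.
  rewrite exchange_big mulmx_sumr; apply: eq_bigr => q _.
  rewrite -scalemxAr [(X *m D x) _ _]mxE [(Y *m D x) _ _]mxE mulr_suml
    scaler_suml.
  apply: eq_bigr => i _; rewrite mulr_sumr scaler_suml;
    by apply: eq_bigr => j _.
rewrite !riemannE gT // (gT' (fU Ux)) (change Ux) -/(D x) trmx_mul !mulmxA.
by rewrite -(mulmxA W _ (D x)) FD !mulmxA.
Qed.

End ChartChange.

(** * Kähler manifolds *)

(** The mean value theorem along segments from [x], inside a ball contained in [U]. *)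
Lemma partial0_near_const (R : realType) (n : nat) (U : set 'rV[R]_n)
    (c : 'rV[R]_n -> R) x :
  open U -> U x -> (forall y, U y -> differentiable c y) ->
  (forall k y, U y -> partial k c y = 0) -> \forall y \near x, c y = c x.
Proof.
move=> oU Ux dc pc.
have /nbhs_ballP[d /= d0 hd] : nbhs x U by exact: open_nbhs_nbhs.
apply/nbhs_ballP; exists d => //= y; rewrite -ball_normE /= => hy.
pose v := y - x.
have inU (t : R) : 0 <= t <= 1 -> U (t *: v + x).
  move=> /andP[t0 t1]; apply: hd; rewrite -ball_normE /= opprD addrA addrAC
    subrr.
  rewrite sub0r normrN normrZ ger0_norm //; apply: le_lt_trans hy.
  by rewrite /v distrC ler_piMl.
have dphi (t : R) : 0 <= t <= 1 -> is_derive t 1 (fun s : R =>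
  c (s *: v + x)) 0.
  move=> ht; have Ut := inU t ht.
  apply: (is_derive_eq (is_derive_line (dc _ Ut))).
  rewrite deriveE; last exact: dc.
  rewrite diff_partialE; last exact: dc.
  by rewrite big1 // => i _; rewrite pc // mulr0.
have := @MVT _ (fun s : R => c (s *: v + x)) (fun=> 0) 0 1 ltr01.
case=> [| |t _].
  - by move=> t; rewrite in_itv /= => /andP[? ?]; apply: dphi; rewrite !ltW.
  - apply: derivable_within_continuous => t; rewrite in_itv /= => ht.
    by have [] := dphi t ht.
rewrite mul0r scale1r scale0r add0r /v subrK => /eqP; rewrite subr_eq0.
by move=> /eqP.
Qed.

Section KahlerManifold.
Context {R : realType} {m : nat} (M : kahler_manifold R m).
Hypothesis m2 : (2 <= m)%N.
Local Notation n := (2 * m)%N.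
Local Notation G a := (metric_mx (kahler_metric M) a).
Local Notation J a := (acs_mx (kahler_J M) a).
Local Notation dom a := (chart_dom (man_chart a)).
Local Notation phi a := (chart_map (man_chart a)).

Definition chart_img (a : man_index M) : set 'rV[R]_n := phi a @` dom a.
Local Notation U := chart_img.

Lemma open_chart_img a : open (U a).
Proof. exact: chart_img_open. Qed.

Lemma chart_metric_smooth a : smoothmx (U a) (G a).
Proof. by move=> i j; exact: metric_smooth. Qed.

Lemma chart_metricT a x : U a x -> (G a x)^T = G a x.
Proof. by case=> p hp <-; exact: (Defs.metric_sym (kahler_metric M) hp). Qed.

Lemma chart_metric_pos a x (v : 'rV[R]_n) : U a x -> v != 0 ->
  0 < (v *m G a x *m v^T) ord0 ord0.
Proof. by case=> p hp <- v0; exact: (Defs.metric_pos (kahler_metric M) hp v0).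
  Qed.

Lemma chart_metric_unit a x : U a x -> G a x \in unitmx.
Proof. by move=> Ux; apply: posdef_unitmx => v; exact: chart_metric_pos. Qed.

Lemma chart_J_smooth a : smoothmx (U a) (J a).
Proof. by move=> i j; exact: acs_smooth. Qed.

Lemma chart_JJ a x : U a x -> J a x *m J a x = - 1%:M.
Proof. by case=> p hp <-; exact: (acs_sqr (kahler_J M) hp). Qed.

Lemma chart_JgJ a x : U a x -> J a x *m G a x *m (J a x)^T = G a x.
Proof. by case=> p hp <-; exact: (kahler_hermitian hp). Qed.

Lemma chart_J_parallel a k x : U a x ->
  pmx k (J a) x = conn (G a) k x *m J a x - J a x *m conn (G a) k x.
Proof.
case=> p hp <- {x}; apply/matrixP => i l.
have := kahler_parallel k i l hp; rewrite /cov_deriv_endo -pmxE sumrB.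
move: (phi a p) => x h.
have DE (X Y : 'M[R]_n) : (X - Y) i l = X i l - Y i l by rewrite !mxE.
rewrite DE [X in _ = X - _]mxE [X in _ = _ - X]mxE.
have -> : \sum_j conn (G a) k x i j * J a x j l = \sum_j christoffel (G a) j k
  i x * J a x j l.
  by apply: eq_bigr => j _; rewrite connE.
have -> : \sum_j J a x i j * conn (G a) k x j l = \sum_j christoffel (G a) l k
  j x * J a x i j.
  by apply: eq_bigr => j _; rewrite connE mulrC.
by move: h; set s1 := \sum_p _; set s2 := \sum_p _ => h; lra.
Qed.

Definition hsc_at (a : man_index M) x c : Prop := forall X,
  riemann (G a) x X (X *m J a x) X (X *m J a x) = c * gdot (G a x) X X ^+ 2.

Lemma chart_kahler a x : U a x -> kahler_tensor (fun X =>
  X *m J a x) (riemann (G a) x).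
Proof.
exact: (riemann_kahler (@open_chart_img a) (@chart_metric_smooth a)
  (@chart_metricT a)
  (@chart_metric_pos a) (@chart_J_smooth a) (@chart_JgJ a)
    (@chart_J_parallel a)).
Qed.

Let n0 : (0 < n)%N. Proof. by rewrite muln_gt0 /= (leq_trans _ m2). Qed.

Lemma hsc_at_unique a x c c' : U a x -> hsc_at a x c -> hsc_at a x c' -> c = c'.
Proof.
move=> Ux h h'; pose X : 'rV[R]_n := delta_mx ord0 (Ordinal n0).
have X0 : X != 0.
  apply/eqP => /matrixP/(_ ord0 (Ordinal n0)); rewrite !mxE !eqxx => /eqP.
  by rewrite oner_eq0.
have gX : gdot (G a x) X X ^+ 2 != 0 by rewrite expf_neq0 // gt_eqF //
  chart_metric_pos.
by apply: (mulIf gX); rewrite -h -h'.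
Qed.

Definition overlap (a b : man_index M) : set 'rV[R]_n := phi a @`
  (dom a `&` dom b).

Lemma overlap_open a b : open (overlap a b).
Proof.
rewrite openE => _ [p [pa pb] <-].
have pU : U a (phi a p) by exists p.
have h1 : nbhs (phi a p) (U a) by apply: open_nbhs_nbhs; split => //;
  exact: open_chart_img.
have h2 : nbhs (phi a p) (chart_inv (man_chart a) @^-1` dom b).
  apply: (chart_inv_cont pU); rewrite chart_mapK //.
  by apply: open_nbhs_nbhs; split => //; exact: chart_dom_open.
apply: filterS (filterI h1 h2) => y [[q qa <-]] /=; rewrite chart_mapK // => qb.
by exists q.
Qed.

Lemma hsc_at_change a b p c : dom a p -> dom b p ->
  hsc_at a (phi a p) c -> hsc_at b (phi b p) c.
Proof.
move=> pa pb h Y.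
pose f := transition (man_chart a) (man_chart b).
have fE q : dom a q -> f (phi a q) = phi b q by move=> qa;
  rewrite /f /transition chart_mapK.
have sub x : overlap a b x -> U a x by case=> q [qa _] <-; exists q.
have Vp : overlap a b (phi a p) by exists p.
have mc x : overlap a b x -> G a x = 'J f x *m G b (f x) *m ('J f x)^T.
  by case=> q [qa qb] <-; rewrite fE //; exact:
    (Defs.metric_change (kahler_metric M) qa qb).
have fU x : overlap a b x -> U b (f x).
  by case=> q [qa qb] <-; rewrite fE //; exists q.
have sm : smoothmx (overlap a b) (G a).
  by move=> i j s x /sub Ux; exact: metric_smooth.
have Du := jacobian_unit (fun x hx => chart_metric_unit (sub x hx)) mc Vp.
have rc := riemann_change (@overlap_open a b) (@open_chart_img b) fU
  (@man_smooth _ _ M a b) sm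
  (fun x hx => chart_metricT (sub x hx)) (fun x hx =>
    chart_metric_unit (sub x hx))
  (@chart_metric_smooth b) (@chart_metricT b) (@chart_metric_unit b) mc.
have JD : J a (phi a p) *m 'J f (phi a p) = 'J f (phi a p) *m J b (phi b p).
  exact: (acs_change (kahler_J M) pa pb).
have hx := rc (phi a p) _ _ _ _ Vp.
(* The Jacobian is invertible, so every vector of the second chart comes from the first. *)
have [X ->] : exists X, Y = X *m 'J f (phi a p).
  by exists (Y *m invmx ('J f (phi a p))); rewrite mulmxKV.
rewrite -[X in riemann _ X](fE p pa) -mulmxA -JD mulmxA -hx h;
  congr (_ * _ ^+ 2).
by rewrite /gdot (mc _ Vp) (fE p pa) trmx_mul !mulmxA.
Qed.

Lemma hsc_at_near (cf : 'rV[R]_n -> R) a x :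
  (forall y, U a y -> hsc_at a y (cf y)) -> U a x ->
    \forall y \near x, cf y = cf x.
Proof.
move=> hcf Ux; have oU := @open_chart_img a.
apply: (partial0_near_const oU Ux).
- move=> y Uy; exact: (hsc_differentiable oU (@chart_metric_smooth a)
    (@chart_metric_pos a) (@chart_J_smooth a) hcf n0 Uy).
- move=> k y Uy.
  apply: (schur_partial oU (@chart_metric_smooth a) (@chart_metricT a)
    (@chart_metric_pos a) (@chart_J_smooth a) (@chart_JJ a) (@chart_JgJ a)
    (@chart_J_parallel a) hcf k _ Uy).
  by rewrite (leq_trans (_ : 3 <= 2 * 2)%N) // leq_mul2l.
Qed.

(** The sign condition is a parameter [P], so that both signs share the argument. *)
Lemma hsc_global (P : set R) : connected [set: M] -> P 0 ->
  (forall a p, dom a p -> exists2 c, P c & hsc_at a (phi a p) c) ->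
  exists2 c, P c & forall a p, dom a p -> hsc_at a (phi a p) c.
Proof.
move=> hconn P0 hP.
(* Connectedness does not exclude an empty [M]; the constant is then 0, by [P 0]. *)
have [p0|] := pselect (exists p : M, True); last first.
  move=> nM; exists 0 => // a p pa; exfalso; apply: nM; by exists p.
case: p0 => p0 _; have [a0 pa0] := man_cover p0; have [c Pc hc] := hP a0 p0 pa0.
exists c => //.
(* Quantifying over all charts frees [A] from any choice, and [AP] reduces membership to one chart.
   [A] is open and closed because the value is locally constant. *)
pose A : set M := [set p | forall a, dom a p -> hsc_at a (phi a p) c].
have AP a p : dom a p -> hsc_at a (phi a p) c -> A p.
  by move=> pa ha b pb; exact: hsc_at_change pa pb ha.
have loc a p : dom a p -> exists2 c', hsc_at a (phi a p) c' &
    \forall q \near p, dom a q /\ hsc_at a (phi a q) c'.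
  move=> pa.
  have ex y : exists c', U a y -> hsc_at a y c'.
    have [[q qa <-]|nU] := pselect (U a y); last by exists 0.
    by have [c' _ h] := hP a q qa; exists c'.
  have [cf hcf] := choice ex.
  have Up : U a (phi a p) by exists p.
  exists (cf (phi a p)); first exact: hcf.
  have h1 : nbhs p (dom a) by apply: open_nbhs_nbhs; split => //;
    exact: chart_dom_open.
  have h2 : nbhs p (phi a @^-1` [set y | cf y = cf (phi a p)]).
    by apply: (chart_map_cont pa); exact: hsc_at_near hcf Up.
  apply: filterS (filterI h1 h2) => q [qa /= <-]; split => //.
  by apply: hcf; exists q.
have oA : open A.
  rewrite openE => p Ap; have [a pa] := man_cover p;
    have [c' hc' near_c'] := loc a p pa.
  have cc' : c = c' by apply: hsc_at_unique (Ap a pa) hc'; exists p.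
  apply: filterS near_c' => q [qa hq]; apply: AP qa _; by rewrite cc'.
have cA : closed A.
  rewrite -openC openE => p nAp; have [a pa] := man_cover p.
  have [c' hc' near_c'] := loc a p pa.
  apply: filterS near_c' => q [qa hq] /= Aq; apply: nAp; apply: (AP a p pa).
  have -> // : c = c' by apply: hsc_at_unique (Aq a qa) hq; exists q.
have AT : A = [set: M].
  apply: hconn; first by exists p0; exact: AP hc.
  - by exists A => //; rewrite setTI.
  - by exists A => //; rewrite setTI.
move=> a p pa; have : A p by rewrite AT.
exact.
Qed.

Lemma nonneg_hsc_at alpha a p : alpha <= 3 / 2 * (m%:R ^+ 2 - 1) ->
  alpha_nonnegative (kahler_metric M) alpha -> dom a p ->
  exists c, [/\ 0 <= c, alpha < 3 / 2 * (m%:R ^+ 2 - 1) -> c = 0 &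
    hsc_at a (phi a p) c].
Proof.
move=> ha [aN hnn] pa; have Up : U a (phi a p) by exists p.
exact: (kahler_point_hsc m2 (chart_metricT Up) (fun v => chart_metric_pos Up)
  (chart_JJ Up) (chart_JgJ Up) (chart_kahler Up) aN (hnn a p pa) ha).
Qed.

Lemma nonpos_hsc_at alpha a p : alpha <= 3 / 2 * (m%:R ^+ 2 - 1) ->
  alpha_nonpositive (kahler_metric M) alpha -> dom a p ->
  exists c, [/\ c <= 0, alpha < 3 / 2 * (m%:R ^+ 2 - 1) -> c = 0 &
    hsc_at a (phi a p) c].
Proof.
move=> ha [aN hnp] pa; have Up : U a (phi a p) by exists p.
(* Reduction to the nonnegative case: the opposite of the curvature tensor is again a Kähler tensor,
   and every [alpha_sum] changes sign. *)
have hN E (hE : orthonormal_frame (G a) (phi a p) E) psi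
  (hpsi : orthonormal_basisS20 psi) :
    0 <= alpha_sum alpha (fun i => curv_form
      (fun X Y Z W => - riemann (G a) (phi a p) X Y Z W) (fun j =>
        row j E) (psi i)).
  have := hnp a p pa E hE psi hpsi; rewrite -oppr_ge0; congr (0 <= _).
  have cfN i : curv_form (fun X Y Z W => - riemann (G a) (phi a p) X Y Z W)
      (fun j => row j E) (psi i) = - second_kind (G a) (phi a p) E (psi i)
        (psi i).
    rewrite /curv_form /second_kind -sumrN; apply: eq_bigr => i1 _.
    rewrite -sumrN; apply: eq_bigr => i2 _; rewrite -sumrN;
      apply: eq_bigr => i3 _.
    by rewrite -sumrN; apply: eq_bigr => i4 _; rewrite !mulNr.
  rewrite /alpha_sum opprD -sumrN -mulrN -sumrN.
  by congr (_ + _ * _); apply: eq_bigr => i _; rewrite cfN.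
have [c [c0 ca hc]] := kahler_point_hsc m2 (chart_metricT Up) (fun v =>
  chart_metric_pos Up)
  (chart_JJ Up) (chart_JgJ Up) (kahler_tensorN (chart_kahler Up)) aN hN ha.
exists (- c); split; first by rewrite oppr_le0.
- by move=> /ca ->; rewrite oppr0.
- by move=> X; rewrite mulNr -hc opprK.
Qed.

Lemma hsc0_flat : (forall a p, dom a p -> hsc_at a (phi a p) 0) ->
  flat (kahler_metric M).
Proof.
move=> h a p pa X Y Z W; have Up : U a (phi a p) by exists p.
rewrite (riemann_const_hsc (@open_chart_img a) (@chart_metric_smooth a)
  (@chart_metricT a) (@chart_metric_pos a) (@chart_J_smooth a) (@chart_JJ a)
  (@chart_JgJ a) (@chart_J_parallel a) Up (h a p pa)).
by rewrite mul0r mul0r.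
Qed.

Lemma hsc_at_constant c : (forall a p, dom a p -> hsc_at a (phi a p) c) ->
  has_constant_hsc M c.
Proof.
by move=> h a p pa x g J0 X XX; rewrite (h a p pa) /gdot XX expr1n mulr1.
Qed.

End KahlerManifold.

Theorem theorem1p2 (R : realType) (m : nat) (M : kahler_manifold R m)
    (hm : (2 <= m)%N) (hconn : connected [set: M]) :
  [/\ forall alpha : R, alpha < 3 / 2 * (m%:R ^+ 2 - 1) ->
        alpha_nonnegative (kahler_metric M) alpha -> flat (kahler_metric M),
      forall alpha : R, alpha < 3 / 2 * (m%:R ^+ 2 - 1) ->
        alpha_nonpositive (kahler_metric M) alpha -> flat (kahler_metric M),
      alpha_nonnegative (kahler_metric M) (3 / 2 * (m%:R ^+ 2 - 1)) ->
        exists2 c : R, 0 <= c & has_constant_hsc M c &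
      alpha_nonpositive (kahler_metric M) (3 / 2 * (m%:R ^+ 2 - 1)) ->
        exists2 c : R, c <= 0 & has_constant_hsc M c].
Proof.
split=> [alpha ha hn|alpha ha hn|hn|hn].
- apply: hsc0_flat => a p pa.
  by have [c [_ /(_ ha) <-]] := nonneg_hsc_at hm (ltW ha) hn pa.
- apply: hsc0_flat => a p pa.
  by have [c [_ /(_ ha) <-]] := nonpos_hsc_at hm (ltW ha) hn pa.
- have [a p pa|c c0 hc] := @hsc_global _ _ M hm [set c | 0 <= c] hconn (lexx 0).
    by have [c [c0 _ hc]] := nonneg_hsc_at hm (lexx _) hn pa; exists c.
  by exists c => //; exact: hsc_at_constant.
- have [a p pa|c c0 hc] := @hsc_global _ _ M hm [set c | c <= 0] hconn (lexx 0).
    by have [c [c0 _ hc]] := nonpos_hsc_at hm (lexx _) hn pa; exists c.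
  by exists c => //; exact: hsc_at_constant.
Qed.
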